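(* Let $d\in\mathbb{N}$, $q\in[1,\infty)$, and let $\gamma=(\gamma_1,\dots,\gamma_d)$ satisfy $1=\gamma_1=\dots=\gamma_\nu<\gamma_{\nu+1}\le\dots\le\gamma_d$ for some $\nu\in\mathbb{N}$, $\nu\le d$. Define $$w(\nu,1)=3;\qquad w(\nu,q)=2 \text{ for } q\in(1,2];\qquad w(\nu,q)=(\nu-1)(q-2)+\min(q,3)\text{ for } q>2.$$ Then there exist positive constants $C_i=C_i(q,\gamma)$, $i=1,2,3$, such that for every $n\in\mathbb{N}$ and every $m\in\mathbb{N}$ with $m\ge C_1|Q_n^\gamma|\,n^{w(\nu,q)}$ there exist points $\xi^1,\dots,\xi^m\in\mathbb{T}^d$ such that for all $f\in\mathcal{T}(Q_n^\gamma)$ $$C_2\|f\|_q^q\le \frac1m\sum_{j=1}^m|f(\xi^j)|^q\le C_3\|f\|_q^q,$$ i.e. $\mathcal{T}(Q_n^\gamma)\in\mathcal{M}(m,q,C_2,C_3)$.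
   Context: $\mathbb{T}^d=[0,2\pi)^d$ is equipped with the normalized Lebesgue (probability) measure, and $\|f\|_q=\left(\int_{\mathbb{T}^d}|f|^q\,d\mu\right)^{1/q}$. For $\mathbf{s}\in\mathbb{Z}_+^d$ let $\rho(\mathbf{s})=\{\mathbf{k}\in\mathbb{Z}^d:[2^{s_j-1}]\le|k_j|<2^{s_j},\ j=1,\dots,d\}$, where $[x]$ is the integer part. The step hyperbolic cross is $Q_n^\gamma=\bigcup_{\mathbf{s}\in\mathbb{Z}_+^d:(\gamma,\mathbf{s})\le n}\rho(\mathbf{s})$, and for finite $Q\subset\mathbb{Z}^d$, $\mathcal{T}(Q)=\{\sum_{\mathbf{k}\in Q}c_{\mathbf{k}}e^{i(\mathbf{k},\mathbf{x})}: c_{\mathbf{k}}\in\mathbb{C}\}$; $|Q|$ is the cardinality of $Q$. For a subspace $X$ of $L_q$ ($1\le q<\infty$) of functions defined pointwise, $X\in\mathcal{M}(m,q,C_2,C_3)$ means there exist $m$ points $\xi^1,\dots,\xi^m$ in the domain with $C_2\|f\|_q^q\le\frac1m\sum_{j=1}^m|f(\xi^j)|^q\le C_3\|f\|_q^q$ for all $f\in X$. *)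

(* Defs.v *)
From HB Require Import structures.
From mathcomp Require Import all_boot all_order all_algebra.
From mathcomp Require Import all_classical all_reals all_analysis.
Set Implicit Arguments. Unset Strict Implicit. Unset Printing Implicit Defensive.
Import Order.TTheory GRing.Theory Num.Theory.
Import numFieldNormedType.Exports.
Local Open Scope classical_set_scope.
Local Open Scope ring_scope.

Section Defs.
Variable R : realType.

(* A box of integer frequency vectors, k_j in [-2^n, 2^n], encoded as a finite type.
   It contains the hyperbolic cross Q_n^gamma whenever all gamma_j >= 1
   (then s_j <= n, so |k_j| < 2^{s_j} <= 2^n). *)
Definition freq_box (d n : nat) := {ffun 'I_d -> 'I_((2 ^ n).*2.+1)}.

Definition freq (d n : nat) (k : freq_box d n) (j : 'I_d) : int :=
  (nat_of_ord (k j))%:Z - (2 ^ n)%:Z.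

(* rho(s): [2^{s_j-1}] <= |k_j| < 2^{s_j}; note [2^{s-1}] = (2^s)./2 for s : nat *)
Definition in_rho (d : nat) (s : 'I_d -> nat) (k : 'I_d -> int) : bool :=
  [forall j : 'I_d, ((2 ^ s j)./2 <= `|k j|%N)%N && (`|k j|%N < 2 ^ s j)%N].

Definition step_ok (d : nat) (gamma : 'I_d -> R) (n : nat) (s : 'I_d -> nat) : Prop :=
  \sum_(j < d) gamma j * (s j)%:R <= n%:R.

Definition hcross (d : nat) (gamma : 'I_d -> R) (n : nat) : {set freq_box d n} :=
  [set k : freq_box d n |
     `[< exists s : 'I_d -> nat, step_ok gamma n s /\ in_rho s (freq k) >]].

Definition phase (d n : nat) (k : freq_box d n) (x : 'I_d -> R) : R :=
  \sum_(j < d) (freq k j)%:~R * x j.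

(* |f(x)| for f = sum_{k in Q} c_k e^{i(k,x)}, c_k = a_k + i b_k *)
Definition trig_abs (d n : nat) (Q : {set freq_box d n})
    (a b : freq_box d n -> R) (x : 'I_d -> R) : R :=
  let re := \sum_(k in Q) (a k * cos (phase k x) - b k * sin (phase k x)) in
  let im := \sum_(k in Q) (a k * sin (phase k x) + b k * cos (phase k x)) in
  Num.sqrt (re ^+ 2 + im ^+ 2).

(* Integration against the normalized Lebesgue measure on [0,2pi)^d, written as
   an iterated integral (coordinate by coordinate). *)
Fixpoint torus_avg_rec (m : nat) (g : (nat -> R) -> R) (y : nat -> R) : R :=
  match m with
  | 0%N => g y
  | m'.+1 =>
      (2 * pi)^-1 *
      (\int[@lebesgue_measure R]_(t in `[0, 2 * pi[%classic)
          torus_avg_rec m' g (fun i => if i == m' then t else y i))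
  end.

Definition torus_avg (d : nat) (g : ('I_d -> R) -> R) : R :=
  torus_avg_rec d (fun y => g (fun j : 'I_d => y (nat_of_ord j))) (fun _ => 0).

Definition Lq_pow (d : nat) (q : R) (f : ('I_d -> R) -> R) : R :=
  torus_avg (fun x => powR `|f x| q).

Definition wexp (nu : nat) (q : R) : R :=
  if q == 1 then 3
  else if q <= 2 then 2
  else (nu%:R - 1) * (q - 2) + Num.min q 3.

End Defs.

(* Main.v *)
(** Normalize f in L_q on a grid finer than its frequencies. |f|^q is comparable to a
    sum of indicators of level sets at dyadic heights 2^l; taking the level sets from a
    2^l-net in the sup norm leaves few sets, and Chernoff bounds show that m random grid
    points count all of them correctly. It remains to bound sup-norm nets by exp(K / t^q).
    A convolution identity f = V * f exhibits f as a combination of translates of V with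
    square-summable coefficients, and random signs turn this into a packing bound. For
    q <= 2, V is the Dirichlet kernel of Q and the identity is applied to differences of two
    close f, whose mean square is small. For q > 2, V is cut into hyperbolic blocks of de la
    Vallee Poussin type and f is truncated at a height depending on the block: the part
    below contributes little in the sup norm, the part above has small mean square.
    A de la Vallee Poussin kernel on a box compares the grid with the torus. *)
Require Import Defs.
From HB Require Import structures.
From mathcomp Require Import all_boot all_order all_algebra.
From mathcomp Require Import all_classical all_reals all_analysis.
From mathcomp Require Import complex ring lra zify.
Import Order.TTheory GRing.Theory Num.Theory.
Import numFieldNormedType.Exports.
Local Open Scope classical_set_scope.
Local Open Scope ring_scope.
Set Implicit Arguments.
Unset Strict Implicit.
Unset Printing Implicit Defensive.

(** * Averages over finite types *)

(** All randomness lives on a finite grid with [2 ^ (n + 3)] nodes per axis, so probabilities are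
    finite averages and measure theory enters only when the grid is compared with the torus. The
    grid also fixes the power of [n]: a union bound over its points inside the packing argument
    costs [ln #|G|], of order [n], and the number of dyadic heights is of order [n] too. This gives
    [n ^ 2] for [q <= 2], with a further factor [n ^ ((nu - 1) * (q - 2))] for [q > 2]; both are
    dominated by [n ^ (wexp nu q)]. The two cases differ because packing needs mean squares while
    only [q]-th means are known. If [q <= 2], a sup bound of order [t] turns a [q]-th mean into a
    mean square of order [t ^ (2 - q)], so differences of close functions are cheap. If [q > 2],
    such an inequality holds only where [|f|] is large. What lies below the threshold must then be
    harmless in sup norm, which asks for kernels with controlled [L_1] norms: these are the blocks,
    about [n ^ (nu - 1)] of them, and their number enters the thresholds, hence the power
    [q - 2]. *)

Definition avg (R : numFieldType) (T : finType) (h : T -> R) : R :=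
  #|T|%:R^-1 * \sum_x h x.

Lemma eq_avg (R : numFieldType) (T : finType) (f g : T -> R) :
  f =1 g -> avg f = avg g.
Proof. by move=> fg; rewrite /avg; congr (_ * _); apply: eq_bigr => x _. Qed.

Lemma ler_avg (R : numFieldType) (T : finType) (f g : T -> R) :
  (forall x, f x <= g x) -> avg f <= avg g.
Proof. by move=> fg; rewrite ler_wpM2l ?invr_ge0 ?ler0n// ler_sum. Qed.

Lemma avg_ge0 (R : numFieldType) (T : finType) (f : T -> R) :
  (forall x, 0 <= f x) -> 0 <= avg f.
Proof. by move=> f0; rewrite mulr_ge0 ?invr_ge0 ?ler0n// sumr_ge0. Qed.

Lemma avg_cst (R : numFieldType) (T : finType) (c : R) :
  (0 < #|T|)%N -> avg (fun _ : T => c) = c.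
Proof.
move=> T0; rewrite /avg sumr_const -[c *+ _]mulr_natl mulrA mulVf ?mul1r//.
by rewrite pnatr_eq0 -lt0n.
Qed.

Lemma avgZl (R : numFieldType) (T : finType) (c : R) (f : T -> R) :
  avg (fun x => c * f x) = c * avg f.
Proof. by rewrite /avg -mulr_sumr mulrCA. Qed.

Lemma avgZr (R : numFieldType) (T : finType) (c : R) (f : T -> R) :
  avg (fun x => f x * c) = avg f * c.
Proof. by rewrite /avg -mulr_suml mulrA. Qed.

Lemma avgD (R : numFieldType) (T : finType) (f g : T -> R) :
  avg (fun x => f x + g x) = avg f + avg g.
Proof. by rewrite /avg big_split mulrDr. Qed.

Lemma avg_sum (R : numFieldType) (T : finType) (I : Type) (r : seq I) (P : pred I)
    (F : I -> T -> R) :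
  avg (fun x => \sum_(i <- r | P i) F i x) = \sum_(i <- r | P i) avg (F i).
Proof. by rewrite /avg exchange_big /= mulr_sumr. Qed.

Lemma exchange_avg (R : numFieldType) (S T : finType) (F : S -> T -> R) :
  avg (fun x => avg (F x)) = avg (fun y => avg (F^~ y)).
Proof. by rewrite {1}/avg -avg_sum -avgZl; apply: eq_avg => y. Qed.

(** Independence of the coordinates of a uniformly random function. It serves the Chernoff bounds as
    well as the tensor structure of the kernels. *)
Lemma avg_prod (R : numFieldType) (I T : finType) (F : I -> T -> R) :
  avg (fun x : {ffun I -> T} => \prod_i F i (x i)) = \prod_i avg (F i).
Proof.
rewrite /avg -bigA_distr_bigA big_split /= prodr_const card_ffun natrX exprVn.
by [].
Qed.

Lemma exists_lt_avg (R : realType) (T : finType) (f : T -> R) (c : R) :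
  (0 < #|T|)%N -> avg f < c -> exists x, f x < c.
Proof.
move=> T0 fc; apply: contrapT => /forallNP nx.
have : avg (fun _ : T => c) <= avg f.
  by apply: ler_avg => x; rewrite leNgt; apply/negP/nx.
by rewrite avg_cst// leNgt fc.
Qed.

Lemma ler_norm_avg (R : numFieldType) (T : finType) (f : T -> R) :
  `|avg f| <= avg (fun x => `|f x|).
Proof. by rewrite normrM ger0_norm ?invr_ge0// ler_wpM2l ?invr_ge0// ler_norm_sum. Qed.

Lemma avgN (R : numFieldType) (T : finType) (f : T -> R) :
  avg (fun x => - f x) = - avg f.
Proof. by rewrite /avg sumrN mulrN. Qed.

Lemma avgB (R : numFieldType) (T : finType) (f g : T -> R) :
  avg (fun x => f x - g x) = avg f - avg g.
Proof. by rewrite avgD avgN. Qed.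

Lemma CauchySchwarz_sum (R : realType) (I : finType) (f g : I -> R) :
  (\sum_i f i * g i) ^+ 2 <= (\sum_i f i ^+ 2) * (\sum_i g i ^+ 2).
Proof.
set A := \sum_i f i ^+ 2; set B := \sum_i g i ^+ 2; set C := \sum_i _.
have h (t : R) : 2 * t * C <= A + t ^+ 2 * B.
  rewrite /A /B /C !mulr_sumr -big_split /= ler_sum// => i _.
  by have := sqr_ge0 (f i - t * g i); rewrite sqrrB exprMn; lra.
have : 0 <= B by rewrite sumr_ge0// => i _; exact: sqr_ge0.
rewrite le_eqVlt => /predU1P[B0|B0].
  have A0 : 0 <= A by rewrite sumr_ge0// => i _; exact: sqr_ge0.
  have [->|C0] := eqVneq C 0; first by rewrite expr0n mulr_ge0// -B0.
  (* With [B = 0] the inequality [h] is linear in [t], and this [t] would give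
     [2 * (A + 1) <= A]. *)
  by have := h ((A + 1) / C); rewrite -B0 mulr0 addr0 -mulrA mulfVK//; lra.
have := h (C / B); have -> : 2 * (C / B) * C = 2 * (C ^+ 2 / B) by ring.
have -> : (C / B) ^+ 2 * B = C ^+ 2 / B by field; rewrite gt_eqF.
by rewrite -ler_pdivrMr//; lra.
Qed.

Lemma CauchySchwarz_avg (R : realType) (T : finType) (f g : T -> R) :
  (avg (fun x => f x * g x)) ^+ 2 <= avg (fun x => f x ^+ 2) * avg (fun x => g x ^+ 2).
Proof.
rewrite /avg exprMn [leRHS]mulrACA -expr2 ler_wpM2l ?sqr_ge0//.
exact: CauchySchwarz_sum.
Qed.

(** * Random sampling of level sets *)

Lemma expR1_le4 (R : realType) : expR 1 <= 4 :> R.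
Proof.
have h2 : expR (2^-1) <= 2 :> R.
  rewrite -[2^-1]opprK expRN invf_ple ?posrE ?expR_gt0//.
  by apply: le_trans (expR_ge1Dx _); lra.
have -> : (1 : R) = 2^-1 + 2^-1 by lra.
have : expR (2^-1) * expR 2^-1 <= 2 * 2 :> R by rewrite ler_pM ?expR_ge0.
by rewrite expRD; lra.
Qed.

(** Exponential moment at parameter 1. For a single draw with [p] the density of [U], the bound
    [e <= 4] gives the mean [1 + 3 p <= expR (3 p)]; independence does the rest. *)
Lemma chernoff_upper (R : realType) (G : finType) (m : nat) (U : G -> bool) :
  (0 < #|G|)%N ->
  avg (fun x : {ffun 'I_m -> G} => expR (\sum_i (U (x i))%:R)) <=
  expR (3 * m%:R * avg (fun g => (U g)%:R)) :> R.
Proof.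
move=> G0; under eq_avg do rewrite expR_sum.
rewrite (avg_prod (fun (_ : 'I_m) g => expR (U g)%:R)) prodr_const card_ord.
have -> : 3 * m%:R * avg (fun g : G => (U g)%:R) =
  3 * avg (fun g => (U g)%:R) * m%:R :> R by ring.
rewrite expRM_natr lerXn2r ?nnegrE ?expR_ge0//; first by apply: avg_ge0 => x; rewrite expR_ge0.
apply: le_trans (expR_ge1Dx _).
have -> : 1 + 3 * avg (fun g => (U g)%:R) = avg (fun g => 1 + 3 * (U g)%:R) :> R.
  by rewrite avgD avgZl avg_cst.
apply: ler_avg => g; case: (U g) => /=; last by rewrite expR0 mulr0 addr0.
by rewrite mulr1; apply: le_trans (expR1_le4 R) _; lra.
Qed.

(** Here [expR (- 1) <= 1 / 2] gives the single-draw bound [1 - p / 2], whence half of the expected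
    count in the lower estimate. *)
Lemma chernoff_lower (R : realType) (G : finType) (m : nat) (U : G -> bool) :
  (0 < #|G|)%N ->
  avg (fun x : {ffun 'I_m -> G} => expR (- \sum_i (U (x i))%:R)) <=
  expR (- (m%:R * avg (fun g => (U g)%:R) / 2)) :> R.
Proof.
move=> G0; under eq_avg do rewrite -sumrN expR_sum.
rewrite (avg_prod (fun (_ : 'I_m) g => expR (- (U g)%:R))) prodr_const card_ord.
have -> : - (m%:R * avg (fun g : G => (U g)%:R) / 2) =
  - avg (fun g => (U g)%:R) / 2 * m%:R :> R by ring.
rewrite expRM_natr lerXn2r ?nnegrE ?expR_ge0//; first by apply: avg_ge0 => x; rewrite expR_ge0.
apply: le_trans (expR_ge1Dx _).
have -> : 1 + - avg (fun g => (U g)%:R) / 2 = avg (fun g => 1 + (- 2^-1) * (U g)%:R) :> R.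
  by rewrite avgD avgZl avg_cst//; ring.
apply: ler_avg => g; case: (U g) => /=; last by rewrite oppr0 expR0 mulr0 addr0.
have e2 : 2 <= expR 1 :> R by apply: le_trans (expR_ge1Dx _); lra.
have : (expR 1)^-1 <= 2^-1 :> R by rewrite lef_pV2 ?posrE ?expR_gt0.
by rewrite mulr1 expRN; lra.
Qed.

(** Union bound in exponential form: [a s] and [b s] are the two exponential moments, scaled to
    reach 1 when the count leaves its range. Their total mean is below 1, so some sample keeps all
    of them below 1. *)
Lemma sampling_counts (R : realType) (G S : finType) (m : nat) (U : S -> G -> bool)
    (h : S -> R) :
  (0 < #|G|)%N -> \sum_s 2 * expR (- h s) < 1 ->
  exists x : {ffun 'I_m -> G}, forall s,
    let p := avg (fun g => (U s g)%:R) in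
    let cnt := \sum_i (U s (x i))%:R in
    cnt <= 3 * m%:R * p + h s /\ m%:R * p / 2 - h s <= cnt :> R.
Proof.
move=> G0 hs.
pose p s : R := avg (fun g => (U s g)%:R).
pose cnt (x : {ffun 'I_m -> G}) s : R := \sum_i (U s (x i))%:R.
pose a s x := expR (- (3 * m%:R * p s + h s)) * expR (cnt x s).
pose b s x := expR (m%:R * p s / 2 - h s) * expR (- cnt x s).
have [||x hx] := @exists_lt_avg R {ffun 'I_m -> G} (fun x => \sum_s (a s x + b s x)) 1.
- by rewrite card_ffun expn_gt0 G0.
- apply: le_lt_trans hs; rewrite avg_sum ler_sum// => s _.
  rewrite avgD !avgZl (_ : 2 * _ = expR (- h s) + expR (- h s)); last by ring.
  apply: lerD.
    apply: le_trans (_ : expR (- (3 * m%:R * p s + h s)) * expR (3 * m%:R * p s) <= _).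
      by rewrite ler_wpM2l ?expR_ge0// chernoff_upper.
    by rewrite -!expRD ler_expR; lra.
  apply: le_trans (_ : expR (m%:R * p s / 2 - h s) * expR (- (m%:R * p s / 2)) <= _).
    by rewrite ler_wpM2l ?expR_ge0// chernoff_lower.
  by rewrite -!expRD ler_expR; lra.
exists x => s /=; rewrite -/(p s) -/(cnt x s).
have : a s x + b s x < 1.
  apply: le_lt_trans hx; rewrite (bigD1 s)//= lerDl sumr_ge0// => t _.
  by rewrite addr_ge0// mulr_ge0// expR_ge0.
have a0 : 0 <= a s x by rewrite mulr_ge0 ?expR_ge0.
have b0 : 0 <= b s x by rewrite mulr_ge0 ?expR_ge0.
move=> ab; have : a s x < 1 by lra.
have : b s x < 1 by lra.
by rewrite /a /b -!expRD !expR_lt1; lra.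
Qed.

Lemma ler_powR2r (R : realType) (q a b : R) : 0 <= q -> 0 <= a -> a <= b -> a `^ q <= b `^ q.
Proof. by move=> q0 a0 ab; apply: ge0_ler_powR => //; rewrite nnegrE// (le_trans a0). Qed.

(** Heights start at [1 / 4] because values of [|f|] below [1 / 2], twice the lowest height, carry
    at most half of a mean equal to 1 and need no level set. *)
Definition dyad (R : realType) (l : nat) : R := 2 ^+ l / 4.

Lemma dyad_gt0 (R : realType) (l : nat) : 0 < dyad R l.
Proof. by rewrite divr_gt0// exprn_gt0. Qed.

Lemma dyadS (R : realType) (l : nat) : dyad R l.+1 = 2 * dyad R l.
Proof. by rewrite /dyad exprS mulrA. Qed.

Lemma powR_dyadS (R : realType) (q : R) (l : nat) : 1 <= q ->
  2 * dyad R l `^ q <= dyad R l.+1 `^ q.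
Proof.
move=> q1; rewrite dyadS powRM// ?(ltW (dyad_gt0 _ _))//.
by rewrite ler_wpM2r ?powR_ge0// le1r_powR//; lra.
Qed.

Lemma sum_dyad (R : realType) (q : R) (L : nat) : 1 <= q ->
  \sum_(l < L) dyad R l `^ q <= dyad R L `^ q.
Proof.
move=> q1; elim: L => [|L IH]; first by rewrite big_ord0 powR_ge0.
by rewrite big_ord_recr /=; apply: le_trans (powR_dyadS _ q1); lra.
Qed.

(** The active terms grow at least by a factor 2 from one level to the next, so the highest of them,
    at most [a ^ q], dominates. *)
Lemma sum_dyad_le (R : realType) (q a : R) (L : nat) : 1 <= q -> 0 <= a ->
  \sum_(l < L) dyad R l `^ q * (dyad R l <= a :> R)%:R <= 2 * a `^ q.
Proof.
move=> q1 a0; elim: L => [|L IH]; first by rewrite big_ord0 mulr_ge0// powR_ge0.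
rewrite big_ord_recr /=; case: (boolP (dyad R L <= a)) => La; last by rewrite mulr0 addr0.
apply: le_trans (_ : \sum_(l < L) dyad R l `^ q + dyad R L `^ q <= _).
  rewrite mulr1 lerD2r ler_sum// => l _.
  by case: (_ <= a); rewrite ?mulr1// mulr0 powR_ge0.
have := sum_dyad L q1.
have : dyad R L `^ q <= a `^ q by apply: ler_powR2r => //; [lra|exact: ltW (dyad_gt0 _ _)].
by lra.
Qed.

Lemma dyad_locate (R : realType) (a : R) (L : nat) : 2^-1 <= a -> a < 2 * dyad R L ->
  exists2 l, (l < L)%N & 2 * dyad R l <= a /\ a < 4 * dyad R l.
Proof.
move=> a0; elim: L => [|L IH]; first by rewrite /dyad expr0; lra.
rewrite dyadS => aL; have [la|la] := ltP a (2 * dyad R L).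
  by have [l lL hl] := IH la; exists l => //; rewrite (ltn_trans lL).
by exists L => //; split => //; lra.
Qed.

(* |f|^q is compared with a combination of indicators of level sets; each level
   set is taken from a net element, so that only finitely many sets need a
   Chernoff bound. *)
Lemma sampling (R : realType) (G : finType) (F : {ffun G -> R} -> Prop) (q D : R)
    (L m : nat) (net : nat -> seq {ffun G -> R}) :
  (0 < #|G|)%N -> 1 <= q -> 0 < D -> (0 < L)%N -> (0 < m)%N ->
  (forall f, F f -> avg (fun x => `|f x| `^ q) = 1) ->
  (forall f, F f -> forall x, `|f x| < 2 * dyad R L) ->
  (forall f l, F f -> (l < L)%N ->
    exists2 g, g \in net l & forall x, `|f x - g x| <= dyad R l / 2) ->
  (forall l, (l < L)%N -> 4 * L%:R * (size (net l))%:R <= expR (D / dyad R l `^ q)) ->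
  8 * 4 `^ q * L%:R * D <= m%:R ->
  exists x : 'I_m -> G, forall f, F f ->
    (16 * 4 `^ q)^-1 <= m%:R^-1 * \sum_i `|f (x i)| `^ q <= 1 + 7 * 4 `^ q.
Proof.
move=> G0 q1 D0 L0 m0 Favg Fsup Fnet netcard mD.
have A4 : 4 <= 4 `^ q :> R by rewrite le1r_powR//; lra.
have mR : 0 < m%:R :> R by rewrite ltr0n.
have LR : 0 < L%:R :> R by rewrite ltr0n.
pose S := {l : 'I_L & 'I_(size (net l))}.
pose lev (s : S) : 'I_L := tag s.
pose elt (s : S) := nth [ffun => 0] (net (tag s)) (tagged s).
(* An intermediate threshold: for a net element within [dyad / 2] of [f], [|f| >= 2 * dyad] forces
   [U], and [U] forces [|f| >= dyad]. *)
pose U (s : S) x := 3 / 2 * dyad R (lev s) <= `|elt s x|.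
(* The deviation is inversely proportional to the weight of the level, so that every level adds the
   same error [D / m] to the weighted count. *)
pose h (s : S) := D / dyad R (lev s) `^ q.
have Aq q' l : 0 < dyad R l `^ q' by rewrite powR_gt0 ?dyad_gt0.
have hsum : \sum_s 2 * expR (- h s) < 1.
  have -> : \sum_(s : S) 2 * expR (- h s) =
      \sum_(l < L) \sum_(k < size (net l)) 2 * expR (- (D / dyad R l `^ q)).
    by rewrite sig_big_dep /=.
  apply: le_lt_trans (_ : \sum_(l < L) (2 * L%:R)^-1 < 1); last first.
    by rewrite sumr_const card_ord -[_ *+ _]mulr_natr invfM mulfVK ?gt_eqF//; lra.
  apply: ler_sum => l _; rewrite sumr_const card_ord -[_ *+ _]mulr_natr.
  have := netcard l (ltn_ord l); set e := D / _ => he.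
  rewrite expRN mulrAC ler_pdivrMr ?expR_gt0// ler_pdivlMl; last by lra.
  by apply: le_trans he; lra.
have [x hx] := sampling_counts m U G0 hsum.
exists x => f Ff.
have [rep hrep] : exists rep : 'I_L -> S, forall l : 'I_L, lev (rep l) = l /\
    forall y, `|f y - elt (rep l) y| <= dyad R l / 2.
  have ex (l : 'I_L) : exists s : S, lev s = l /\
      forall y, `|f y - elt s y| <= dyad R l / 2.
    have [g gn hg] := Fnet f l Ff (ltn_ord l).
    have gi : (index g (net l) < size (net l))%N by rewrite index_mem.
    exists (Tagged (fun l : 'I_L => 'I_(size (net l))) (Ordinal gi)).
    by split => // y; rewrite /elt /= nth_index.
  by have [rep] := choice ex; exists rep.
pose W y : R := \sum_(l < L) dyad R l `^ q * (U (rep l) y)%:R.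
have W2 y : W y <= 2 * `|f y| `^ q.
  apply: le_trans (sum_dyad_le L q1 (normr_ge0 _)); apply: ler_sum => l _.
  rewrite ler_wpM2l ?powR_ge0// ler_nat; have [lr hl] := hrep l.
  case: (boolP (U _ _)) => //; rewrite /U lr => Uy; case: leP => //=.
  have := hl y; have := ler_dist_dist (f y) (elt (rep l) y).
  move=> h1 h2 h3; exfalso; move: (le_trans h1 h2); rewrite ler_norml => /andP[h4 h5].
  lra.
have fW y : `|f y| `^ q <= 2^-1 + 4 `^ q * W y.
  have W0 (l : 'I_L) : 0 <= dyad R l `^ q * (U (rep l) y)%:R by rewrite mulr_ge0 ?powR_ge0.
  have W00 : 0 <= W y by rewrite sumr_ge0.
  have [fy|fy] := ltP `|f y| 2^-1.
    apply: le_trans (_ : 2^-1 <= _); last by rewrite lerDl mulr_ge0 ?powR_ge0.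
    apply: le_trans (ler_powR2r _ (normr_ge0 _) (ltW fy)) _; first by lra.
    by rewrite ge1r_powR//; lra.
  have [l lL [fl1 fl2]] := dyad_locate fy (Fsup f Ff y).
  have [lr hl] := hrep (Ordinal lL).
  have Uy : U (rep (Ordinal lL)) y.
    rewrite /U lr /=; have := hl y; have := ler_dist_dist (f y) (elt (rep (Ordinal lL)) y).
    move=> h1 h2; move: (le_trans h1 h2); rewrite ler_norml /= => /andP[h4 h5]; lra.
  apply: le_trans (_ : 4 `^ q * dyad R l `^ q <= _).
    rewrite -powRM//; last exact: ltW (dyad_gt0 _ _).
    by apply: ler_powR2r => //; [lra|exact: ltW].
  apply: le_trans (_ : 4 `^ q * W y <= _); last by rewrite lerDr invr_ge0.
  rewrite ler_wpM2l ?powR_ge0// /W (bigD1 (Ordinal lL))//= Uy mulr1 lerDl.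
  by rewrite sumr_ge0.
pose emp (k : G -> R) := m%:R^-1 * \sum_(i < m) k (x i).
have mono k k' : (forall y, k y <= k' y) -> emp k <= emp k'.
  by move=> kk; rewrite ler_wpM2l ?invr_ge0 ?ler0n// ler_sum.
have avgW_ub : avg W <= 2.
  by apply: le_trans (ler_avg W2) _; rewrite avgZl Favg// mulr1.
have avgW_lb : 2^-1 <= 4 `^ q * avg W.
  have := ler_avg fW; rewrite avgD avg_cst// avgZl Favg//; lra.
(* The main term [avg W / 2] is at least [1 / (4 * 4 ^ q)], so at least half of it survives this
   error; with [W <= 2 * |f| ^ q] this is the origin of [16 * 4 ^ q]. The upper constant comes from
   [1 / 2 + 6 * 4 ^ q + 1 / 8]. *)
have LDm : 4 `^ q * (L%:R * D / m%:R) <= 8^-1.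
  by rewrite mulrA ler_pdivrMr//; lra.
have empWE : emp W = \sum_(l < L) dyad R l `^ q * (m%:R^-1 * \sum_i (U (rep l) (x i))%:R).
  rewrite /emp exchange_big /= mulr_sumr; apply: eq_bigr => l _.
  by rewrite -mulr_sumr mulrCA.
have avgWE : avg W = \sum_(l < L) dyad R l `^ q * avg (fun y => (U (rep l) y)%:R).
  by rewrite /W avg_sum; apply: eq_bigr => l _; rewrite avgZl.
have hE (l : 'I_L) : dyad R l `^ q * (m%:R^-1 * h (rep l)) = D / m%:R.
  rewrite /h (hrep l).1; field.
  by rewrite !gt_eqF//= dyad_gt0.
have hS : \sum_(l < L) dyad R l `^ q * (m%:R^-1 * h (rep l)) = L%:R * D / m%:R.
  under eq_bigr do rewrite hE.
  by rewrite sumr_const card_ord -[_ *+ _]mulr_natl mulrA.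
have empW_ub : emp W <= 3 * avg W + L%:R * D / m%:R.
  rewrite empWE avgWE -hS mulr_sumr -big_split /= ler_sum// => l _.
  rewrite -[3 * _]mulrCA -mulrDr ler_wpM2l ?powR_ge0//.
  have [/= h1 _] := hx (rep l).
  rewrite ler_pdivrMl// mulrDr mulVKf ?gt_eqF//.
  apply: le_trans h1 _; rewrite lerD2r le_eqVlt; apply/orP; left; apply/eqP; ring.
have empW_lb : avg W / 2 - L%:R * D / m%:R <= emp W.
  rewrite empWE avgWE -hS mulr_suml -sumrB ler_sum// => l _.
  rewrite -mulrA -mulrBr ler_wpM2l ?powR_ge0//.
  have [/= _ h1] := hx (rep l).
  rewrite ler_pdivlMl// mulrBr mulVKf ?gt_eqF// mulrA.
  by apply: h1.
have LD0 : 0 <= L%:R * D / m%:R by rewrite divr_ge0 ?mulr_ge0 ?ltW.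
rewrite -/(emp (fun y => `|f y| `^ q)); apply/andP; split.
  have h1 : emp W <= 2 * emp (fun y => `|f y| `^ q).
    apply: le_trans (mono _ _ W2) _.
    by rewrite /emp -mulr_sumr mulrCA.
  rewrite invfM ler_pdivrMl// -[(4 `^ q)^-1]mulr1 ler_pdivrMl; last by lra.
  apply: le_trans (_ : 4 `^ q * (8 * emp W) <= _); last first.
    by rewrite ler_wpM2l ?powR_ge0//; lra.
  apply: le_trans (_ : 4 `^ q * (8 * (avg W / 2 - L%:R * D / m%:R)) <= _); last first.
    by rewrite ler_wpM2l ?powR_ge0// ler_wpM2l.
  by lra.
apply: le_trans (mono _ _ fW) _.
rewrite /emp big_split /= -mulr_sumr sumr_const card_ord mulrDr -[2^-1 *+ m]mulr_natr.
rewrite (mulrC m%:R^-1 (2^-1 * _)) mulfK ?gt_eqF// mulrCA -/(emp W).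
have : 4 `^ q * emp W <= 4 `^ q * (6 + L%:R * D / m%:R).
  by rewrite ler_wpM2l ?powR_ge0//; lra.
by lra.
Qed.

(** * Packing bounds by random signs *)

(** The first-order term is kept exact, so that it vanishes in the mean of a centred variable and
    only a Gaussian factor remains. *)
Lemma expR_le_quad (R : realType) (x : R) : expR x <= x + expR (4 * x ^+ 2).
Proof.
have q0 : 0 <= x ^+ 2 by exact: sqr_ge0.
have e1 := expR_ge1Dx (4 * x ^+ 2).
have [x1|x1] := lerP 4^-1 x.
  have : expR x <= expR (4 * x ^+ 2) by rewrite ler_expR; nra.
  lra.
have [x2|x2] := lerP x (- 4^-1).
  have : expR x <= 1 by rewrite expR_le1; lra.
  nra.
have : expR x <= (1 - x)^-1.
  rewrite -[x in expR x]opprK expRN lef_pV2 ?posrE ?expR_gt0//; last by lra.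
  exact: expR_ge1Dx.
have : (1 - x)^-1 <= 1 + x + 4 * x ^+ 2.
  have x3 : 0 < 1 - x by lra.
  rewrite -[leLHS]mul1r ler_pdivrMr//; nra.
lra.
Qed.

Definition sgb (R : realType) (b : bool) : R := if b then 1 else - 1.

(* The weight of [z] when the signs [sgb (z i)] are independent with mean [b i]. *)
Definition sgw (R : realType) (I : finType) (b : I -> R) (z : {ffun I -> bool}) : R :=
  \prod_i ((1 + b i * sgb R (z i)) / 2).

Lemma sgw_ge0 (R : realType) (I : finType) (b : I -> R) (z : {ffun I -> bool}) :
  (forall i, `|b i| <= 1) -> 0 <= sgw b z.
Proof.
move=> b1; apply: prodr_ge0 => i _; have := b1 i; rewrite ler_norml => /andP[? ?].
by rewrite /sgb; case: (z i); lra.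
Qed.

Lemma sum_sgw (R : realType) (I : finType) (b : I -> R) : \sum_z sgw b z = 1.
Proof.
rewrite /sgw -(bigA_distr_bigA (fun i (e : bool) => (1 + b i * sgb R e) / 2)) big1// => i _.
by rewrite big_bool /sgb /=; field.
Qed.

(** In each coordinate the two squares add up to [(1 + b_i ^ 2) / 2]. This is the [L_2] norm of the
    tilted measure, against which Cauchy-Schwarz bounds the size of a set from below. *)
Lemma sum_sgw_sqr (R : realType) (I : finType) (b : I -> R) :
  \sum_z sgw b z ^+ 2 <= 2 ^- #|I| * expR (\sum_i b i ^+ 2).
Proof.
have -> : \sum_z sgw b z ^+ 2 =
    \sum_(z : {ffun I -> bool}) \prod_i ((1 + b i * sgb R (z i)) / 2) ^+ 2.
  by apply: eq_bigr => z _; rewrite prodrXl.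
rewrite -(bigA_distr_bigA (fun i (e : bool) => ((1 + b i * sgb R e) / 2) ^+ 2)).
rewrite expR_sum -exprVn -prodr_const -big_split /= ler_prod// => i _.
apply/andP; split; first by rewrite sumr_ge0// => e _; exact: sqr_ge0.
rewrite big_bool /sgb /= ler_pdivlMl//; apply: le_trans (expR_ge1Dx _).
by rewrite le_eqVlt; apply/orP; left; apply/eqP; field.
Qed.

(** Each summand is centred under [sgw b], and [sgb - b_i] lies in [[-2, 2]], so [expR_le_quad]
    leaves the exponent [4 * (2 v_i) ^ 2]. *)
Lemma sgw_exp (R : realType) (I : finType) (b v : I -> R) : (forall i, `|b i| <= 1) ->
  \sum_z sgw b z * expR (\sum_i (sgb R (z i) - b i) * v i) <=
  expR (16 * \sum_i v i ^+ 2).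
Proof.
move=> b1.
have -> : \sum_z sgw b z * expR (\sum_i (sgb R (z i) - b i) * v i) =
    \sum_(z : {ffun I -> bool}) \prod_i
      ((1 + b i * sgb R (z i)) / 2 * expR ((sgb R (z i) - b i) * v i)).
  by apply: eq_bigr => z _; rewrite expR_sum big_split.
rewrite -(bigA_distr_bigA (fun i (e : bool) =>
  (1 + b i * sgb R e) / 2 * expR ((sgb R e - b i) * v i))).
rewrite mulr_sumr expR_sum ler_prod// => i _.
have := b1 i; rewrite ler_norml => /andP[bl bu].
have p1 : 0 <= (1 + b i) / 2 by lra.
have p2 : 0 <= (1 - b i) / 2 by lra.
rewrite big_bool /sgb /= mulr1 mulrN1.
apply/andP; split; first by rewrite addr_ge0// mulr_ge0// expR_ge0.
have key t : `|t| <= 2 -> expR (t * v i) <= t * v i + expR (16 * v i ^+ 2).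
  rewrite ler_norml => /andP[t1 t2].
  apply: le_trans (expR_le_quad _) _; rewrite lerD2l ler_expR exprMn.
  have : 0 <= v i ^+ 2 by exact: sqr_ge0.
  have : t ^+ 2 <= 4 by nra.
  nra.
have k1 : expR ((1 - b i) * v i) <= (1 - b i) * v i + expR (16 * v i ^+ 2).
  by apply: key; rewrite ler_norml; apply/andP; split; lra.
have k2 : expR ((- 1 - b i) * v i) <= (- 1 - b i) * v i + expR (16 * v i ^+ 2).
  by apply: key; rewrite ler_norml; apply/andP; split; lra.
apply: le_trans (lerD (ler_wpM2l p1 k1) (ler_wpM2l p2 k2)) _.
by rewrite le_eqVlt; apply/orP; left; apply/eqP; field.
Qed.

Lemma sgw_tail (R : realType) (I : finType) (b v : I -> R) (V e : R) :
  (forall i, `|b i| <= 1) -> 0 < V -> 0 < e -> \sum_i v i ^+ 2 <= V ->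
  \sum_(z : {ffun I -> bool} | e <= `|\sum_i (sgb R (z i) - b i) * v i|) sgw b z <=
  2 * expR (- (e ^+ 2 / (64 * V))).
Proof.
(* This [lam] minimizes [16 * lam ^ 2 * V - lam * e], with minimum [- e ^ 2 / (64 * V)]. *)
move=> b1 V0 e0 vV; pose lam := e / (32 * V).
have lam0 : 0 < lam by rewrite divr_gt0// mulr_gt0.
pose X (z : {ffun I -> bool}) := \sum_i (sgb R (z i) - b i) * v i.
have lamX s z : s * lam * X z = \sum_i (sgb R (z i) - b i) * (s * lam * v i).
  by rewrite /X mulr_sumr; apply: eq_bigr => i _; ring.
have one s : s ^+ 2 = 1 -> \sum_z sgw b z * expR (s * lam * X z) <= expR (16 * lam ^+ 2 * V).
  move=> s1; under eq_bigr do rewrite lamX.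
  apply: le_trans (sgw_exp _ b1) _; rewrite ler_expR -mulrA ler_pM2l//.
  have -> : \sum_i (s * lam * v i) ^+ 2 = \sum_i lam ^+ 2 * v i ^+ 2.
    by apply: eq_bigr => i _; rewrite 2!(@exprMn R) s1 mul1r.
  by rewrite -mulr_sumr ler_wpM2l// sqr_ge0.
apply: le_trans (_ : \sum_z (sgw b z * expR (1 * lam * X z) +
    sgw b z * expR (- 1 * lam * X z)) * expR (- (lam * e)) <= _).
  rewrite [leRHS](bigID (fun z => e <= `|X z|)) /= -[leLHS]addr0 lerD//; last first.
    by rewrite sumr_ge0// => z _; rewrite mulr_ge0 ?addr_ge0 ?mulr_ge0 ?expR_ge0 ?sgw_ge0.
  apply: ler_sum => z ez; rewrite -mulrDr -mulrA -[leLHS]mulr1 ler_wpM2l ?sgw_ge0//.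
  rewrite mulrDl -!expRD.
  have g0 t : 0 <= expR t :> R by exact: expR_ge0.
  have e1 t : 0 <= t -> 1 <= expR t :> R.
    by move=> t0; apply: le_trans (expR_ge1Dx t); rewrite lerDl.
  have [X0|X0] := lerP 0 (X z).
    rewrite ger0_norm// in ez; rewrite -[leLHS]addr0 lerD//; apply: e1.
    by rewrite mul1r subr_ge0 ler_pM2l.
  rewrite ltr0_norm// in ez; rewrite -[leLHS]add0r lerD//; apply: e1.
  by rewrite mulN1r mulNr -mulrN subr_ge0 ler_pM2l.
rewrite -mulr_suml big_split /=.
apply: le_trans (_ : (2 * expR (16 * lam ^+ 2 * V)) * expR (- (lam * e)) <= _).
  rewrite ler_wpM2r ?expR_ge0//; have := one 1 (expr1n _ _).
  have : (- 1 : R) ^+ 2 = 1 by rewrite sqrrN expr1n.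
  by move/one; lra.
rewrite -mulrA -expRD ler_pM2l// ler_expR le_eqVlt; apply/orP; left; apply/eqP.
by rewrite /lam; field; rewrite gt_eqF.
Qed.

(* Each [f] in a separated family owns the sign vectors [z] for which
   [\sum_i z_i v_i] is close to [f]; these sets are disjoint and, by
   Cauchy-Schwarz against the tilted measure [sgw b], none of them is small. *)
Lemma sgn_packing (R : realType) (I G : finType) (v : I -> G -> R) (V e K : R)
    (s : seq {ffun G -> R}) :
  0 < V -> 0 < e -> (forall x, \sum_i v i x ^+ 2 <= V) ->
  64 * V * ln (4 * #|G|%:R) <= e ^+ 2 -> (0 < #|G|)%N ->
  (forall f, f \in s -> exists b : I -> R, [/\ forall i, `|b i| <= 1,
     \sum_i b i ^+ 2 <= K & forall x, `|f x - \sum_i b i * v i x| <= e]) ->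
  pairwise (fun f g : {ffun G -> R} => `[< exists x, 4 * e < `|f x - g x| >]) s ->
  (size s)%:R <= 4 * expR K.
Proof.
move=> V0 e0 vV Ve G0 sb sep.
(* Of the radius [2 * e], one [e] pays for the distance from [f] to the mean combination, the other
   for the random deviation from it. *)
pose E (f : {ffun G -> R}) : {set {ffun I -> bool}} :=
  [set z : {ffun I -> bool} | [forall x, `|f x - \sum_i sgb R (z i) * v i x| < 2 * e]]%SET.
have Ecard f : f \in s -> 2 ^+ #|I| <= (4 * expR K) * #|E f|%:R.
  move=> /sb[b [b1 bK bf]].
  (* Union bound over the points of [G]: the logarithmic hypothesis makes each tail at most
     [1 / (2 * #|G|)]. *)
  have half : 2^-1 <= \sum_(z in E f) sgw b z.
    have := sum_sgw b; rewrite (bigID (fun z => z \in E f)) /= => tot.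
    suff : \sum_(z | z \notin E f) sgw b z <= 2^-1 by lra.
    pose bad x (z : {ffun I -> bool}) := e <= `|\sum_i (sgb R (z i) - b i) * v i x|.
    apply: le_trans (_ : \sum_x \sum_(z | bad x z) sgw b z <= _).
      rewrite (exchange_big_dep xpredT)//= [leRHS](bigID (fun z => z \in E f)) /=.
      rewrite -[leLHS]add0r lerD//.
        by rewrite sumr_ge0// => z _; rewrite sumr_ge0// => x _; exact: sgw_ge0.
      apply: ler_sum => z; rewrite inE negb_forall => /existsP[x]; rewrite -leNgt => xz.
      have xb : bad x z.
        rewrite /bad; under eq_bigr do rewrite mulrBl.
        rewrite sumrB.
        have -> : \sum_i sgb R (z i) * v i x - \sum_i b i * v i x =
          (f x - \sum_i b i * v i x) - (f x - \sum_i sgb R (z i) * v i x) by ring.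
        have := bf x; have := lerB_dist (f x - \sum_i sgb R (z i) * v i x) (f x - \sum_i b i * v i x).
        by rewrite distrC; lra.
      by rewrite (bigD1 x)//= lerDl sumr_ge0// => y _; exact: sgw_ge0.
    apply: le_trans (_ : \sum_(x : G) 2 * expR (- (e ^+ 2 / (64 * V))) <= _).
      by apply: ler_sum => x _; exact: sgw_tail.
    rewrite sumr_const -[_ *+ _]mulr_natl expRN.
    have : 4 * #|G|%:R <= expR (e ^+ 2 / (64 * V)).
      rewrite -[leLHS]lnK ?posrE ?mulr_gt0 ?ltr0n// ler_expR ler_pdivlMr ?mulr_gt0//.
      by rewrite mulrC.
    set t := expR _ => ht; rewrite mulrA ler_pdivrMr ?expR_gt0//; lra.
  have CS : (\sum_(z in E f) sgw b z) ^+ 2 <= #|E f|%:R * \sum_z sgw b z ^+ 2.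
    have := CauchySchwarz_sum (fun z => (z \in E f)%:R) (sgw b).
    have -> : \sum_z (z \in E f)%:R * sgw b z = \sum_(z in E f) sgw b z.
      by rewrite [RHS]big_mkcond; apply: eq_bigr => z _; case: (z \in E f); rewrite ?mul1r ?mul0r.
    have -> : \sum_z (z \in E f)%:R ^+ 2 = #|E f|%:R :> R.
      rewrite -sum1_card natr_sum [RHS]big_mkcond; apply: eq_bigr => z _.
      by case: (z \in E f); rewrite ?expr1n ?expr0n.
    by [].
  have := sum_sgw_sqr b => sq.
  have : 4^-1 <= #|E f|%:R * (2 ^- #|I| * expR K).
    apply: le_trans (_ : (\sum_(z in E f) sgw b z) ^+ 2 <= _); first by nra.
    apply: le_trans CS _; rewrite ler_wpM2l ?ler0n//; apply: le_trans sq _.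
    by rewrite ler_wpM2l ?invr_ge0 ?exprn_ge0// ler_expR.
  by rewrite mulrCA ler_pdivlMl ?exprn_gt0//; lra.
(* A common sign vector would put [f] and [g] within [4 * e] of each other at every point. *)
have disj : pairwise (fun f g => (E f :&: E g)%SET == finset.set0) s.
  apply: sub_pairwise sep => f g /asboolP[x fg].
  apply/negPn/negP => /finset.set0Pn[z]; rewrite !inE => /andP[/forallP/(_ x) h1 /forallP/(_ x) h2].
  have := ler_distD (\sum_i sgb R (z i) * v i x) (f x) (g x).
  rewrite [X in _ <= _ + X]distrC; lra.
have sumE : (\sum_(f <- s) #|E f| <= 2 ^ #|I|)%N.
  have -> : (2 ^ #|I| = #|{: {ffun I -> bool}}|)%N by rewrite card_ffun card_bool.
  have -> : (\sum_(f <- s) #|E f| = #|[set z | has (fun f => z \in E f) s]%SET|)%N.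
    elim: s disj {sb sep Ecard} => [|f s IH] /=.
      by move=> _; rewrite big_nil; apply/esym/eqP; rewrite cards_eq0; apply/eqP/finset.setP => z; rewrite !inE.
    move=> /andP[fs /IH {}IH]; rewrite big_cons IH.
    have -> : [set z | (z \in E f) || has (fun f => z \in E f) s]%SET =
       E f :|: [set z | has (fun f => z \in E f) s]%SET.
      by apply/finset.setP => z; rewrite finset.in_setU !finset.in_set.
    rewrite cardsU; suff -> : (E f :&: [set z | has (fun f => z \in E f) s])%SET = finset.set0.
      by rewrite cards0 subn0.
    apply/finset.setP => z; rewrite !inE; apply/negP => /andP[zf /hasP[g gs zg]].
    move/allP : fs => /(_ g gs) /eqP/finset.setP/(_ z).
    by rewrite finset.in_setI finset.in_set0 zg andbT inE zf.
  exact: max_card.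
have : (size s)%:R * 2 ^+ #|I| <= 4 * expR K * (\sum_(f <- s) #|E f|)%:R.
  rewrite natr_sum mulr_sumr mulr_natl.
  have -> : 2 ^+ #|I| *+ size s = \sum_(f <- s) 2 ^+ #|I| :> R.
    by rewrite big_const_seq count_predT iter_addr_0.
  rewrite big_seq [leRHS]big_seq ler_sum// => f; exact: Ecard.
have : 4 * expR K * (\sum_(f <- s) #|E f|)%:R <= 4 * expR K * 2 ^+ #|I|.
  by rewrite ler_wpM2l ?mulr_ge0 ?expR_ge0// -natrX ler_nat.
move=> h1 h2; have := le_trans h2 h1; rewrite ler_pM2r// exprn_gt0//.
Qed.

(* Spreading an index over [r] copies makes its coefficient as small as needed
   without changing [\sum_i b_i v_i], [\sum_i b_i^2] and [\sum_i v_i^2]. *)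
Lemma sup_packing (R : realType) (I G : finType) (v : I -> G -> R) (V e K : R)
    (s : seq {ffun G -> R}) :
  0 < V -> 0 < e -> (forall x, \sum_i v i x ^+ 2 <= V) ->
  64 * V * ln (4 * #|G|%:R) <= e ^+ 2 -> (0 < #|G|)%N ->
  (forall f, f \in s -> exists2 b : I -> R,
     \sum_i b i ^+ 2 <= K & forall x, `|f x - \sum_i b i * v i x| <= e) ->
  pairwise (fun f g : {ffun G -> R} => `[< exists x, 4 * e < `|f x - g x| >]) s ->
  (size s)%:R <= 4 * expR K.
Proof.
move=> V0 e0 vV Ve G0 sb sep.
(* [r] exceeds [K], hence every [b_i ^ 2], so the divided coefficients are at most 1 in absolute
   value. *)
pose r := (Num.truncn K).+1.
have r0 : 0 < r%:R :> R by rewrite ltr0n.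
pose w (p : I * 'I_r) x := v p.1 x / Num.sqrt r%:R.
have rep (F : I -> R) : \sum_(p : I * 'I_r) F p.1 = r%:R * \sum_i F i.
  rewrite -(pair_bigA _ (fun i (_ : 'I_r) => F i)) /= mulr_sumr.
  by apply: eq_bigr => i _; rewrite sumr_const card_ord -[_ *+ r]mulr_natl.
have sq : (Num.sqrt r%:R)^-1 ^+ 2 = r%:R^-1 :> R by rewrite exprVn sqr_sqrtr// ltW.
apply: (@sgn_packing R _ G w V e K s) => //.
  move=> x; rewrite (rep (fun i => (v i x / Num.sqrt r%:R) ^+ 2)).
  under eq_bigr do rewrite exprMn sq.
  by rewrite -mulr_suml mulrC mulfVK ?gt_eqF.
move=> f /sb[b bK bf]; exists (fun p => b p.1 / Num.sqrt r%:R); split.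
- move=> [i k] /=; rewrite -(ler_pXn2r (n := 2))// ?nnegrE// expr1n real_normK ?num_real//.
  rewrite exprMn sq ler_pdivrMr// mul1r; apply: le_trans (_ : K <= _).
    by apply: le_trans bK; rewrite (bigD1 i)//= lerDl sumr_ge0// => j _; exact: sqr_ge0.
  by rewrite ltW// truncnS_gt.
- rewrite (rep (fun i => (b i / Num.sqrt r%:R) ^+ 2)).
  under eq_bigr do rewrite exprMn sq.
  by rewrite -mulr_suml mulrC mulfVK ?gt_eqF.
- move=> x; rewrite (rep (fun i => b i / Num.sqrt r%:R * (v i x / Num.sqrt r%:R))).
  have -> : r%:R * \sum_i b i / Num.sqrt r%:R * (v i x / Num.sqrt r%:R) = \sum_i b i * v i x.
    rewrite mulr_sumr; apply: eq_bigr => i _.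
    have -> : r%:R * (b i / Num.sqrt r%:R * (v i x / Num.sqrt r%:R)) =
      r%:R * (b i * v i x * (Num.sqrt r%:R)^-1 ^+ 2) by ring.
    by rewrite sq mulrC mulfVK ?gt_eqF.
  exact: bf.
Qed.

(** A separated family of maximal size is a net, since a function far from all its members could be
    added. The bound [B] on the sizes makes a maximum exist. *)
Lemma net_of_packing (R : realType) (G : finType) (F : {ffun G -> R} -> Prop) (t B : R) :
  (forall s : seq {ffun G -> R}, (forall f, f \in s -> F f) ->
     pairwise (fun f g : {ffun G -> R} => `[< exists x, t < `|f x - g x| >]) s ->
     (size s)%:R <= B) ->
  exists s : seq {ffun G -> R}, [/\ forall f, f \in s -> F f, (size s)%:R <= B &
    forall f, F f -> exists2 g, g \in s & forall x, `|f x - g x| <= t].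
Proof.
move=> pack.
pose sep := fun f g : {ffun G -> R} => `[< exists x, t < `|f x - g x| >].
pose P k := `[< exists s : seq {ffun G -> R},
  [/\ forall f, f \in s -> F f, pairwise sep s & size s = k] >].
have P0 : P 0%N by apply/asboolP; exists [::].
have Pub k : P k -> (k <= Num.truncn B)%N.
  move=> /asboolP[s [sF sp <-]]; have sB := pack s sF sp.
  by rewrite truncn_ge_nat// (le_trans _ sB).
have [k /asboolP[s [sF sp sk]] kmax] := ex_maxnP (ex_intro (fun k => P k) 0%N P0) Pub.
exists s; split => //; first exact: pack.
move=> f Ff; apply: contrapT => nf.
suff : P k.+1 by move/kmax; rewrite ltnn.
apply/asboolP; exists (f :: s); split => /=; last by rewrite sk.
- by move=> g; rewrite inE => /predU1P[->|/sF].
- apply/andP; split => //; apply/allP => g gs; apply/asboolP.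
  apply: contrapT => ng; apply: nf; exists g => // x; rewrite leNgt; apply/negP => xt.
  by apply: ng; exists x.
Qed.

(** * Kernels on grids *)

Definition cis (R : realType) (t : R) : R[i] := (cos t +i* sin t)%C.

Lemma cis0 (R : realType) : cis (0 : R) = 1.
Proof. by rewrite /cis cos0 sin0. Qed.

Lemma cisD (R : realType) (s t : R) : cis (s + t) = cis s * cis t.
Proof.
rewrite /cis cosD sinD; apply/eqP; rewrite eq_complex /=.
by rewrite eqxx /= addrC [cos s * sin t + _]addrC [sin s * cos t]mulrC !eqxx.
Qed.

Lemma cis_sum (R : realType) (I : Type) (r : seq I) (P : pred I) (F : I -> R) :
  cis (\sum_(i <- r | P i) F i) = \prod_(i <- r | P i) cis (F i).
Proof. by apply: (big_morph (@cis R) (@cisD R) (@cis0 R)). Qed.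

Lemma cis_mulrn (R : realType) (t : R) (n : nat) : cis (t *+ n) = cis t ^+ n.
Proof. by elim: n => [|n IH]; rewrite ?mulr0n ?cis0// mulrS cisD IH exprS. Qed.

Lemma cis_neq0 (R : realType) (t : R) : cis t != 0.
Proof.
apply/eqP => h; have := cisD t (- t); rewrite subrr cis0 h mul0r.
by move/eqP; rewrite oner_eq0.
Qed.

Lemma cosC_cis (R : realType) (t : R) : ((cos t)%:C)%C = (cis t + cis (- t)) / 2.
Proof.
have -> : cis t + cis (- t) = 2 * ((cos t)%:C)%C.
  apply/eqP; rewrite mulr_natl mulr2n eq_complex /cis cosN sinN /=.
  by apply/andP; split; apply/eqP; ring.
by rewrite mulrC mulKf// pnatr_eq0.
Qed.

Lemma cis_int2pi (R : realType) (l : int) : cis (l%:~R * (2 * pi)) = 1 :> R[i].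
Proof.
have h n : cis (n%:R * (2 * pi) : R) = 1.
  rewrite mulr_natl cis_mulrn (mulr_natl pi 2) /cis cos2pi sin2pi.
  by rewrite expr1n.
case: l => n; first by rewrite -pmulrn h.
have := cisD (n.+1%:R * (2 * pi) : R) (- (n.+1%:R * (2 * pi))).
by rewrite subrr cis0 h mul1r NegzE mulrNz mulNr.
Qed.

Lemma cis_neq1 (R : realType) (t : R) : 0 < t < 2 * pi -> cis t != 1.
Proof.
move=> /andP[t0 t2]; apply/eqP => /(congr1 (@complex.Re R)) /=.
have -> : t = t / 2 *+ 2 by rewrite -mulr_natr; field.
rewrite cos_mulr2n cos2sin2 => h.
have : 0 < sin (t / 2) by apply: sin_gt0_pi; apply/andP; split; lra.
move=> s0; have : 0 < sin (t / 2) ^+ 2 by rewrite exprn_gt0.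
by move: h; rewrite -mulr_natl; lra.
Qed.

Definition node (R : realType) (N : nat) (i : 'I_N) : R := 2 * pi * i%:R / N%:R.

(** Geometric sum of the powers of a root of unity; [|l| < N] excludes aliasing. *)
Lemma avg_cis (R : realType) (N : nat) (l : int) : (`|l| < N)%N ->
  avg (fun t : 'I_N => cis (l%:~R * node R t)) = (l == 0)%:R.
Proof.
move=> lN; have N0 : (0 < N)%N by apply: leq_ltn_trans lN.
have NR : 0 < N%:R :> R by rewrite ltr0n.
have [->|l0] := eqVneq l 0.
  by under eq_avg do rewrite mul0r cis0; rewrite avg_cst// card_ord.
pose z := cis (l%:~R * (2 * pi) / N%:R : R).
have zE (t : 'I_N) : cis (l%:~R * node R t) = z ^+ t.
  rewrite -cis_mulrn; congr cis; rewrite /node -mulr_natr; field.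
  by rewrite gt_eqF.
under eq_avg do rewrite zE.
have z1 : z != 1.
  (* According to the sign of [l], either [z] or its inverse has its angle in []0, 2 * pi[]. *)
  have h : z != 1 \/ z^-1 != 1.
    have zV : z^-1 = cis (- (l%:~R * (2 * pi) / N%:R)).
      apply: (mulfI (cis_neq0 (l%:~R * (2 * pi) / N%:R : R))).
      by rewrite -cisD subrr cis0 mulfV// cis_neq0.
    have pl : 0 < (`|l|%N%:R * (2 * pi) / N%:R : R) < 2 * pi.
      have p0 := pi_gt0 R; have l1 : 0 < `|l|%N%:R :> R by rewrite ltr0n absz_gt0.
      apply/andP; split; first by rewrite divr_gt0 ?mulr_gt0.
      by rewrite ltr_pdivrMr// mulrC ltr_pM2l ?ltr_nat// mulr_gt0.
    have := cis_neq1 pl; rewrite zV /z; case: (l) => n; first by left.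
    rewrite NegzE abszN absz_nat => ?; right.
    by rewrite mulrNz !mulNr opprK -pmulrn.
  by case: h => //; apply: contra => /eqP ->; rewrite invr1.
have zN : z ^+ N = 1.
  rewrite -cis_mulrn -(cis_int2pi R l); congr cis; rewrite -mulr_natr; field.
  by rewrite gt_eqF.
have := subrX1 z N; rewrite zN subrr => /esym/eqP; rewrite mulf_eq0 subr_eq0 (negbTE z1) /=.
by rewrite /avg => /eqP ->; rewrite mulr0.
Qed.

Lemma avg_cos_cis (R : realType) (N : nat) (k l : int) (x : R) : (`|k| + `|l| < N)%N ->
  avg (fun t : 'I_N => ((cos (k%:~R * (x - node R t)))%:C)%C * cis (l%:~R * node R t)) =
  ((l == k)%:R + (l == - k)%:R) / 2 * cis (l%:~R * x).
Proof.
move=> klN.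
have h (t : 'I_N) :
  ((cos (k%:~R * (x - node R t)))%:C)%C * cis (l%:~R * node R t) =
  2^-1 * cis (k%:~R * x) * cis ((l - k)%:~R * node R t) +
  2^-1 * cis (- (k%:~R * x)) * cis ((l + k)%:~R * node R t).
  have e (a b c f : R) : a + b = c + f -> cis a / 2 * cis b = 2^-1 * cis c * cis f.
    by move=> h; rewrite mulrAC -cisD h cisD mulrC mulrA.
  rewrite cosC_cis mulrDl mulrDl; congr (_ + _); apply: e.
    by rewrite intrB; ring.
  by rewrite intrD; ring.
under eq_avg do rewrite h.
rewrite avgD !avgZl !avg_cis; [|lia|lia].
rewrite subr_eq0 addr_eq0.
have -> : ((l == k)%:R + (l == - k)%:R) / 2 * cis (l%:~R * x) =
  2^-1 * cis (l%:~R * x) * (l == k)%:R + 2^-1 * cis (l%:~R * x) * (l == - k)%:R by ring.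
congr (_ + _).
  by case: eqP => [->//|_]; rewrite !mulr0.
by case: eqP => [->|_]; rewrite ?mulr0// intrN mulNr.
Qed.

Definition ifreq (H : nat) (i : 'I_(H.*2.+1)) : int := (nat_of_ord i)%:Z - H%:Z.

Lemma ifreq_le (H : nat) (i : 'I_(H.*2.+1)) : (`|ifreq i| <= H)%N.
Proof. by have := ltn_ord i; rewrite /ifreq; lia. Qed.

Lemma ifreq_inj (H : nat) : injective (@ifreq H).
Proof. by move=> i j ij; apply: val_inj => /=; move: ij; rewrite /ifreq; lia. Qed.

Lemma ifreq_surj (H : nat) (l : int) : (`|l| <= H)%N -> exists i : 'I_(H.*2.+1), ifreq i = l.
Proof.
move=> lH; have h : (`|(l + H%:Z)%R| < H.*2.+1)%N by lia.
by exists (Ordinal h); rewrite /ifreq /=; lia.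
Qed.

Lemma sum_ifreq_eq (R : numFieldType) (H : nat) (l : int) : (`|l| <= H)%N ->
  \sum_(i < H.*2.+1) (l == ifreq i)%:R = 1 :> R.
Proof.
move=> /ifreq_surj[i il]; rewrite (bigD1 i)//= il eqxx big1 ?addr0// => j ji.
by rewrite -il (inj_eq (@ifreq_inj H)) eq_sym (negbTE ji).
Qed.

(** Each sign of [ifreq i] accounts for one half; for [l = 0] both halves come from the same
    index. *)
Lemma sum_ifreq_pm (R : numFieldType) (H : nat) (l : int) : (`|l| <= H)%N ->
  \sum_(i < H.*2.+1) ((l == ifreq i)%:R + (l == - ifreq i)%:R) / 2 = 1 :> R.
Proof.
move=> lH; rewrite -mulr_suml big_split /= sum_ifreq_eq//.
have -> : \sum_(i < H.*2.+1) (l == - ifreq i)%:R = 1 :> R.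
  rewrite -[RHS](@sum_ifreq_eq R H (- l)) ?abszN//.
  by apply: eq_bigr => i _; rewrite eqr_oppLR.
by rewrite -[1 + 1]/(2%:R) mulfV// pnatr_eq0.
Qed.

Section Kernels.
Variables (R : realType) (d : nat).
Implicit Types (w : ('I_d -> nat) -> R) (x : 'I_d -> R).

Definition box (H : nat) := {ffun 'I_d -> 'I_(H.*2.+1)}.

Definition gpt (N : nat) (z : {ffun 'I_d -> 'I_N}) : 'I_d -> R := fun j => node R (z j).

(** The weight sees only the moduli of the frequencies, so pairing opposite signs turns exponentials
    into cosines and keeps the kernel real. *)
Definition kern (H : nat) w x : R :=
  \sum_(k : box H) w (fun j => `|ifreq (k j)|%N) * \prod_j cos ((ifreq (k j))%:~R * x j).

(** The kernel acts as a Fourier multiplier, exactly and not only in the limit, because the grid has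
    more than [2 * H] nodes per axis. *)
Lemma kern_cis (H N : nat) w x (l : 'I_d -> int) :
  (H.*2 < N)%N -> (forall j, (`|l j| <= H)%N) ->
  avg (fun z : {ffun 'I_d -> 'I_N} => ((kern H w (fun j => x j - gpt z j))%:C)%C *
     cis (\sum_j (l j)%:~R * gpt z j)) =
  ((w (fun j => `|l j|%N))%:C)%C * cis (\sum_j (l j)%:~R * x j).
Proof.
move=> HN lH.
under eq_avg do rewrite /kern rmorph_sum /= mulr_suml.
rewrite avg_sum cis_sum.
transitivity (\sum_(k : box H) ((w (fun j => `|l j|%N))%:C)%C *
   \prod_j (((l j == ifreq (k j))%:R + (l j == - ifreq (k j))%:R) / 2 * cis ((l j)%:~R * x j))).
  apply: eq_bigr => k _.
  transitivity (((w (fun j => `|ifreq (k j)|%N))%:C)%C *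
     \prod_j (((l j == ifreq (k j))%:R + (l j == - ifreq (k j))%:R) / 2 * cis ((l j)%:~R * x j))).
    under eq_avg do rewrite rmorphM rmorph_prod /= cis_sum -mulrA -big_split /=.
    rewrite avgZl (avg_prod (fun j (t : 'I_N) =>
       ((cos ((ifreq (k j))%:~R * (x j - node R t)))%:C)%C * cis ((l j)%:~R * node R t))).
    congr (_ * _); apply: eq_bigr => j _; rewrite avg_cos_cis//.
    by have := ifreq_le (k j); have := lH j; lia.
  (* Some factor of the product vanishes unless all moduli agree, and in that case the two weights
     coincide. *)
  have [/forallP all_eq|] := boolP [forall j, `|l j|%N == `|ifreq (k j)|%N].
    by congr (((w _)%:C)%C * _); apply/funext => j; rewrite (eqP (all_eq j)).
  rewrite negb_forall => /existsP[j jn].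
  rewrite (bigD1 j)//=.
  have -> : (l j == ifreq (k j)) = false.
    by apply/eqP => h; move: jn; rewrite h eqxx.
  have -> : (l j == - ifreq (k j)) = false.
    by apply/eqP => h; move: jn; rewrite h abszN eqxx.
  by rewrite addr0 !mul0r !mulr0.
rewrite -mulr_sumr; congr (_ * _).
rewrite -(bigA_distr_bigA (fun j (i : 'I_H.*2.+1) =>
  ((l j == ifreq i)%:R + (l j == - ifreq i)%:R) / 2 * cis ((l j)%:~R * x j))).
by apply: eq_bigr => j _; rewrite -mulr_suml sum_ifreq_pm ?mul1r.
Qed.

Lemma avg_cos_cos (N : nat) (k l : int) (x : R) : (`|k| + `|l| < N)%N ->
  avg (fun t : 'I_N => cos (k%:~R * (x - node R t)) * cos (l%:~R * (x - node R t))) =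
  ((l == k)%:R + (l == - k)%:R) / 2.
Proof.
move=> klN.
pose c : R := ((l == k)%:R + (l == - k)%:R) / 2.
have E : avg (fun t : 'I_N => ((cos (k%:~R * (x - node R t)))%:C)%C *
    cis (l%:~R * (x - node R t))) = (c%:C)%C.
  have h (t : 'I_N) : cis (l%:~R * (x - node R t)) =
      cis ((- l)%:~R * node R t) * cis (l%:~R * x).
    by rewrite -cisD; congr cis; rewrite intrN; ring.
  under eq_avg do rewrite h mulrA.
  rewrite avgZr avg_cos_cis ?abszN// -(mulrA _ (cis _) (cis _)) -cisD intrN mulNr addNr cis0 mulr1.
  by rewrite eqr_oppLR eqr_opp addrC /c rmorphM rmorphD fmorphV !rmorph_nat.
have ReM (u : R) (v : R[i]) : complex.Re ((u%:C)%C * v) = u * complex.Re v.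
  by case: v => a b /=; rewrite mul0r subr0.
rewrite -/c -[RHS]/(complex.Re ((c%:C)%C)) -E /avg.
have -> : (#|'I_N|%:R : R[i])^-1 = (((#|'I_N|%:R)^-1 : R)%:C)%C by rewrite fmorphV rmorph_nat.
rewrite ReM (big_morph _ (_ : {morph @complex.Re R : x y / x + y >-> x + y}) (erefl : complex.Re 0 = 0)).
  by congr (_ * _); apply: eq_bigr => t _; rewrite ReM.
by move=> [a b] [a' b'].
Qed.

(** Parseval. The value does not depend on [x], so all points have the same variance in the packing
    bound. *)
Lemma avg_kern_sqr (H N : nat) w x : (H.*2 < N)%N ->
  avg (fun z : {ffun 'I_d -> 'I_N} => kern H w (fun j => x j - gpt z j) ^+ 2) =
  \sum_(k : box H) w (fun j => `|ifreq (k j)|%N) ^+ 2.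
Proof.
move=> HN.
under eq_avg do rewrite expr2 {1}/kern mulr_suml.
rewrite avg_sum; apply: eq_bigr => k _.
under eq_avg do rewrite /kern mulr_sumr.
rewrite avg_sum.
transitivity (\sum_(l : box H) w (fun j => `|ifreq (k j)|%N) ^+ 2 *
   \prod_j (((ifreq (k j) == ifreq (l j))%:R + (ifreq (k j) == - ifreq (l j))%:R) / 2)).
  apply: eq_bigr => l _.
  transitivity (w (fun j => `|ifreq (k j)|%N) * w (fun j => `|ifreq (l j)|%N) *
    \prod_j (((ifreq (k j) == ifreq (l j))%:R + (ifreq (k j) == - ifreq (l j))%:R) / 2)).
    under eq_avg do rewrite mulrACA -big_split /=.
    rewrite avgZl; congr (_ * _).
    rewrite (avg_prod (fun j (t : 'I_N) =>
       cos ((ifreq (k j))%:~R * (x j - node R t)) * cos ((ifreq (l j))%:~R * (x j - node R t)))).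
    apply: eq_bigr => j _; rewrite avg_cos_cos; last first.
      by have := ifreq_le (k j); have := ifreq_le (l j); lia.
    by rewrite eq_sym -[ifreq (l j) == - _]eqr_oppLR [- _ == _]eq_sym.
  have [/forallP all_eq|] := boolP [forall j, `|ifreq (l j)|%N == `|ifreq (k j)|%N].
    rewrite expr2; congr (_ * w _ * _); apply/funext => j; rewrite (eqP (all_eq j)).
    by [].
  rewrite negb_forall => /existsP[j jn].
  suff -> : \prod_j (((ifreq (k j) == ifreq (l j))%:R + (ifreq (k j) == - ifreq (l j))%:R) / 2) =
      0 :> R by rewrite !mulr0.
  rewrite (bigD1 j)//=.
  have -> : (ifreq (k j) == ifreq (l j)) = false.
    by apply/eqP => h; move: jn; rewrite h eqxx.
  have -> : (ifreq (k j) == - ifreq (l j)) = false.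
    by apply/eqP => h; move: jn; rewrite h abszN eqxx.
  by rewrite addr0 !mul0r.
rewrite -mulr_sumr.
rewrite -(bigA_distr_bigA (fun j (i : 'I_H.*2.+1) =>
  ((ifreq (k j) == ifreq i)%:R + (ifreq (k j) == - ifreq i)%:R) / 2)).
by rewrite big1 ?mulr1// => j _; rewrite sum_ifreq_pm// ifreq_le.
Qed.

Definition kern1 (H : nat) (w : nat -> R) (t : R) : R :=
  \sum_(i < H.*2.+1) w `|ifreq i|%N * cos ((ifreq i)%:~R * t).

Lemma kern_prod (H : nat) (w : 'I_d -> nat -> R) x :
  kern H (fun k => \prod_j w j (k j)) x = \prod_j kern1 H (w j) (x j).
Proof.
rewrite /kern1 (bigA_distr_bigA (fun j (i : 'I_H.*2.+1) =>
  w j `|ifreq i|%N * cos ((ifreq i)%:~R * x j))).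
by apply: eq_bigr => k _; rewrite -big_split.
Qed.

Lemma kern_sum (H : nat) (I : Type) (r : seq I) (P : pred I)
    (w : I -> ('I_d -> nat) -> R) x :
  kern H (fun k => \sum_(i <- r | P i) w i k) x = \sum_(i <- r | P i) kern H (w i) x.
Proof.
by rewrite /kern exchange_big /=; apply: eq_bigr => k _; rewrite mulr_suml.
Qed.

Lemma avg_norm_kern_prod (H N : nat) (w : 'I_d -> nat -> R) (C : 'I_d -> R) x :
  (forall j t, avg (fun i : 'I_N => `|kern1 H (w j) (t - node R i)|) <= C j) ->
  avg (fun z : {ffun 'I_d -> 'I_N} =>
    `|kern H (fun k => \prod_j w j (k j)) (fun j => x j - gpt z j)|) <= \prod_j C j.
Proof.
move=> wC; under eq_avg do rewrite kern_prod normr_prod.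
rewrite (avg_prod (fun j (i : 'I_N) => `|kern1 H (w j) (x j - node R i)|)).
apply: ler_prod => j _; rewrite wC andbT.
exact: avg_ge0.
Qed.

End Kernels.

(** * De la Vallee Poussin kernels *)

(** Truncated subtraction on [nat] makes this the positive part of [1 - k / m] when [m > 0]. *)
Definition fejer (R : realType) (m k : nat) : R := (m - k)%:R / m%:R.

(* Coefficients of the de la Vallee Poussin kernel. *)
Definition vp (R : realType) (p k : nat) : R :=
  2 * fejer R (2 ^ p.+1) k - fejer R (2 ^ p) k.

(** Dyadic pieces that telescope to [vp]; the piece of index 0 is a whole kernel, so that frequency
    0 is covered. *)
Definition dvp (R : realType) (p k : nat) : R :=
  if p is p'.+1 then vp R p k - vp R p' k else vp R 0 k.

Lemma vp_eq1 (R : realType) (p k : nat) : (k <= 2 ^ p)%N -> vp R p k = 1.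
Proof.
move=> kp; rewrite /vp /fejer !natrB//; last by rewrite (leq_trans kp)// leq_exp2l.
rewrite expnS natrM; field.
by rewrite pnatr_eq0 expn_eq0.
Qed.

Lemma vp_eq0 (R : realType) (p k : nat) : (2 ^ p.+1 <= k)%N -> vp R p k = 0.
Proof.
move=> kp; rewrite /vp /fejer.
have /eqP -> : (2 ^ p.+1 - k == 0)%N by rewrite subn_eq0.
have /eqP -> : (2 ^ p - k == 0)%N by rewrite subn_eq0 (leq_trans _ kp)// leq_exp2l.
by rewrite !mul0r mulr0 subr0.
Qed.

Lemma vp_mid (R : realType) (p k : nat) : (2 ^ p <= k)%N -> (k <= 2 ^ p.+1)%N ->
  vp R p k = 2 - k%:R / 2 ^+ p.
Proof.
move=> pk kp; rewrite /vp /fejer.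
have /eqP -> : (2 ^ p - k == 0)%N by rewrite subn_eq0.
rewrite natrB// mul0r subr0 expnS natrM natrX; field.
by rewrite expf_neq0// pnatr_eq0.
Qed.

Lemma vp_ge0 (R : realType) (p k : nat) : 0 <= vp R p k.
Proof.
have [kp|/ltnW kp] := leqP k (2 ^ p); first by rewrite vp_eq1.
have [kp2|/ltnW kp2] := leqP k (2 ^ p.+1); last by rewrite vp_eq0.
rewrite vp_mid// subr_ge0 ler_pdivrMr ?exprn_gt0//.
by rewrite -exprS -natrX ler_nat.
Qed.

Lemma vp_le1 (R : realType) (p k : nat) : vp R p k <= 1.
Proof.
have [kp|/ltnW kp] := leqP k (2 ^ p); first by rewrite vp_eq1.
have [kp2|/ltnW kp2] := leqP k (2 ^ p.+1); last by rewrite vp_eq0.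
rewrite vp_mid// lerBlDr -lerBlDl ler_pdivlMr ?exprn_gt0//.
have -> : (2 - 1) * 2 ^+ p = (2 ^ p)%:R :> R by rewrite natrX; ring.
by rewrite ler_nat.
Qed.

Lemma dvp_ge0 (R : realType) (p k : nat) : 0 <= dvp R p k.
Proof.
case: p => [|p] /=; first exact: vp_ge0.
have [kp|/ltnW kp] := leqP k (2 ^ p.+1).
  by rewrite vp_eq1// subr_ge0 vp_le1.
by rewrite (vp_eq0 R kp) subr0 vp_ge0.
Qed.

Lemma dvp_le_vp (R : realType) (p k : nat) : dvp R p k <= vp R p k.
Proof. by case: p => [|p] //=; rewrite gerBl vp_ge0. Qed.

Lemma dvp_eq0 (R : realType) (p k : nat) : (k <= 2 ^ p.-1)%N -> (0 < p)%N -> dvp R p k = 0.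
Proof.
case: p => [|p] //= kp _; rewrite !vp_eq1 ?subrr//.
by rewrite (leq_trans kp)// leq_exp2l.
Qed.

Lemma sum_dvp (R : realType) (n k : nat) : \sum_(p < n.+1) dvp R p k = vp R n k.
Proof.
elim: n => [|n IH]; first by rewrite big_ord1.
by rewrite big_ord_recr IH /= addrC subrK.
Qed.

Lemma kern1E (R : realType) (H : nat) (w : nat -> R) (t : R) :
  kern1 H w t = w 0%N + 2 * \sum_(i < H) w i.+1 * cos (i.+1%:R * t).
Proof.
rewrite /kern1.
pose F (k : int) := w `|k|%N * cos (k%:~R * t).
have FN k : F (- k) = F k by rewrite /F abszN intrN mulNr cosN.
have -> : \sum_(i < H.*2.+1) F (ifreq i) = \sum_(0 <= i < H.*2.+1) F (i%:Z - H%:Z).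
  by rewrite big_mkord.
rewrite (big_cat_nat (n := H))//=; last by lia.
rewrite (big_cat_nat (m := H) (n := H.+1))//=; last by lia.
rewrite big_nat1 subrr {2}/F mul0r cos0 mulr1.
have -> : \sum_(0 <= i < H) F (i%:Z - H%:Z) = \sum_(i < H) w i.+1 * cos (i.+1%:R * t).
  rewrite big_mkord (reindex_inj rev_ord_inj) /=; apply: eq_bigr => i _.
  rewrite -FN (_ : - _ = i.+1%:Z); last by have := ltn_ord i; lia.
  by rewrite /F absz_nat -pmulrn.
have -> : \sum_(H.+1 <= i < H.*2.+1) F (i%:Z - H%:Z) = \sum_(i < H) w i.+1 * cos (i.+1%:R * t).
  rewrite -{1}[H.+1]add0n big_addn big_mkord.
  have -> : (H.*2.+1 - H.+1 = H)%N by lia.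
  apply: eq_bigr => i _.
  by rewrite (_ : _ - _ = i.+1%:Z); [rewrite /F absz_nat -pmulrn|lia].
by ring.
Qed.

(** The Fejer kernel as the squared modulus of an exponential sum. Raising [m] by one adds a
    Dirichlet kernel on the left and, on the right, the cross terms with the new exponential. *)
Lemma fejer_sqr (R : realType) (H m : nat) (t : R) : (m <= H.+1)%N ->
  kern1 H (fun k => (m - k)%:R) t =
  (\sum_(a < m) cos (a%:R * t)) ^+ 2 + (\sum_(a < m) sin (a%:R * t)) ^+ 2.
Proof.
elim: m => [|m IH] mH.
  rewrite !big_ord0 expr0n addr0 kern1E sub0n big1 ?mulr0 ?addr0// => i _.
  by rewrite sub0n mul0r.
have step : kern1 H (fun k => (m.+1 - k)%:R) t =
    kern1 H (fun k => (m - k)%:R) t + (1 + 2 * \sum_(i < m) cos (i.+1%:R * t)).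
  rewrite !kern1E !subn0 -[m.+1%:R]natr1.
  suff -> : \sum_(i < H) (m.+1 - i.+1)%:R * cos (i.+1%:R * t) =
    \sum_(i < H) (m - i.+1)%:R * cos (i.+1%:R * t) + \sum_(i < m) cos (i.+1%:R * t) by ring.
  rewrite (big_ord_widen H (fun i => cos (i.+1%:R * t)))//.
  rewrite [X in _ + X]big_mkcond -big_split /=; apply: eq_bigr => i _.
  case: ltnP => im; first by rewrite subSS -[(m - i)%N]prednK ?subn_gt0// -subnS -natr1; ring.
  have /eqP -> : (m.+1 - i.+1 == 0)%N by rewrite subn_eq0.
  have /eqP -> : (m - i.+1 == 0)%N by rewrite subn_eq0 (leq_trans im).
  by rewrite mul0r addr0.
rewrite step IH ?(ltnW mH)// !big_ord_recr /=.
set C := \sum_(i < m) cos _; set S := \sum_(i < m) sin _.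
have -> : \sum_(i < m) cos (i.+1%:R * t) = C * cos (m%:R * t) + S * sin (m%:R * t).
  rewrite (reindex_inj rev_ord_inj) /= /C /S !mulr_suml -big_split /=.
  apply: eq_bigr => i _; rewrite [cos _ * _]mulrC [sin _ * _]mulrC -cosB -mulrBl.
  by rewrite -natrB ?(ltnW (ltn_ord i))// subnSK.
have := cos2Dsin2 (m%:R * t); set c := cos (m%:R * t); set s := sin _ => cs.
have -> : (C + c) ^+ 2 + (S + s) ^+ 2 = C ^+ 2 + S ^+ 2 + (2 * (C * c + S * s) + (c ^+ 2 + s ^+ 2)).
  by ring.
by rewrite cs; ring.
Qed.

Lemma kern1Z (R : realType) (H : nat) (w : nat -> R) (c t : R) :
  kern1 H (fun k => c * w k) t = c * kern1 H w t.
Proof. by rewrite /kern1 mulr_sumr; apply: eq_bigr => i _; rewrite mulrA. Qed.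

Lemma kern1B (R : realType) (H : nat) (w v : nat -> R) (t : R) :
  kern1 H (fun k => w k - v k) t = kern1 H w t - kern1 H v t.
Proof. by rewrite /kern1 -sumrB; apply: eq_bigr => i _; rewrite mulrBl. Qed.

Lemma kern1_fejer_ge0 (R : realType) (H m : nat) (t : R) : (m <= H.+1)%N ->
  0 <= kern1 H (fejer R m) t.
Proof.
move=> mH.
have -> : fejer R m = fun k => m%:R^-1 * (m - k)%:R by apply/funext => k; rewrite mulrC.
by rewrite kern1Z fejer_sqr// mulr_ge0 ?invr_ge0// addr_ge0// sqr_ge0.
Qed.

Lemma avg_kern1 (R : realType) (H N : nat) (w : nat -> R) (t : R) : (H.*2 < N)%N ->
  avg (fun i : 'I_N => kern1 H w (t - node R i)) = w 0%N.
Proof.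
move=> HN; rewrite /kern1 avg_sum.
transitivity (\sum_(k < H.*2.+1) w 0%N * (((0 == ifreq k)%:R + (0 == - ifreq k)%:R) / 2)).
  apply: eq_bigr => k _; rewrite avgZl.
  have -> : avg (fun i : 'I_N => cos ((ifreq k)%:~R * (t - node R i))) =
      ((0 == ifreq k)%:R + (0 == - ifreq k)%:R) / 2.
    rewrite -(@avg_cos_cos R N (ifreq k) 0 t) ?absz0 ?addn0; last by have := ifreq_le k; lia.
    by apply: eq_avg => i; rewrite mul0r cos0 mulr1.
  have [->|k0] := eqVneq (ifreq k) 0; first by [].
  rewrite [0 == - _]eq_sym oppr_eq0 (negbTE k0).
  by rewrite addr0 mul0r !mulr0.
by rewrite -mulr_sumr sum_ifreq_pm ?mulr1.
Qed.

(** Fejer kernels are nonnegative with mean 1, so the combination [2 F - F'] has [L_1] norm at most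
    [2 + 1]. *)
Lemma avg_norm_kern1_vp (R : realType) (H N p : nat) (t : R) :
  (2 ^ p.+1 <= H.+1)%N -> (H.*2 < N)%N ->
  avg (fun i : 'I_N => `|kern1 H (vp R p) (t - node R i)|) <= 3.
Proof.
move=> pH HN.
have F0 m : (0 < m)%N -> fejer R m 0 = 1.
  by move=> m0; rewrite /fejer subn0 mulfV// pnatr_eq0 -lt0n.
apply: le_trans (_ : avg (fun i : 'I_N => 2 * kern1 H (fejer R (2 ^ p.+1)) (t - node R i) +
    kern1 H (fejer R (2 ^ p)) (t - node R i)) <= _); last first.
  by rewrite avgD avgZl !avg_kern1// !F0 ?expn_gt0//; lra.
apply: ler_avg => i.
have -> : vp R p = (fun k => 2 * fejer R (2 ^ p.+1) k - fejer R (2 ^ p) k) by [].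
rewrite kern1B kern1Z.
have h1 := kern1_fejer_ge0 (t - node R i) pH.
have pH' : (2 ^ p <= H.+1)%N by rewrite (leq_trans _ pH)// leq_exp2l.
have h2 := kern1_fejer_ge0 (t - node R i) pH'.
by rewrite ler_norml; apply/andP; split; lra.
Qed.

Lemma avg_norm_kern1_dvp (R : realType) (H N p : nat) (t : R) :
  (2 ^ p.+1 <= H.+1)%N -> (H.*2 < N)%N ->
  avg (fun i : 'I_N => `|kern1 H (dvp R p) (t - node R i)|) <= 6.
Proof.
case: p => [|p] pH HN.
  by apply: le_trans (avg_norm_kern1_vp t pH HN) _; lra.
have pH' : (2 ^ p.+1 <= H.+1)%N by rewrite (leq_trans _ pH)// leq_exp2l.
have h1 := avg_norm_kern1_vp t pH HN.
have h2 := avg_norm_kern1_vp t pH' HN.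
apply: le_trans (_ : avg (fun i : 'I_N => `|kern1 H (vp R p.+1) (t - node R i)| +
   `|kern1 H (vp R p) (t - node R i)|) <= _); last by rewrite avgD; lra.
apply: ler_avg => i; rewrite -[dvp R p.+1]/(fun k => vp R p.+1 k - vp R p k) kern1B.
exact: ler_normB.
Qed.

(** The sum is the value of the kernel at 0, and at most [2 ^ (p + 1) - 1] positive frequencies
    contribute. *)
Lemma sum_ifreq_vp (R : realType) (H p : nat) :
  \sum_(i < H.*2.+1) vp R p `|ifreq i|%N <= 4 * 2 ^+ p.
Proof.
have -> : \sum_(i < H.*2.+1) vp R p `|ifreq i|%N = kern1 H (vp R p) 0.
  by apply: eq_bigr => i _; rewrite mulr0 cos0 mulr1.
rewrite kern1E vp_eq1//.
have : \sum_(i < H) vp R p i.+1 * cos (i.+1%:R * 0) <= \sum_(i < H) (i.+1 < 2 ^ p.+1)%:R.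
  apply: ler_sum => i _; rewrite mulr0 cos0 mulr1; case: ltnP => h.
    exact: vp_le1.
  by rewrite vp_eq0.
have : \sum_(i < H) (i.+1 < 2 ^ p.+1)%:R <= 2 ^+ p.+1 - 1 :> R.
  rewrite -natrX -[X in _ - X]/(1%:R) -natrB ?expn_gt0// -natr_sum ler_nat.
  elim: H => [|H IH]; first by rewrite big_ord0.
  rewrite big_ord_recr /=; case: (ltnP H.+1 (2 ^ p.+1)) => h; last by rewrite addn0.
  rewrite addn1; apply: leq_ltn_trans (_ : H < _)%N; last by lia.
  rewrite -[leqRHS]card_ord -sum1_card leq_sum// => i _.
  by case: (_ < _)%N.
by rewrite exprS; lra.
Qed.

(** * Nets of trigonometric polynomials *)

Lemma Re_avg (R : realType) (T : finType) (h : T -> R[i]) :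
  complex.Re (avg h) = avg (fun x => complex.Re (h x)).
Proof.
rewrite /avg; have -> : (#|T|%:R : R[i])^-1 = (((#|T|%:R)^-1 : R)%:C)%C by rewrite fmorphV rmorph_nat.
have -> : \sum_x complex.Re (h x) = complex.Re (\sum_x h x).
  by rewrite (big_morph _ (_ : {morph @complex.Re R : x y / x + y >-> x + y}) (erefl : complex.Re 0 = 0))// => -[a b] [a' b'].
by case: (\sum_x h x) => a b /=; rewrite mul0r subr0.
Qed.

Lemma Im_avg (R : realType) (T : finType) (h : T -> R[i]) :
  complex.Im (avg h) = avg (fun x => complex.Im (h x)).
Proof.
rewrite /avg; have -> : (#|T|%:R : R[i])^-1 = (((#|T|%:R)^-1 : R)%:C)%C by rewrite fmorphV rmorph_nat.
have -> : \sum_x complex.Im (h x) = complex.Im (\sum_x h x).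
  by rewrite (big_morph _ (_ : {morph @complex.Im R : x y / x + y >-> x + y}) (erefl : complex.Im 0 = 0))// => -[a b] [a' b'].
by case: (\sum_x h x) => a b /=; rewrite mul0r addr0.
Qed.

Section TrigPoly.
Variables (R : realType) (d n : nat).

(* The real part of the polynomial with coefficients [a k + i b k]. *)
Definition tp (Q : {set freq_box d n}) (a b : freq_box d n -> R) (x : 'I_d -> R) : R :=
  \sum_(k in Q) (a k * cos (phase k x) - b k * sin (phase k x)).

Lemma avg_kern_cos_sin (H N : nat) (w : ('I_d -> nat) -> R) (k : freq_box d n) (x : 'I_d -> R) :
  (2 ^ n <= H)%N -> (H.*2 < N)%N ->
  avg (fun z : {ffun 'I_d -> 'I_N} => kern H w (fun j => x j - gpt R z j) * cos (phase k (gpt R z)))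
    = w (fun j => `|freq k j|%N) * cos (phase k x) /\
  avg (fun z : {ffun 'I_d -> 'I_N} => kern H w (fun j => x j - gpt R z j) * sin (phase k (gpt R z)))
    = w (fun j => `|freq k j|%N) * sin (phase k x).
Proof.
move=> nH HN.
have kH j : (`|freq k j| <= H)%N by apply: leq_trans nH; rewrite /freq; have := ltn_ord (k j); lia.
have := kern_cis w x HN kH.
rewrite -/(phase k x) => E.
have ReM (u : R) (v : R) : complex.Re ((u%:C)%C * cis v) = u * cos v by rewrite /= mul0r subr0.
have ImM (u : R) (v : R) : complex.Im ((u%:C)%C * cis v) = u * sin v by rewrite /= mul0r addr0.
split.
  have := congr1 (@complex.Re R) E; rewrite Re_avg ReM => <-.
  by apply: eq_avg => z; rewrite ReM.
have := congr1 (@complex.Im R) E; rewrite Im_avg ImM => <-.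
by apply: eq_avg => z; rewrite ImM.
Qed.

Lemma avg_kern_tp (H N : nat) (w : ('I_d -> nat) -> R) (Q : {set freq_box d n})
    (a b : freq_box d n -> R) (x : 'I_d -> R) :
  (2 ^ n <= H)%N -> (H.*2 < N)%N ->
  (forall k, k \in Q -> w (fun j => `|freq k j|%N) = 1) ->
  avg (fun z : {ffun 'I_d -> 'I_N} =>
    kern H w (fun j => x j - gpt R z j) * tp Q a b (gpt R z)) = tp Q a b x.
Proof.
move=> nH HN w1; under eq_avg do rewrite mulr_sumr.
rewrite avg_sum; apply: eq_bigr => k kQ.
have [Ec Es] := avg_kern_cos_sin w k x nH HN; rewrite w1// !mul1r in Ec Es.
rewrite -[cos _ in RHS]Ec -[sin _ in RHS]Es -!avgZl -avgB.
by apply: eq_avg => z; ring.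
Qed.

End TrigPoly.

Section ConvNet.
Variables (R : realType) (d H N : nat).
Hypothesis HN : (H.*2 < N)%N.
Notation G := {ffun 'I_d -> 'I_N}.

Lemma card_grid_gt0 : (0 < #|G|)%N.
Proof. by rewrite card_ffun expn_gt0 card_ord (leq_ltn_trans _ HN). Qed.

Definition conv (w : ('I_d -> nat) -> R) (g : G -> R) (x : 'I_d -> R) : R :=
  avg (fun z : G => kern H w (fun j => x j - gpt R z j) * g z).

(** A convolution is a combination of translates of its kernel, indexed here by pairs of a piece and
    a grid point. The scale [delta s] trades the two sides of the packing bound: it multiplies the
    variance of piece [s] and divides its energy. *)
Lemma conv_net (S : finType) (w : S -> ('I_d -> nat) -> R) (F : {ffun G -> R} -> Prop)
    (delta : S -> R) (V K e : R) :
  0 < e -> 0 < V -> (forall s, 0 < delta s) ->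
  \sum_s delta s * (\sum_(k : box d H) w s (fun j => `|ifreq (k j)|%N) ^+ 2) <= V ->
  64 * V * ln (4 * #|G|%:R) <= e ^+ 2 ->
  (forall f, F f -> exists2 g : S -> G -> R,
     \sum_s (delta s)^-1 * avg (fun z => g s z ^+ 2) <= K &
     forall x, `|f x - \sum_s conv (w s) (g s) (gpt R x)| <= e) ->
  exists s : seq {ffun G -> R}, [/\ forall f, f \in s -> F f, (size s)%:R <= 4 * expR K &
    forall f, F f -> exists2 g, g \in s & forall x, `|f x - g x| <= 4 * e].
Proof.
move=> e0 V0 d0 sV Ve Fg; apply: net_of_packing => s sF sep.
have G0 := card_grid_gt0.
have GR : 0 < #|G|%:R :> R by rewrite ltr0n.
(* The division by [#|G|] turns the sum of [v ^ 2] into grid averages, which [avg_kern_sqr]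
   evaluates. *)
pose c (t : S) := Num.sqrt (delta t / #|G|%:R).
have c2 t : c t ^+ 2 = delta t / #|G|%:R by rewrite sqr_sqrtr// divr_ge0 ?ltW.
have c0 t : 0 < c t by rewrite sqrtr_gt0 divr_gt0.
pose v (p : S * G) (x : G) := c p.1 * kern H (w p.1) (fun j => gpt R x j - gpt R p.2 j).
apply: (@sup_packing R _ G v V e K s) => //.
- move=> x; apply: le_trans sV.
  rewrite -(pair_bigA _ (fun t z => v (t, z) x ^+ 2)) /= le_eqVlt; apply/orP; left; apply/eqP.
  apply: eq_bigr => t _; under eq_bigr do rewrite /v /= exprMn c2.
  by rewrite -mulr_sumr -mulrA -(avg_kern_sqr (w t) (gpt R x) HN).
- move=> f fs; have [g gK gf] := Fg f (sF f fs).
  exists (fun p => g p.1 p.2 / (c p.1 * #|G|%:R)).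
    apply: le_trans gK.
    rewrite -(pair_bigA _ (fun t z => (g t z / (c t * #|G|%:R)) ^+ 2)) /=.
    rewrite le_eqVlt; apply/orP; left; apply/eqP; apply: eq_bigr => t _.
    under eq_bigr do rewrite exprMn mulrC.
    rewrite -mulr_sumr /avg mulrA; congr (_ * _).
    rewrite exprVn exprMn c2; field.
    by rewrite !gt_eqF.
  move=> x; apply: le_trans (gf x).
  rewrite le_eqVlt; apply/orP; left; apply/eqP; congr (`|_ - _|).
  rewrite -(pair_bigA _ (fun t z => g t z / (c t * #|G|%:R) * v (t, z) x)) /=.
  apply: eq_bigr => t _; rewrite /conv /avg mulr_sumr; apply: eq_bigr => z _.
  rewrite /v /=; field.
  by rewrite !gt_eqF.
Qed.

End ConvNet.

Lemma powR_addl2 (R : realType) (q a b : R) : 1 <= q -> 0 <= a -> 0 <= b ->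
  (a + b) `^ q <= 2 `^ q * (a `^ q + b `^ q).
Proof.
move=> q1 a0 b0.
wlog ab : a b a0 b0 / a <= b => [h|].
  by have [ab|/ltW ba] := leP a b; [exact: h|rewrite addrC [a `^ q + _]addrC; exact: h].
apply: le_trans (_ : (2 * b) `^ q <= _).
  by apply: ler_powR2r; [lra|exact: addr_ge0|lra].
by rewrite powRM// ler_wpM2l ?powR_ge0// lerDr powR_ge0.
Qed.

(* Bisection of the radius: a ball of radius [2 t] is covered by few balls of
   radius [t], the number of bits spent at [t] dominating those spent before. *)
Lemma net_bisect (R : realType) (G : finType) (F : {ffun G -> R} -> Prop) (q A K : R) :
  1 <= q -> 0 < A -> 0 <= K ->
  (forall f, F f -> forall x, `|f x| <= A) ->
  (forall t, 0 < t -> t <= 2 * A -> ln 4 <= K / t `^ q) ->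
  (forall t f0, 0 < t -> t <= 2 * A -> F f0 ->
    exists s : seq {ffun G -> R},
     [/\ forall f, f \in s -> F f, (size s)%:R <= 4 * expR (K / t `^ q) &
      forall f, F f -> (forall x, `|f x - f0 x| <= 2 * t) ->
        exists2 g, g \in s & forall x, `|f x - g x| <= t]) ->
  forall t, 0 < t -> exists s : seq {ffun G -> R},
     [/\ forall f, f \in s -> F f, (size s)%:R <= expR (4 * K / t `^ q) &
      forall f, F f -> exists2 g, g \in s & forall x, `|f x - g x| <= t].
Proof.
move=> q1 A0 K0 FA K4 Floc.
(* Induction on the number of halvings, starting at radius [2 * A], where any single element is a
   net. *)
have main i : forall t, 0 < t -> 2 * A <= 2 ^+ i * t -> exists s : seq {ffun G -> R},
     [/\ forall f, f \in s -> F f, (size s)%:R <= expR (4 * K / t `^ q) &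
      forall f, F f -> exists2 g, g \in s & forall x, `|f x - g x| <= t].
  elim: i => [|i IH] t t0 it.
    rewrite expr0 mul1r in it.
    have e1 : 1 <= expR (4 * K / t `^ q).
      by apply: le_trans (expR_ge1Dx _); rewrite lerDl divr_ge0 ?powR_ge0 ?mulr_ge0.
    have [[f0 Ff0]|nF] := pselect (exists f, F f); last first.
      by exists [::]; split => //=; [exact: expR_ge0|move=> f Ff; case: nF; exists f].
    exists [:: f0]; split => //=.
      by move=> f; rewrite inE => /eqP ->.
    move=> f Ff; exists f0; rewrite ?inE// => x.
    apply: le_trans (ler_normB _ _) _; apply: le_trans it.
    by have := FA f Ff x; have := FA f0 Ff0 x; lra.
  have [At|tA] := leP (2 * A) t.
    apply: IH => //; apply: le_trans At _; rewrite ler_peMl ?(ltW t0)//.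
    by rewrite exprn_ege1//; lra.
  have t20 : 0 < 2 * t by lra.
  have it2 : 2 * A <= 2 ^+ i * (2 * t) by rewrite mulrA -exprSr.
  have [s [sF sc sn]] := IH (2 * t) t20 it2.
  have [loc hloc] : exists loc : {ffun G -> R} -> seq {ffun G -> R}, forall f0, F f0 ->
     [/\ forall f, f \in loc f0 -> F f, (size (loc f0))%:R <= 4 * expR (K / t `^ q) &
      forall f, F f -> (forall x, `|f x - f0 x| <= 2 * t) ->
        exists2 g, g \in loc f0 & forall x, `|f x - g x| <= t].
    suff ex (f0 : {ffun G -> R}) : exists l : seq {ffun G -> R}, F f0 ->
       [/\ forall f, f \in l -> F f, (size l)%:R <= 4 * expR (K / t `^ q) &
        forall f, F f -> (forall x, `|f x - f0 x| <= 2 * t) ->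
        exists2 g, g \in l & forall x, `|f x - g x| <= t].
      by have [loc hloc] := choice ex; exists loc.
    have [Ff0|nF] := pselect (F f0); last by exists [::].
    by have [l hl] := Floc t f0 t0 (ltW tA) Ff0; exists l.
  exists (flatten [seq loc f0 | f0 <- s]); split.
  - move=> f /flattenP[l /mapP[f0 f0s ->]].
    by have [h _ _] := hloc f0 (sF f0 f0s); exact: h.
  - have -> : (size (flatten [seq loc f0 | f0 <- s]) = \sum_(f0 <- s) size (loc f0))%N.
      by rewrite size_flatten /shape -map_comp sumnE big_map.
    apply: le_trans (_ : (size s)%:R * (4 * expR (K / t `^ q)) <= _).
      rewrite natr_sum mulr_natl -iter_addr_0 -[X in iter X]count_predT -big_const_seq.
      rewrite big_seq [leRHS]big_seq ler_sum// => f0 f0s.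
      by have [_ h _] := hloc f0 (sF f0 f0s).
    apply: le_trans (_ : expR (4 * K / (2 * t) `^ q) * (expR (ln 4) * expR (K / t `^ q)) <= _).
      by rewrite lnK ?posrE// ler_wpM2r// mulr_ge0 ?expR_ge0.
    rewrite -!expRD ler_expR.
    have h := K4 t t0 (ltW tA).
    (* The budget of four units [K / t ^ q] is spent as two units on all coarser radii, since
       [2 ^ q >= 2], one on the local net and one on its factor 4. *)
    have : 4 * K / (2 * t) `^ q <= 2 * (K / t `^ q).
      have tq : 0 < t `^ q by rewrite powR_gt0.
      have h2 : 2 <= 2 `^ q :> R by rewrite le1r_powR//; lra.
      have p0 : 0 < 2 `^ q :> R by lra.
      rewrite powRM ?(ltW t0)//.
      have -> : 4 * K / (2 `^ q * t `^ q) = 4 / 2 `^ q * (K / t `^ q).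
        by field; rewrite !gt_eqF.
      rewrite ler_wpM2r ?divr_ge0 ?(ltW tq)//.
      by rewrite ler_pdivrMr//; lra.
    by rewrite -[4 * K / t `^ q]mulrA; lra.
  - move=> f Ff; have [f0 f0s hf0] := sn f Ff.
    have [_ _ h] := hloc f0 (sF f0 f0s).
    have [g gl hg] := h f Ff hf0; exists g => //.
    by apply/flattenP; exists (loc f0) => //; apply/mapP; exists f0.
move=> t t0.
have [i hi] : exists i : nat, 2 * A / t <= 2 ^+ i.
  exists (Num.truncn (2 * A / t)).+1.
  apply: ltW; apply: lt_le_trans (truncnS_gt _) _.
  by rewrite -natrX ler_nat ltnW// ltn_expl.
by apply: (main i) => //; rewrite -ler_pdivrMr.
Qed.

(** The number [L] of levels is the least one reaching above [A], and [l] is an explicit bound for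
    it. In the budget, [2 ^ q] is due to nets of radius [dyad / 2], and [A ^ q * ln (4 * l)] absorbs
    the factor [4 * L] of the union bound at every level below [A]. *)
Lemma sampling_of_nets (R : realType) (G : finType) (F : {ffun G -> R} -> Prop)
    (q A K : R) (m l : nat) :
  (0 < #|G|)%N -> 1 <= q -> 1 <= A -> 0 < K -> (0 < m)%N -> (0 < l)%N ->
  (forall f, F f -> avg (fun x => `|f x| `^ q) = 1) ->
  (forall f, F f -> forall x, `|f x| <= A) ->
  4 * A <= 2 ^+ l ->
  (forall t, 0 < t -> t <= A -> exists s : seq {ffun G -> R},
     (size s)%:R <= expR (K / t `^ q) /\
      forall f, F f -> exists2 g, g \in s & forall x, `|f x - g x| <= t) ->
  8 * 4 `^ q * l%:R * (2 `^ q * K + A `^ q * ln (4 * l%:R)) <= m%:R ->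
  exists x : 'I_m -> G, forall f, F f ->
    (16 * 4 `^ q)^-1 <= m%:R^-1 * \sum_i `|f (x i)| `^ q <= 1 + 7 * 4 `^ q.
Proof.
move=> G0 q1 A1 K0 m0 l0 Favg FA Al nets mK.
pose P L := 2 * A < 2 ^+ L.
have exP : exists L, P L by exists l; rewrite /P; lra.
have [L PL Lmin] := ex_minnP exP.
have Ll : (L <= l)%N by apply: Lmin; rewrite /P; lra.
have L0 : (0 < L)%N by rewrite lt0n; apply/eqP => L0; move: PL; rewrite /P L0 expr0; lra.
have dL k : (k < L)%N -> dyad R k <= A / 2.
  move=> kL; apply: le_trans (_ : 2 ^+ L.-1 / 4 <= _).
    by rewrite /dyad ler_pM2r ?invr_gt0// ler_weXn2l ?ler1n// -ltnS prednK.
  have : 2 ^+ L.-1 <= 2 * A.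
    rewrite leNgt; apply/negP => /Lmin; by rewrite -ltnS prednK// ltnn.
  by lra.
have [net hnet] : exists net : nat -> seq {ffun G -> R}, forall k, (k < L)%N ->
   (size (net k))%:R <= expR (K / (dyad R k / 2) `^ q) /\
      forall f, F f -> exists2 g, g \in net k & forall x, `|f x - g x| <= dyad R k / 2.
  suff ex k : exists s : seq {ffun G -> R}, (k < L)%N ->
     (size s)%:R <= expR (K / (dyad R k / 2) `^ q) /\
      forall f, F f -> exists2 g, g \in s & forall x, `|f x - g x| <= dyad R k / 2.
    by have [net hnet] := choice ex; exists net.
  have [kL|kL] := ltnP k L; last by exists [::].
  have d0 := dyad_gt0 R k; have dA := dL k kL.
  by have [||s hs] := nets (dyad R k / 2); [lra|lra|exists s].
have l1 : 1 <= l%:R :> R by rewrite ler1n.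
have ln0 : 0 <= ln (4 * l%:R) :> R by rewrite ln_ge0//; lra.
pose D := 2 `^ q * K + A `^ q * ln (4 * l%:R).
have Aq : 0 < A `^ q by rewrite powR_gt0//; lra.
have D0 : 0 < D by rewrite ltr_pwDl ?mulr_gt0 ?powR_gt0// mulr_ge0// ltW.
apply: (@sampling R G F q D L m net) => //.
- move=> f Ff x; apply: le_lt_trans (FA f Ff x) _.
  by rewrite /dyad; move: PL; rewrite /P; lra.
- by move=> f k Ff kL; have [_ h] := hnet k kL; exact: h.
- move=> k kL; have [sk _] := hnet k kL.
  have d0 := dyad_gt0 R k; have dA := dL k kL.
  apply: le_trans (_ : expR (ln (4 * l%:R)) * expR (K / (dyad R k / 2) `^ q) <= _).
    rewrite lnK ?posrE; last by lra.
    by rewrite ler_pM// ?mulr_ge0// ler_pM2l// ler_nat.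
  have dq : 0 < dyad R k `^ q by rewrite powR_gt0.
  rewrite -expRD ler_expR ler_pdivlMr// mulrDl addrC /D lerD//.
    have -> : dyad R k `^ q = 2 `^ q * (dyad R k / 2) `^ q.
      by rewrite -powRM//; [congr (_ `^ _); field|lra].
    rewrite le_eqVlt; apply/orP; left; apply/eqP; field.
    by rewrite gt_eqF// powR_gt0; lra.
  rewrite mulrC ler_wpM2r//; apply: ler_powR2r; [lra|exact: ltW|lra].
- apply: le_trans mK; rewrite ler_pM2r//.
  by rewrite ler_wpM2l ?mulr_ge0 ?powR_ge0// ler_nat.
Qed.

Lemma powR_sqr (R : realType) (a : R) : 0 <= a -> a `^ 2 = a ^+ 2.
Proof. exact: (powR_mulrn 2). Qed.

Lemma sqr_le_powR (R : realType) (q a t : R) : 0 < q -> q <= 2 -> 0 <= a -> a <= t ->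
  a ^+ 2 <= t `^ (2 - q) * a `^ q.
Proof.
move=> q0 q2; rewrite le_eqVlt => /predU1P[<- _|a0 at_].
  by rewrite expr0n mulr_ge0 ?powR_ge0.
have -> : a ^+ 2 = a `^ (2 - q) * a `^ q.
  rewrite -powRD; first by rewrite subrK powR_sqr// ltW.
  by rewrite (gt_eqF a0) implybT.
by rewrite ler_wpM2r ?powR_ge0//; apply: ler_powR2r => //; [lra|exact: ltW].
Qed.

(** * Polynomials on a grid, and sampling for [q <= 2] *)

Section TrigGrid.
Variables (R : realType) (d n N : nat) (Q : {set freq_box d n}).
Notation G := {ffun 'I_d -> 'I_N}.

Definition tp_grid (f : {ffun G -> R}) : Prop :=
  exists a b, forall z, f z = tp Q a b (gpt R z).

Lemma tp_gridB (f g : {ffun G -> R}) : tp_grid f -> tp_grid g ->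
  tp_grid [ffun z => f z - g z].
Proof.
move=> [a [b fE]] [a' [b' gE]].
exists (fun k => a k - a' k), (fun k => b k - b' k) => z.
rewrite ffunE fE gE /tp -sumrB; apply: eq_bigr => k _; ring.
Qed.

Lemma conv_tp_grid (H : nat) (w : ('I_d -> nat) -> R) (f : {ffun G -> R}) :
  (2 ^ n <= H)%N -> (H.*2 < N)%N ->
  (forall k, k \in Q -> w (fun j => `|freq k j|%N) = 1) ->
  tp_grid f -> forall x, conv H w f (gpt R x) = f x.
Proof.
move=> nH HN wQ [a [b fE]] x; rewrite fE -(avg_kern_tp a b (gpt R x) nH HN wQ).
by apply: eq_avg => z; rewrite fE.
Qed.

Definition tp_sphere (q : R) (f : {ffun G -> R}) : Prop :=
  tp_grid f /\ avg (fun z => `|f z| `^ q) = 1.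

Lemma sup_attained (f : {ffun G -> R}) : (0 < #|G|)%N ->
  exists x0, forall x, `|f x| <= `|f x0|.
Proof.
move=> /card_gt0P[z0 _].
have := arg_maxP (fun z : G => `|f z|) (erefl (xpredT z0)); case=> x0 _ h.
by exists x0 => x; exact: h.
Qed.

Variable w : ('I_d -> nat) -> R.
Hypothesis wQ : forall k : freq_box d n, w (fun j => `|freq k j|%N) = (k \in Q)%:R.
Hypothesis nN : ((2 ^ n).*2 < N)%N.

Lemma sum_wQ_sqr : \sum_(k : box d (2 ^ n)) w (fun j => `|ifreq (k j)|%N) ^+ 2 = #|Q|%:R.
Proof.
rewrite -sum1_card natr_sum [RHS]big_mkcond; apply: eq_bigr => k _.
have := wQ k; rewrite /freq /ifreq => ->.
by case: (k \in Q); rewrite ?expr1n ?expr0n.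
Qed.

Lemma wQ1 k : k \in Q -> w (fun j => `|freq k j|%N) = 1.
Proof. by rewrite wQ => ->. Qed.

(** Nikol'skii's inequality: at a maximum point the reproducing kernel and Cauchy-Schwarz give [M ^
    2 <= #|Q| * avg (f ^ 2) <= #|Q| * M ^ (2 - q)]. *)
Lemma tp_grid_sup (q : R) (f : {ffun G -> R}) : 1 <= q -> q <= 2 ->
  tp_sphere q f -> forall x, `|f x| `^ q <= #|Q|%:R.
Proof.
move=> q1 q2 [fX f1] x.
have G0 := card_grid_gt0 d nN.
have [x0 hx0] := sup_attained f G0.
apply: le_trans (_ : `|f x0| `^ q <= _); first by apply: ler_powR2r => //; lra.
set M := `|f x0|.
have : 0 <= M by exact: normr_ge0.
rewrite le_eqVlt => /predU1P[<-|M0]; first by rewrite powR0 ?ler0n//; lra.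
have h : M ^+ 2 <= #|Q|%:R * M `^ (2 - q).
  rewrite real_normK ?num_real// -(conv_tp_grid (leqnn _) nN wQ1 fX x0).
  apply: le_trans (CauchySchwarz_avg _ _) _.
  rewrite (avg_kern_sqr w (gpt R x0) nN) sum_wQ_sqr ler_wpM2l//.
  apply: le_trans (_ : M `^ (2 - q) * avg (fun z => `|f z| `^ q) <= _); last first.
    by rewrite f1 mulr1.
  rewrite -avgZl; apply: ler_avg => z.
  by rewrite -[f z ^+ 2]real_normK ?num_real//; apply: sqr_le_powR => //; lra.
have Mq : 0 < M `^ (2 - q) by rewrite powR_gt0.
rewrite -(ler_pM2r Mq); apply: le_trans h.
rewrite -powRD ?(gt_eqF M0) ?implybT// addrC subrK.
by rewrite powR_sqr// ltW.
Qed.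

(** If [h] is the difference of two elements and [|h| <= 2 * t], its mean square is at most [(2 t) ^
    (2 - q) * 2 ^ q * 2 = 8 * t ^ (2 - q)]. The gain is available only for differences at scale [t],
    which is why the net goes through [net_bisect]. *)
Lemma sampling_le2 (q : R) (m l : nat) : 1 <= q -> q <= 2 -> (0 < #|Q|)%N ->
  (0 < m)%N -> (0 < l)%N -> (4 * #|Q| <= 2 ^ l)%N ->
  8 * 4 `^ q * l%:R * (2 `^ q * (4 * (8 * 16 * 64 * #|Q|%:R * ln (4 * #|G|%:R)))
    + #|Q|%:R * ln (4 * l%:R)) <= m%:R ->
  exists x : 'I_m -> G, forall f, tp_sphere q f ->
    (16 * 4 `^ q)^-1 <= m%:R^-1 * \sum_i `|f (x i)| `^ q <= 1 + 7 * 4 `^ q.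
Proof.
move=> q1 q2 Q0 m0 l0 Ql mK.
have G0 := card_grid_gt0 d nN.
have G1 : 1 <= #|G|%:R :> R by rewrite ler1n.
have Q1 : 1 <= #|Q|%:R :> R by rewrite ler1n.
set lG := ln (4 * #|G|%:R) in mK *.
have l4 : 0 < ln 4 :> R by rewrite ln_gt0//; lra.
have lG4 : ln 4 <= lG by rewrite ler_ln ?posrE//; lra.
set K := 8 * 16 * 64 * #|Q|%:R * lG in mK *.
have lG0 : 0 < lG by lra.
have QR : 0 < #|Q|%:R :> R by lra.
have K0 : 0 < K by rewrite mulr_gt0// mulr_gt0//; lra.
pose A := #|Q|%:R `^ q^-1 : R.
have Aq : A `^ q = #|Q|%:R by rewrite -powRrM mulVf ?powRr1//; lra.
have A1 : 1 <= A.
  have <- : 1 `^ q^-1 = 1 :> R by rewrite powR1.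
  by apply: ler_powR2r; rewrite ?invr_ge0//; lra.
have AQ : A <= #|Q|%:R by rewrite -Aq le1r_powR.
have FA f : tp_sphere q f -> forall x, `|f x| <= A.
  move=> Ff x; have := tp_grid_sup q1 q2 Ff x.
  move=> h; have -> : `|f x| = (`|f x| `^ q) `^ q^-1 by rewrite -powRrM mulfV ?powRr1//; lra.
  by apply: ler_powR2r h; rewrite ?invr_ge0 ?powR_ge0//; lra.
apply: (@sampling_of_nets R G (tp_sphere q) q A (4 * K) m l) => //.
- by rewrite mulr_gt0.
- by move=> f [].
- apply: le_trans (_ : (4 * #|Q|)%:R <= _); first by rewrite natrM ler_wpM2l.
  by rewrite -natrX ler_nat.
- move=> t t0 _.
  suff [s [_ h1 h2]] : exists s : seq {ffun G -> R},
     [/\ forall f, f \in s -> tp_sphere q f, (size s)%:R <= expR (4 * K / t `^ q) &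
      forall f, tp_sphere q f -> exists2 g, g \in s & forall x, `|f x - g x| <= t].
    by exists s.
  apply: (@net_bisect R G (tp_sphere q) q A K) => //; [lra|exact: ltW| |].
    move=> {}t {}t0 tA; rewrite ler_pdivlMr ?powR_gt0//.
    apply: le_trans (_ : ln 4 * (4 * #|Q|%:R) <= _).
      rewrite ler_pM2l//; apply: le_trans (_ : (2 * A) `^ q <= _).
        by apply: ler_powR2r; [lra|exact: ltW|].
      rewrite powRM ?Aq; [|lra|lra]; rewrite ler_wpM2r; [by []|lra|].
      have -> : 4 = 2 `^ 2 :> R by rewrite powR_sqr//; ring.
      by rewrite ler_powR//; lra.
    rewrite /K; have : ln 4 * #|Q|%:R <= lG * #|Q|%:R by rewrite ler_pM2r//; lra.
    have : 0 <= ln 4 * #|Q|%:R :> R by rewrite mulr_ge0//; lra.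
    by move=> h1 h2; nra.
  move=> {}t f0 {}t0 tA F0.
  pose F' (h : {ffun G -> R}) := tp_sphere q [ffun z => f0 z + h z] /\ forall z, `|h z| <= 2 * t.
  have e0 : 0 < t / 4 by lra.
  (* With this scale the variance [dl * #|Q|] meets the logarithmic condition of [conv_net] with
     equality, and the energy bound [8 * t ^ (2 - q) / dl] is exactly [K / t ^ q]. *)
  pose dl := (t / 4) ^+ 2 / (64 * #|Q|%:R * lG).
  have den0 : 0 < 64 * #|Q|%:R * lG by rewrite !mulr_gt0.
  have dl0 : 0 < dl by rewrite divr_gt0// exprn_gt0.
  have tq : 0 < t `^ q by rewrite powR_gt0.
  have [|||||s [sF' sc sn]] := @conv_net R d (2 ^ n) N nN unit (fun=> w) F' (fun=> dl)
     (dl * #|Q|%:R) (K / t `^ q) (t / 4) e0.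
  - by rewrite mulr_gt0//; lra.
  - by [].
  - by rewrite big_const card_unit /= addr0 sum_wQ_sqr.
  - rewrite -/lG /dl le_eqVlt; apply/orP; left; apply/eqP; field.
    by rewrite !gt_eqF//; lra.
  - move=> h [[fX f1] ht]; exists (fun _ z => h z).
      rewrite big_const card_unit /= addr0.
      have hq : avg (fun z => `|h z| `^ q) <= 2 `^ q * 2.
        have -> : 2 `^ q * 2 = 2 `^ q * (avg (fun z => `|[ffun z => f0 z + h z] z| `^ q) +
            avg (fun z => `|f0 z| `^ q)).
          by rewrite f1 F0.2.
        rewrite -avgD -avgZl.
        apply: ler_avg => z; rewrite ffunE.
        apply: le_trans (powR_addl2 q1 (normr_ge0 _) (normr_ge0 _)).
        apply: ler_powR2r; [lra|by []|].
        rewrite [X in `|X| <= _](_ : _ = f0 z + h z - f0 z); last by ring.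
        exact: ler_normB.
      have hsq : avg (fun z => h z ^+ 2) <= 8 * t `^ (2 - q).
        apply: le_trans (_ : (2 * t) `^ (2 - q) * avg (fun z => `|h z| `^ q) <= _).
          rewrite -avgZl; apply: ler_avg => z.
          rewrite -[h z ^+ 2]real_normK ?num_real//; apply: sqr_le_powR => //; lra.
        apply: le_trans (ler_wpM2l (powR_ge0 _ _) hq) _.
        rewrite powRM ?(ltW t0)//.
        have -> : 2 `^ (2 - q) * t `^ (2 - q) * (2 `^ q * 2) =
          2 `^ (2 - q) * 2 `^ q * (2 * t `^ (2 - q)) by ring.
        rewrite -powRD ?pnatr_eq0 ?implybT// subrK powR_sqr//.
        by rewrite le_eqVlt; apply/orP; left; apply/eqP; ring.
      rewrite ler_pdivrMl//; apply: le_trans hsq _.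
      have t2 : t ^+ 2 = t `^ (2 - q) * t `^ q.
        rewrite -powRD; first by rewrite subrK powR_sqr// ltW.
        by rewrite (gt_eqF t0) implybT.
      rewrite /dl exprMn t2 /K le_eqVlt; apply/orP; left; apply/eqP; field.
      by rewrite !gt_eqF//; lra.
    move=> x; rewrite big_const card_unit /= addr0.
    have hX : tp_grid h.
      have := tp_gridB fX F0.1; congr (tp_grid _); apply/ffunP => z.
      by rewrite !ffunE; ring.
    by rewrite (conv_tp_grid (leqnn _) nN wQ1 hX) subrr normr0 ltW.
  exists [seq [ffun z => f0 z + h z] | h : {ffun G -> R} <- s]; split.
  - by move=> f /mapP[h hs ->]; have [] := sF' h hs.
  - by rewrite size_map.
  - move=> f Ff ft.
    have Fh : F' [ffun z => f z - f0 z].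
      split; last by move=> z; rewrite ffunE.
      by have := Ff; congr (tp_sphere _ _); apply/ffunP => z; rewrite !ffunE; ring.
    have [g gs hg] := sn _ Fh; exists [ffun z => f0 z + g z]; first by apply: map_f.
    move=> x; rewrite ffunE; have := hg x; rewrite ffunE.
    have -> : f x - f0 x - g x = f x - (f0 x + g x) by ring.
    by lra.
- by rewrite Aq.
Qed.

End TrigGrid.

(** Cauchy-Schwarz in each convolution and then over the pieces. The two factors are the variance
    and the energy of [conv_net], so one choice of [delta] serves both the sup bound and the
    nets. *)
Lemma conv_sqr_le (R : realType) (d H N : nat) (S : finType) (w : S -> ('I_d -> nat) -> R)
    (delta : S -> R) (g : S -> {ffun 'I_d -> 'I_N} -> R) (x : 'I_d -> R) :
  (H.*2 < N)%N -> (forall s, 0 < delta s) ->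
  (\sum_s conv H (w s) (g s) x) ^+ 2 <=
  (\sum_s delta s * (\sum_(k : box d H) w s (fun j => `|ifreq (k j)|%N) ^+ 2)) *
  (\sum_s (delta s)^-1 * avg (fun z => g s z ^+ 2)).
Proof.
move=> HN d0.
apply: le_trans (_ : (\sum_s Num.sqrt (delta s * \sum_(k : box d H) w s (fun j => `|ifreq (k j)|%N) ^+ 2) *
   Num.sqrt ((delta s)^-1 * avg (fun z => g s z ^+ 2))) ^+ 2 <= _).
  rewrite -[leLHS]real_normK ?num_real// lerXn2r ?nnegrE//.
    by rewrite sumr_ge0// => s _; rewrite mulr_ge0.
  apply: le_trans (ler_norm_sum _ _ _) _; apply: ler_sum => s _.
  have A0 : 0 <= \sum_(k : box d H) w s (fun j => `|ifreq (k j)|%N) ^+ 2.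
    by rewrite sumr_ge0// => k _; exact: sqr_ge0.
  rewrite -sqrtrM; last by rewrite mulr_ge0// ltW.
  rewrite mulrACA mulfV ?gt_eqF// mul1r -(avg_kern_sqr (w s) x HN) -sqrtr_sqr ler_sqrt.
    exact: CauchySchwarz_avg.
  by rewrite mulr_ge0// avg_ge0// => z; exact: sqr_ge0.
apply: le_trans (CauchySchwarz_sum _ _) _.
rewrite le_eqVlt; apply/orP; left; apply/eqP; congr (_ * _); apply: eq_bigr => s _;
  rewrite sqr_sqrtr// mulr_ge0 ?invr_ge0 ?(ltW (d0 s))//.
- by rewrite sumr_ge0// => k _; exact: sqr_ge0.
- by rewrite avg_ge0// => z; exact: sqr_ge0.
Qed.

(** * Sampling for [q > 2], with a truncation adapted to each piece of the kernel *)

Section SplitKernel.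
Variables (R : realType) (d n H N : nat) (Q : {set freq_box d n}) (q : R).
Notation G := {ffun 'I_d -> 'I_N}.
Hypotheses (nH : (2 ^ n <= H)%N) (HN : (H.*2 < N)%N) (q2 : 2 < q).
Variables (S : finType) (I : {pred S}) (W : S -> ('I_d -> nat) -> R).
Variables (lam t delta : S -> R) (V K : R).
Hypotheses (t0 : forall s, 0 < t s) (d0 : forall s, 0 < delta s) (V0 : 0 < V) (K0 : 0 < K).
Hypothesis WQ : forall k, k \in Q -> \sum_s W s (fun j => `|freq k j|%N) = 1.
Hypothesis WI : forall s, s \notin I -> forall k, W s k = 0.
Hypothesis Wlam : forall s x,
  avg (fun z : G => `|kern H (W s) (fun j => x j - gpt R z j)|) <= lam s.
Hypothesis lamt : \sum_s lam s * t s <= 1.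
Hypothesis WV : \sum_s delta s * (\sum_(k : box d H) W s (fun j => `|ifreq (k j)|%N) ^+ 2) <= V.
Hypothesis tK : \sum_(s in I) (delta s)^-1 * t s `^ (2 - q) <= K.

(* The part of [f] below the threshold [e t_s] is small in sup norm after
   convolution, the part above it is small in mean square. *)
Lemma split_kernel (f : {ffun G -> R}) (e : R) : tp_sphere Q q f -> 0 < e ->
  exists2 g : S -> G -> R, \sum_s (delta s)^-1 * avg (fun z => g s z ^+ 2) <= K * e `^ (2 - q) &
    forall x, `|f x - \sum_s conv H (W s) (g s) (gpt R x)| <= e.
Proof.
move: (q2) => q2' [fX f1] e0.
pose g s (z : G) := if (s \in I) && (e * t s < `|f z|) then f z else 0.
exists g.
  apply: le_trans (_ : \sum_(s in I) (delta s)^-1 * t s `^ (2 - q) * e `^ (2 - q) <= _); last first.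
    by rewrite -mulr_suml ler_wpM2r ?powR_ge0.
  rewrite [leRHS]big_mkcond; apply: ler_sum => s _.
  case: ifPn => sI; last first.
    rewrite (_ : avg _ = 0) ?mulr0//.
    transitivity (avg (fun _ : G => 0 : R)); last exact: (avg_cst _ (card_grid_gt0 d HN)).
    by apply: eq_avg => z; rewrite /g (negbTE sI) expr0n.
  rewrite -mulrA ler_wpM2l ?invr_ge0 ?(ltW (d0 s))// -powRM ?(ltW (t0 s)) ?(ltW e0)//.
  rewrite [t s * e]mulrC.
  apply: le_trans (_ : (e * t s) `^ (2 - q) * avg (fun z => `|f z| `^ q) <= _); last first.
    by rewrite f1 mulr1.
  rewrite -avgZl; apply: ler_avg => z; rewrite /g sI /=.
  have et0 : 0 < e * t s by rewrite mulr_gt0.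
  case: ifPn => h; last by rewrite expr0n mulr_ge0 ?powR_ge0.
  have fz0 : 0 < `|f z| by exact: lt_trans h.
  rewrite -[f z ^+ 2]real_normK ?num_real// -powR_sqr//.
  have -> : `|f z| `^ 2 = `|f z| `^ (2 - q) * `|f z| `^ q.
    by rewrite -powRD ?subrK// (gt_eqF fz0) implybT.
  (* The exponent [2 - q] is negative, so above the threshold the power is at most its value at the
     threshold. *)
  rewrite ler_wpM2r ?powR_ge0// -opprB !powRN lef_pV2 ?posrE ?powR_gt0//.
  by apply: ler_powR2r; [lra|exact: ltW|exact: ltW].
move=> x.
have fE : f x = \sum_s conv H (W s) f (gpt R x).
  rewrite -[LHS](conv_tp_grid (w := fun k => \sum_s W s k) nH HN WQ fX x) /conv -avg_sum.
  by apply: eq_avg => z; rewrite kern_sum mulr_suml.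
rewrite fE -sumrB; apply: le_trans (ler_norm_sum _ _ _) _.
(* What lies below the threshold of piece [s] costs at most [lam s * (e * t s)] in sup norm, and
   [lamt] keeps the total within [e]. *)
apply: le_trans (_ : \sum_s lam s * t s * e <= _); last first.
  by rewrite -mulr_suml ler_piMl// ltW.
apply: ler_sum => s _; rewrite /conv -avgB.
have [sI|sI] := boolP (s \in I); last first.
  have k0 y : kern H (W s) y = 0.
    by rewrite /kern big1// => k _; rewrite WI// mul0r.
  rewrite (_ : avg _ = 0).
    rewrite normr0 mulr_ge0 ?(ltW e0)// mulr_ge0 ?(ltW (t0 s))//.
    by apply: le_trans (Wlam s (gpt R x)); exact: avg_ge0.
  transitivity (avg (fun _ : G => 0 : R)); last exact: (avg_cst _ (card_grid_gt0 d HN)).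
  by apply: eq_avg => z; rewrite k0 !mul0r subrr.
apply: le_trans (ler_norm_avg _) _.
apply: le_trans (_ : avg (fun z : G => `|kern H (W s) (fun j => gpt R x j - gpt R z j)| * (e * t s)) <= _).
  apply: ler_avg => z; rewrite -mulrBr normrM ler_wpM2l// /g sI /=.
  by case: ltP => h; rewrite ?subrr ?normr0 ?subr0// mulr_ge0// ltW.
by rewrite avgZr [e * t s]mulrC mulrA ler_wpM2r ?(ltW e0)// ler_wpM2r ?(ltW (t0 s)).
Qed.

(** The counterpart of [tp_grid_sup]: one [e] is lost below the thresholds, and the square of the
    rest is at most [V * K * e ^ (2 - q) <= e ^ 2] by [conv_sqr_le]. *)
Lemma tp_sphere_sup (f : {ffun G -> R}) (e : R) : tp_sphere Q q f -> 0 < e ->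
  V * K <= e `^ q -> forall x, `|f x| <= 2 * e.
Proof.
move: (q2) => q2' fS e0 VKe x; have [g gK gf] := split_kernel fS e0.
have := gf x; set s := \sum_s _ => h.
suff : `|s| <= e.
  by have := ler_normD (f x - s) s; rewrite subrK; lra.
rewrite -(ler_pXn2r (n := 2))// ?nnegrE ?(ltW e0)// real_normK ?num_real//.
apply: le_trans (conv_sqr_le W g (gpt R x) HN d0) _.
apply: le_trans (_ : V * (K * e `^ (2 - q)) <= _).
  apply: ler_pM => //.
    by rewrite sumr_ge0// => u _; rewrite mulr_ge0 ?(ltW (d0 u))// sumr_ge0// => k _; exact: sqr_ge0.
  rewrite sumr_ge0// => u _; rewrite mulr_ge0 ?invr_ge0 ?(ltW (d0 u))// avg_ge0// => z.
  exact: sqr_ge0.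
rewrite mulrA; apply: le_trans (ler_wpM2r (powR_ge0 _ _) VKe) _.
by rewrite -powRD ?(gt_eqF e0) ?implybT// addrC subrK powR_sqr// ltW.
Qed.

(** The mean square of the upper part is controlled for every single [f], not just for differences,
    so [conv_net] yields a net of each radius directly, without bisection. *)
Lemma sampling_gt2 (m l : nat) : 1 <= V * K -> (0 < m)%N -> (0 < l)%N -> 8 * (V * K) <= 2 ^+ l ->
  8 * 4 `^ q * l%:R * (2 `^ q * ((64 * 4 `^ q + 2 `^ q) * (V * K) * ln (4 * #|G|%:R))
    + 2 `^ q * (V * K) * ln (4 * l%:R)) <= m%:R ->
  exists x : 'I_m -> G, forall f, tp_sphere Q q f ->
    (16 * 4 `^ q)^-1 <= m%:R^-1 * \sum_i `|f (x i)| `^ q <= 1 + 7 * 4 `^ q.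
Proof.
move: (q2) => q2'; set B := V * K => B1 m0 l0 Bl mK.
have G0 := card_grid_gt0 d HN.
have G1 : 1 <= #|G|%:R :> R by rewrite ler1n.
have q1 : 1 <= q by lra.
set lG := ln (4 * #|G|%:R) in mK *.
have l4 : 0 < ln 4 :> R by rewrite ln_gt0//; lra.
have lG4 : ln 4 <= lG by rewrite ler_ln ?posrE//; lra.
have lG0 : 0 < lG by lra.
have B0 : 0 < B by lra.
pose E := B `^ q^-1.
have Eq : E `^ q = B by rewrite -powRrM mulVf ?powRr1//; lra.
have E1 : 1 <= E.
  have <- : 1 `^ q^-1 = 1 :> R by rewrite powR1.
  by apply: ler_powR2r; rewrite ?invr_ge0//; lra.
have EB : E <= B by rewrite -Eq le1r_powR.
have p0 a : 0 < a -> 0 < a `^ q by move=> a0; rewrite powR_gt0.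
have p2 : 0 < 2 `^ q :> R by apply: p0.
have p4 : 0 < 4 `^ q :> R by apply: p0.
have Aq : (2 * E) `^ q = 2 `^ q * B by rewrite powRM ?Eq//; lra.
(* The term [64 * 4 ^ q] is the energy at error [u / 4]; the term [2 ^ q] absorbs the factor 4 of
   the packing bound, as [u ^ q <= (2 * E) ^ q = 2 ^ q * B]. *)
pose KK := (64 * 4 `^ q + 2 `^ q) * B * lG.
have KK0 : 0 < KK by rewrite mulr_gt0// mulr_gt0// addr_gt0// mulr_gt0.
apply: (@sampling_of_nets R G (tp_sphere Q q) q (2 * E) KK m l) => //.
- lra.
- by move=> f [].
- by move=> f fS x; apply: tp_sphere_sup => //; [lra|rewrite Eq].
- by lra.
- move=> u u0 uE.
  have e0 : 0 < u / 4 by lra.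
  (* Rescales [delta] so that the variance [c * V] meets the logarithmic condition with equality. *)
  pose c := (u / 4) ^+ 2 / (64 * V * lG).
  have c0 : 0 < c by rewrite divr_gt0 ?exprn_gt0// !mulr_gt0.
  have eq0 : 0 < (u / 4) `^ q by exact: p0.
  have [|||||s [sF sc sn]] := @conv_net R d H N HN S W (tp_sphere Q q) (fun s => c * delta s)
     (c * V) (64 * lG * B / (u / 4) `^ q) (u / 4) e0.
  - by rewrite mulr_gt0.
  - by move=> s; rewrite mulr_gt0.
  - under eq_bigr do rewrite -mulrA.
    by rewrite -mulr_sumr ler_pM2l.
  - rewrite -/lG /c le_eqVlt; apply/orP; left; apply/eqP; field.
    by rewrite !gt_eqF.
  - move=> f fS; have [g gK gf] := split_kernel fS e0; exists g => //.
    under eq_bigr do rewrite invfM -mulrA.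
    rewrite -mulr_sumr ler_pdivrMl//; apply: le_trans gK _.
    have e2 : (u / 4) ^+ 2 = (u / 4) `^ (2 - q) * (u / 4) `^ q.
      rewrite -powRD; first by rewrite subrK powR_sqr// ltW.
      by rewrite (gt_eqF e0) implybT.
    rewrite /c e2 /B le_eqVlt; apply/orP; left; apply/eqP; field.
    by rewrite !gt_eqF.
  exists s; split; last first.
    by move=> f fS; have [h hs hh] := sn f fS; exists h => // x; have := hh x; lra.
  apply: le_trans sc _; rewrite -[X in X * _](@lnK R) ?posrE// -expRD ler_expR.
  have uq : 0 < u `^ q by exact: p0.
  have -> : 64 * lG * B / (u / 4) `^ q = 64 * 4 `^ q * B * lG / u `^ q.
    have -> : u `^ q = 4 `^ q * (u / 4) `^ q.
      by rewrite -powRM ?(ltW e0)//; congr (_ `^ _); field.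
    by field; rewrite !gt_eqF.
  rewrite /KK ler_pdivlMr// mulrDl mulfVK ?gt_eqF//.
  have : ln 4 * u `^ q <= lG * (2 `^ q * B).
    rewrite -Aq; apply: ler_pM; [exact: ltW|exact: ltW|by []|].
    by apply: ler_powR2r => //; [lra|exact: ltW].
  by move=> h; nra.
- by rewrite Aq.
Qed.

End SplitKernel.

(** * Splitting the kernel of the hyperbolic cross *)

Lemma geometric_le (R : realType) (x : R) (n : nat) : 0 <= x -> x < 1 ->
  \sum_(s < n) x ^+ s <= (1 - x)^-1.
Proof.
move=> x0 x1; have x1' : 0 < 1 - x by rewrite subr_gt0.
rewrite -[leRHS]mul1r ler_pdivlMr// mulrC.
by have := subrX1 x n; have := exprn_ge0 n x0; lra.
Qed.

Section HyperbolicKernel.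
Variables (R : realType) (d n nu : nat) (gamma : 'I_d.+1 -> R).
Hypotheses (nu0 : (0 < nu)%N) (nud : (nu <= d.+1)%N).
Hypothesis g1 : forall j : 'I_d.+1, (j < nu)%N -> gamma j = 1.
Hypothesis g2 : forall j : 'I_d.+1, (nu <= j)%N -> 1 < gamma j.

Notation idx := {ffun 'I_d.+1 -> 'I_n.+1}.

Definition geom_cst (y : 'I_d.+1 -> R) : R := \prod_(j : 'I_d.+1 | (nu <= j)%N) (1 - y j)^-1.

Section Geometric.
Variable y : 'I_d.+1 -> R.
Hypotheses (y1 : forall j : 'I_d.+1, (j < nu)%N -> y j = 1).
Hypothesis y2 : forall j : 'I_d.+1, (nu <= j)%N -> 0 < y j < 1.

Lemma geom_ge0 j : 0 <= y j.
Proof. by case: (ltnP j nu) => [/y1 ->|/y2/andP[/ltW]]. Qed.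

Lemma geom_cst_ge1 : 1 <= geom_cst y.
Proof.
have -> : (1 : R) = \prod_(j : 'I_d.+1 | (nu <= j)%N) 1 by rewrite big1.
apply: ler_prod => j /y2/andP[h0 h1]; rewrite ler01/= invf_ge1 ?subr_gt0//.
by rewrite gerBl ltW.
Qed.

(** Direction 0 is frozen, each of the [nu - 1] other directions of ratio 1 gives [n + 1], and the
    remaining ones are geometric series. *)
Lemma sum_geom_all :
  \sum_(s : idx | s ord0 == ord0) \prod_j y j ^+ s j <= n.+1%:R ^+ nu.-1 * geom_cst y.
Proof.
pose h (j : 'I_d.+1) (i : 'I_n.+1) : R := if j == ord0 then (i == ord0)%:R else y j ^+ i.
have h0 j i : 0 <= h j i by rewrite /h; case: ifP => // _; rewrite exprn_ge0// geom_ge0.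
apply: le_trans (_ : \sum_(s : idx) \prod_j h j (s j) <= _).
  rewrite [leLHS]big_mkcond; apply: ler_sum => s _; case: ifPn => s0; last first.
    by rewrite prodr_ge0.
  rewrite le_eqVlt; apply/orP; left; apply/eqP; apply: eq_bigr => j _.
  by rewrite /h; case: eqP => // ->; rewrite s0 (eqP s0) expr0.
rewrite -bigA_distr_bigA.
pose b (j : 'I_d.+1) : R := if j == ord0 then 1 else if (j < nu)%N then n.+1%:R else 1.
apply: le_trans (_ : \prod_j (b j * (if (nu <= j)%N then (1 - y j)^-1 else 1)) <= _).
  apply: ler_prod => j _; apply/andP; split; first by rewrite sumr_ge0.
  rewrite /b /h; case: eqP => [->|_].
    rewrite leqNgt nu0 mulr1 (bigD1 ord0)//= big1 ?addr0// => i /negbTE ->.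
    by [].
  case: (ltnP j nu) => [jn|jn].
    rewrite mulr1 y1//; under eq_bigr do rewrite expr1n.
    by rewrite sumr_const card_ord.
  by rewrite mul1r; have /andP[h2 h1] := y2 jn; rewrite geometric_le// ltW.
rewrite big_split /= -big_mkcond /= ler_wpM2r//.
  by apply: le_trans geom_cst_ge1.
rewrite big_ord_recl /b /= mul1r.
have -> : \prod_(i < d) (if (lift ord0 i < nu)%N then n.+1%:R else 1) =
   \prod_(i < d) (if (i < nu.-1)%N then n.+1%:R else 1) :> R.
  by apply: eq_bigr => i _; rewrite lift0 -[in LHS](prednK nu0) ltnS.
rewrite -big_mkcond /= -(big_ord_widen d (fun=> n.+1%:R)); last by rewrite -ltnS prednK.
by rewrite prodr_const card_ord.
Qed.

(** With all directions of ratio 1 frozen, no power of [n] appears. *)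
Lemma sum_geom_image :
  \sum_(s : idx | [forall j : 'I_d.+1, (j < nu)%N ==> (s j == ord0)]) \prod_j y j ^+ s j
    <= geom_cst y.
Proof.
pose h (j : 'I_d.+1) (i : 'I_n.+1) : R := if (j < nu)%N then (i == ord0)%:R else y j ^+ i.
have h0 j i : 0 <= h j i by rewrite /h; case: ifP => // _; rewrite exprn_ge0// geom_ge0.
apply: le_trans (_ : \sum_(s : idx) \prod_j h j (s j) <= _).
  rewrite [leLHS]big_mkcond; apply: ler_sum => s _; case: ifPn => s0; last first.
    by rewrite prodr_ge0.
  rewrite le_eqVlt; apply/orP; left; apply/eqP; apply: eq_bigr => j _.
  rewrite /h; case: ifPn => // jn; move/forallP : s0 => /(_ j); rewrite jn /= => s0.
  by rewrite s0 (eqP s0) expr0.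
rewrite -bigA_distr_bigA /geom_cst [leRHS]big_mkcond.
apply: ler_prod => j _; apply/andP; split; first by rewrite sumr_ge0.
rewrite /h; case: (ltnP j nu) => jn.
  by rewrite (bigD1 ord0)//= big1 ?addr0// => i /negbTE ->.
by have /andP[h2 h1] := y2 jn; rewrite geometric_le// ltW.
Qed.

End Geometric.

Definition ratio (b : R) (j : 'I_d.+1) : R := 2 `^ (- (b * (gamma j - 1))).

Lemma ratio1 b (j : 'I_d.+1) : (j < nu)%N -> ratio b j = 1.
Proof. by move=> /g1 jn; rewrite /ratio jn subrr mulr0 oppr0 powRr0. Qed.

Lemma ratio2 b (j : 'I_d.+1) : 0 < b -> (nu <= j)%N -> 0 < ratio b j < 1.
Proof.
move=> b0 /g2 jn; rewrite powR_gt0//=.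
rewrite /ratio powRN invf_lt1 ?powR_gt0// -[ltLHS](powRr0 (2 : R)).
rewrite /powR !ifF; [|by rewrite pnatr_eq0..].
by rewrite ltr_expR mul0r mulr_gt0 ?ln_gt0 ?mulr_gt0//; lra.
Qed.

Lemma gamma_ge1 j : 1 <= gamma j.
Proof. by case: (ltnP j nu) => [/g1 ->//|/g2/ltW]. Qed.

(** Up to a factor depending only on [d], [2 ^ n * weight s] bounds the sum of the coefficients of
    block [s]; see [sum_block]. *)
Definition weight (s : idx) : R := 2 `^ (- \sum_j (gamma j - 1) * (s j)%:R).

Lemma weight_gt0 s : 0 < weight s.
Proof. by rewrite powR_gt0. Qed.

Lemma weight_powR b (s : idx) : weight s `^ b = \prod_j ratio b j ^+ s j.
Proof.
transitivity (\prod_j 2 `^ (- (b * (gamma j - 1) * (s j)%:R)) : R).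
  rewrite /weight -powRrM mulrC mulrN mulr_sumr -sumrN.
  rewrite (big_morph (fun x : R => 2 `^ x) (id1 := 1) (op1 := *%R)); first last.
  - exact: powRr0.
  - by move=> x z; rewrite powRD// pnatr_eq0 implybT.
  - by apply: eq_bigr => j _; rewrite mulrA.
by apply: eq_bigr => j _; rewrite /ratio -powR_mulrn ?powR_ge0// -powRrM mulNr.
Qed.

(** The largest integer exponent left to coordinate 0, where [gamma] is 1, once the other
    coordinates have taken their share of [n]. *)
Definition level (s : idx) : nat := Num.truncn (n%:R - \sum_j gamma j * (s j)%:R).

Definition admissible (s : idx) : bool :=
  (s ord0 == ord0) && (\sum_j gamma j * (s j)%:R <= n%:R).

(** Coordinate 0 takes a whole de la Vallee Poussin kernel instead of dyadic pieces. Only [nu - 1]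
    directions without decay remain free, and [admissible] sets [s ord0] to 0. *)
Definition factor (s : idx) (j : 'I_d.+1) : nat -> R :=
  if j == ord0 then vp R (level s) else dvp R (s j).

Definition block (s : idx) (k : 'I_d.+1 -> nat) : R := \prod_j factor s j (k j).

(* The kernel of [s] is summed over the directions [j < nu], along which the
   weight does not decay. *)
Definition tail (s : idx) : idx := [ffun j : 'I_d.+1 => if (j < nu)%N then ord0 else s j].

Definition blocks (t : idx) (k : 'I_d.+1 -> nat) : R :=
  \sum_(s | admissible s && (tail s == t)) block s k.

Lemma weight_tail s : weight (tail s) = weight s.
Proof.
rewrite /weight; congr (2 `^ (- _)); apply: eq_bigr => j _; rewrite ffunE.
by case: ifP => // /g1 ->; rewrite subrr !mul0r.
Qed.

Lemma factor_ge0 s j k : 0 <= factor s j k.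
Proof. by rewrite /factor; case: ifP; [rewrite vp_ge0|rewrite dvp_ge0]. Qed.

Lemma block_ge0 s k : 0 <= block s k.
Proof. by apply: prodr_ge0 => j _; exact: factor_ge0. Qed.

Lemma blocks_ge0 t k : 0 <= blocks t k.
Proof. by apply: sumr_ge0 => s _; exact: block_ge0. Qed.

(** A majorant of [factor] that forgets the cut in coordinate 0, so that the sum over all [s]
    factorizes and telescopes. *)
Definition pick0 (k : 'I_d.+1 -> nat) (j : 'I_d.+1) (i : 'I_n.+1) : R :=
  if j == ord0 then (i == ord0)%:R else dvp R i (k j).

Lemma pick0_ge0 k j i : 0 <= pick0 k j i.
Proof. by rewrite /pick0; case: ifP => // _; exact: dvp_ge0. Qed.

Lemma sum_pick0 k : \sum_(s : idx) \prod_j pick0 k j (s j) =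
  \prod_(j | j != ord0) vp R n (k j).
Proof.
rewrite -bigA_distr_bigA [RHS]big_mkcond; apply: eq_bigr => j _; rewrite /pick0.
case: eqP => /= _; last by rewrite sum_dvp.
by rewrite (bigD1 ord0)//= big1 ?addr0// => i /negbTE ->.
Qed.

Lemma block_le_pick0 (s : idx) k : s ord0 = ord0 -> block s k <= \prod_j pick0 k j (s j).
Proof.
move=> s0; apply: ler_prod => j _; rewrite factor_ge0 /factor /pick0.
case: (eqVneq j ord0) => [j0|_] //=; have -> : s j = ord0 by rewrite j0.
by rewrite eqxx vp_le1.
Qed.

(** Allows the squares of the coefficients to be replaced by the coefficients themselves. *)
Lemma blocks_le1 t k : blocks t k <= 1.
Proof.
apply: le_trans (_ : \prod_(j | j != ord0) vp R n (k j) <= _); last first.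
  have e : \prod_(j : 'I_d.+1 | j != ord0) 1 = 1 :> R by rewrite big1.
  rewrite -[leRHS]e.
  by apply: ler_prod => j _; rewrite vp_ge0 vp_le1.
rewrite -sum_pick0 /blocks big_mkcond; apply: ler_sum => s _.
case: ifPn => [/andP[/andP[/eqP s0 _] _]|_]; first exact: block_le_pick0.
by apply: prodr_ge0 => j _; exact: pick0_ge0.
Qed.

Lemma sum_blocks k : \sum_t blocks t k = \sum_(s | admissible s) block s k.
Proof. by rewrite -(partition_big tail xpredT). Qed.

(** If [k] lies in the dyadic block of [s], nonzero [dvp] factors force [t_j <= s_j] for [j > 0].
    Then [t] is admissible with level at least [s ord0], so its factor in coordinate 0 equals 1, and
    no term of the full telescoping sum is lost. *)
Lemma sum_blocks_hcross (k : freq_box d.+1 n) : k \in hcross gamma n ->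
  \sum_t blocks t (fun j => `|freq k j|%N) = 1.
Proof.
rewrite inE => /asboolP[s [sok /forallP srho]].
rewrite sum_blocks; pose kk := fun j => `|freq k j|%N; rewrite -/kk.
have kn j : vp R n (kk j) = 1.
  by rewrite vp_eq1// /kk /freq; have := ltn_ord (k j); lia.
have -> : (1 : R) = \prod_(j < d.+1 | j != ord0) vp R n (kk j) by rewrite big1.
rewrite -sum_pick0 [LHS]big_mkcond; apply: eq_bigr => t _.
have gam0 j : 0 <= gamma j by apply: le_trans (gamma_ge1 j).
have klt j : (kk j < 2 ^ s j)%N by have /andP[] := srho j.
have [nz|/forallPn[j]] := boolP [forall j, pick0 kk j (t j) != 0]; last first.
  rewrite negbK => /eqP j0; have p0 : \prod_j pick0 kk j (t j) = 0 by rewrite (bigD1 j)//= j0 mul0r.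
  rewrite p0; case: ifPn => // /andP[/eqP t0 _].
  by apply/eqP; rewrite eq_le block_ge0 andbT -p0 block_le_pick0.
have t0 : t ord0 = ord0.
  by move/forallP : nz => /(_ ord0); rewrite /pick0 eqxx; case: (t ord0 =P ord0) => //= _; rewrite eqxx.
have ts j : (t j <= s j)%N.
  have [->|j0] := eqVneq j ord0; first by rewrite t0.
  move/forallP : nz => /(_ j); rewrite /pick0 (negbTE j0).
  case: (posnP (t j)) => [->//|tj0]; apply: contraR; rewrite -ltnNge => st.
  rewrite dvp_eq0//; apply: leq_trans (ltnW (klt j)) _.
  by rewrite leq_exp2l// -ltnS prednK.
have sums : \sum_j gamma j * (t j)%:R + (s ord0)%:R <= n%:R.
  apply: le_trans sok; rewrite big_ord_recl t0 mulr0 add0r [leRHS]big_ord_recl g1// mul1r addrC.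
  by rewrite lerD2l ler_sum// => j _; rewrite ler_wpM2l// ler_nat.
rewrite ifT; last first.
  by rewrite /admissible t0 eqxx /= (le_trans _ sums)// lerDl.
apply: eq_bigr => j _; rewrite /factor /pick0; case: eqP => // ->.
rewrite t0 eqxx vp_eq1//; apply: leq_trans (ltnW (klt ord0)) _.
rewrite leq_exp2l// /level truncn_ge_nat; first by lra.
by have := ler0n R (s ord0); lra.
Qed.

(** The exponents add up to [level s + \sum s_j <= n - \sum (gamma_j - 1) * s_j], which is where
    [weight] comes from. *)
Lemma sum_block (H : nat) s : admissible s ->
  \sum_(k : box d.+1 H) block s (fun j => `|ifreq (k j)|%N) <= 4 ^+ d.+1 * 2 ^+ n * weight s.
Proof.
move=> /andP[/eqP s0 sn].
rewrite /block -(bigA_distr_bigA (fun j (i : 'I_H.*2.+1) => factor s j `|ifreq i|%N)).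
pose e j : nat := if j == ord0 then level s else s j.
apply: le_trans (_ : \prod_j (4 * 2 ^+ e j) <= _).
  apply: ler_prod => j _; apply/andP; split; first by rewrite sumr_ge0// => i _; exact: factor_ge0.
  apply: le_trans (sum_ifreq_vp R H (e j)); apply: ler_sum => i _; rewrite /factor /e.
  by case: eqP => // _; exact: dvp_le_vp.
rewrite big_split /= prodr_const card_ord -mulrA ler_wpM2l ?exprn_ge0//.
rewrite -expr_sum -powR_mulrn// -[2 ^+ n]powR_mulrn// -powRD ?pnatr_eq0 ?implybT//.
apply: ler_powR; first by rewrite ler1n.
have lev : (level s)%:R <= n%:R - \sum_j gamma j * (s j)%:R by rewrite truncn_le// subr_ge0.
rewrite natr_sum big_ord_recl /= /e eqxx.
have -> : \sum_(i < d) ((if lift ord0 i == ord0 then level s else s (lift ord0 i)))%:R =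
   \sum_j (s j)%:R :> R.
  by rewrite [RHS]big_ord_recl s0 add0r; apply: eq_bigr.
have -> : \sum_j (gamma j - 1) * (s j)%:R = \sum_j gamma j * (s j)%:R - \sum_j (s j)%:R.
  by rewrite -sumrB; apply: eq_bigr => j _; rewrite mulrBl mul1r.
by lra.
Qed.

Lemma sum_blocks_sqr (H : nat) t :
  \sum_(k : box d.+1 H) blocks t (fun j => `|ifreq (k j)|%N) ^+ 2 <=
  \sum_(s | admissible s && (tail s == t)) 4 ^+ d.+1 * 2 ^+ n * weight s.
Proof.
apply: le_trans (_ : \sum_(k : box d.+1 H) blocks t (fun j => `|ifreq (k j)|%N) <= _).
  by apply: ler_sum => k _; rewrite expr2 ler_piMl ?blocks_ge0 ?blocks_le1.
rewrite exchange_big /=; apply: ler_sum => s /andP[sa _].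
exact: sum_block.
Qed.

Lemma avg_norm_kern_blocks (N : nat) t (x : 'I_d.+1 -> R) : ((2 ^ n.+1).*2 < N)%N ->
  avg (fun z : {ffun 'I_d.+1 -> 'I_N} =>
     `|kern (2 ^ n.+1) (blocks t) (fun j => x j - gpt R z j)|) <=
  \sum_(s | admissible s && (tail s == t)) 6 ^+ d.+1.
Proof.
move=> HN.
apply: le_trans (_ : avg (fun z : {ffun 'I_d.+1 -> 'I_N} =>
   \sum_(s | admissible s && (tail s == t))
     `|kern (2 ^ n.+1) (block s) (fun j => x j - gpt R z j)|) <= _).
  by apply: ler_avg => z; rewrite /blocks kern_sum ler_norm_sum.
rewrite avg_sum; apply: ler_sum => s /andP[/andP[_ sn] _].
rewrite -[d.+1 in leRHS]card_ord -prodr_const; apply: avg_norm_kern_prod => j y.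
rewrite /factor; case: eqP => _.
  apply: le_trans (avg_norm_kern1_vp y _ HN) _; last by lra.
  rewrite leqW// leq_exp2l// ltnS truncn_le_nat.
  suff : 0 <= \sum_j0 gamma j0 * (s j0)%:R by rewrite -natr1; lra.
  by apply: sumr_ge0 => i _; rewrite mulr_ge0// (le_trans _ (gamma_ge1 i)).
apply: avg_norm_kern1_dvp HN; rewrite leqW// leq_exp2l// ltn_ord//.
Qed.

End HyperbolicKernel.

Lemma powR_ge1 (R : realType) (a r : R) : 1 <= a -> 0 <= r -> 1 <= a `^ r.
Proof.
move=> a1 r0; have {1}<- : 1 `^ r = 1 :> R by rewrite powR1.
by apply: ler_powR2r.
Qed.

Section HyperbolicSampling.
Variables (R : realType) (d nu : nat) (gamma : 'I_d.+1 -> R) (q : R).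
Hypotheses (nu0 : (0 < nu)%N) (nud : (nu <= d.+1)%N).
Hypothesis g1 : forall j : 'I_d.+1, (j < nu)%N -> gamma j = 1.
Hypothesis g2 : forall j : 'I_d.+1, (nu <= j)%N -> 1 < gamma j.

(** Thresholds and scales are powers of the weight, chosen so that the sums in [lamt], [V] and [K]
    keep the positive exponents [a], [1 / 2] and [1 / 4]. The first two run over all admissible
    blocks and pay [S = (n + 1) ^ (nu - 1)]; grouping by [tail] spares the third this factor. The
    division of the thresholds by [S] enters [K] as [S ^ (q - 2)], whence [S ^ (q - 1)] in
    [V * K]. *)
Lemma sampling_gt2_hcross : 2 < q -> exists2 c : R, 1 <= c &
  forall n N m l : nat, ((2 ^ n.+1).*2 < N)%N -> (0 < m)%N -> (0 < l)%N ->
  let B := c * (2 ^+ n * (n.+1%:R ^+ nu.-1) `^ (q - 1)) in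
  8 * B <= 2 ^+ l ->
  8 * 4 `^ q * l%:R * (2 `^ q * ((64 * 4 `^ q + 2 `^ q) * B *
      ln (4 * #|{ffun 'I_d.+1 -> 'I_N}|%:R))
    + 2 `^ q * B * ln (4 * l%:R)) <= m%:R ->
  exists x : 'I_m -> {ffun 'I_d.+1 -> 'I_N}, forall f, tp_sphere (hcross gamma n) q f ->
    (16 * 4 `^ q)^-1 <= m%:R^-1 * \sum_i `|f (x i)| `^ q <= 1 + 7 * 4 `^ q.
Proof.
move=> q2.
(* With this [a], [t ^ (2 - q)] contributes [w ^ (- 1 / 4)], and [w ^ (1 / 4)] is left after
   multiplication by [1 / delta = w ^ (1 / 2)]. *)
have a0 : 0 < (4 * (q - 2))^-1 by rewrite invr_gt0; lra.
set a := (4 * (q - 2))^-1 in a0.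
pose C b := geom_cst nu (ratio gamma b).
have C1 b : 0 < b -> 1 <= C b.
  by move=> b0; apply: geom_cst_ge1 => j jn; exact: (ratio2 g2 b0 jn).
have h0 : 0 < 2^-1 :> R by [].
have k0 : 0 < 4^-1 :> R by [].
pose D6 : R := 6 ^+ d.+1; pose D4 : R := 4 ^+ d.+1.
have D61 : 1 <= D6 by rewrite exprn_ege1//; lra.
have D41 : 1 <= D4 by rewrite exprn_ege1//; lra.
have Ca := C1 a a0; have Ch := C1 _ h0; have Ck := C1 _ k0.
have DC1 : 1 <= (D6 * C a) `^ (q - 2).
  by apply: powR_ge1; [nra|lra].
exists (D4 * C 2^-1 * (C 4^-1 * (D6 * C a) `^ (q - 2))).
  have : 1 <= D4 * C 2^-1 by nra.
  have : 1 <= C 4^-1 * (D6 * C a) `^ (q - 2) by nra.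
  by nra.
move=> n N m l nN m0 l0 B Bl mB.
pose S : R := n.+1%:R ^+ nu.-1.
have S1 : 1 <= S by rewrite exprn_ege1// ler1n.
pose idx := {ffun 'I_d.+1 -> 'I_n.+1}.
pose w (s : idx) := weight gamma s.
have w0 s : 0 < w s by exact: weight_gt0.
pose t s := w s `^ a / (D6 * C a * S).
pose delta s := w s `^ (- 2^-1).
have den : 0 < D6 * C a * S by rewrite !mulr_gt0//; lra.
have t0 s : 0 < t s by rewrite divr_gt0 ?powR_gt0.
have d0 s : 0 < delta s by rewrite powR_gt0.
have all_le b : 0 < b -> \sum_(s : idx | admissible gamma s) w s `^ b <= S * C b.
  move=> b0; apply: le_trans (_ : \sum_(s : idx | s ord0 == ord0) w s `^ b <= _).
    rewrite [leLHS]big_mkcond [leRHS]big_mkcond; apply: ler_sum => s _.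
    by rewrite /admissible; case: (s ord0 == ord0) => //=; case: ifP; rewrite ?powR_ge0.
  rewrite (eq_bigr (fun s : idx => \prod_j ratio gamma b j ^+ s j)); last first.
    by move=> s _; exact: weight_powR.
  by apply: (sum_geom_all n nu0 nud) => j jn; [exact: (ratio1 g1 b jn)|exact: (ratio2 g2 b0 jn)].
pose I := [pred s : idx | [forall j : 'I_d.+1, (j < nu)%N ==> (s j == ord0)]].
have tailI s : tail nu s \in I.
  by rewrite inE; apply/forallP => j; apply/implyP => jn; rewrite ffunE jn.
pose V := D4 * C 2^-1 * (2 ^+ n * S).
pose K := C 4^-1 * (D6 * C a) `^ (q - 2) * S `^ (q - 2).
have BE : B = V * K.
  rewrite /B /V /K -/S.
  have -> : S `^ (q - 1) = S * S `^ (q - 2).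
    rewrite -[S in S * _]powRr1 ?(le_trans _ S1)// -powRD; last by rewrite gt_eqF ?implybT//; lra.
    by congr (_ `^ _); ring.
  by ring.
have V0 : 0 < V by rewrite !mulr_gt0 ?exprn_gt0//; lra.
have Hn : (2 ^ n <= 2 ^ n.+1)%N by rewrite leq_exp2l.
have fib (F : idx -> R) (E : idx -> R) :
  \sum_u E u * (\sum_(s | admissible gamma s && (tail nu s == u)) F s) =
  \sum_(s | admissible gamma s) E (tail nu s) * F s.
  rewrite [RHS](partition_big (tail nu) xpredT)//=; apply: eq_bigr => u _.
  by rewrite mulr_sumr; apply: eq_bigr => s /andP[_ /eqP <-].
rewrite BE in Bl mB.
apply: (@sampling_gt2 R d.+1 n (2 ^ n.+1) N (hcross gamma n) q Hn nN q2 idx I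
  (fun u => blocks nu gamma u)
  (fun u => \sum_(s | admissible gamma s && (tail nu s == u)) D6) t delta V K
  t0 d0 V0 _ _ _ _ _ _ m l _ m0 l0 Bl mB).
- by move=> k kQ; exact: (sum_blocks_hcross nu0 nud g1 g2 kQ).
- move=> u uI k; rewrite /blocks big1// => s /andP[_ /eqP su].
  by move: uI; rewrite -su tailI.
- by move=> u x; exact: (avg_norm_kern_blocks g1 g2).
- under eq_bigr do rewrite mulrC.
  rewrite (fib (fun=> D6)).
  apply: le_trans (_ : \sum_(s : idx | admissible gamma s) w s `^ a * (C a * S)^-1 <= _).
    apply: ler_sum => s _; rewrite /t /w (weight_tail g1) le_eqVlt; apply/orP; left; apply/eqP.
    by field; rewrite !gt_eqF//; lra.
  rewrite -mulr_suml ler_pdivrMr ?mul1r; last by rewrite mulr_gt0//; lra.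
  by rewrite mulrC all_le.
- apply: le_trans (_ : \sum_u delta u * (\sum_(s | admissible gamma s && (tail nu s == u))
     D4 * 2 ^+ n * w s) <= _).
    by apply: ler_sum => u _; rewrite ler_pM2l// sum_blocks_sqr.
  rewrite fib; apply: le_trans (_ : \sum_(s : idx | admissible gamma s) w s `^ 2^-1 * (D4 * 2 ^+ n) <= _).
    apply: ler_sum => s _; rewrite /delta /w (weight_tail g1) -/(w s) le_eqVlt.
    apply/orP; left; apply/eqP.
    have E : w s = w s `^ 2^-1 * w s `^ 2^-1.
      rewrite -powRD ?(gt_eqF (w0 s)) ?implybT//.
      by rewrite (_ : 2^-1 + 2^-1 = 1) ?powRr1 ?ltW//; field.
    rewrite {2}E powRN; field.
    by rewrite gt_eqF// powR_gt0.
  rewrite -mulr_suml /V.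
  apply: le_trans (ler_wpM2r _ (all_le _ h0)) _.
    by rewrite mulr_ge0 ?exprn_ge0//; lra.
  by rewrite le_eqVlt; apply/orP; left; apply/eqP; ring.
- apply: le_trans (_ : \sum_(u in I) w u `^ 4^-1 * ((D6 * C a * S) `^ (q - 2)) <= _).
    apply: ler_sum => u _; rewrite le_eqVlt; apply/orP; left; apply/eqP.
    have wu : w u != 0 by rewrite gt_eqF.
    have -> : (delta u)^-1 = w u `^ 2^-1 by rewrite /delta powRN invrK.
    rewrite /t powRM ?powR_ge0 ?invr_ge0 ?(ltW den)// -powRrM mulrA -powRD ?(negbTE wu) ?implybT//.
    congr (_ * _).
      by congr (_ `^ _); rewrite /a; field; rewrite gt_eqF//; lra.
    rewrite -powR_inv1 ?(ltW den)// -powRrM.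
    by congr (_ `^ _); ring.
  have DC0 : 0 <= D6 * C a by rewrite mulr_ge0//; lra.
  have S0 : 0 <= S by lra.
  rewrite -mulr_suml (powRM _ DC0 S0).
  rewrite /K mulrA ler_wpM2r ?powR_ge0// ler_wpM2r ?powR_ge0//.
  rewrite (eq_bigr (fun s : idx => \prod_j ratio gamma 4^-1 j ^+ s j)); last first.
    by move=> s _; exact: weight_powR.
  by apply: (sum_geom_image n) => j jn; [exact: (ratio1 g1 _ jn)|exact: (ratio2 g2 k0 jn)].
- have V1 : 1 <= V by rewrite !mulr_ege1// exprn_ege1//; lra.
  have K1 : 1 <= K by rewrite !mulr_ege1//; apply: powR_ge1 => //; lra.
  exact: mulr_ege1.
Qed.

End HyperbolicSampling.

(** * Comparison of the grid with the torus *)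

(** Young's inequality for [a] and [u ^ (q - 1)]: the power lies above its tangent at [u]. *)
Lemma powR_tangent (R : realType) (q a u : R) : 1 <= q -> 0 <= a -> 0 <= u ->
  q * (a * u `^ (q - 1)) <= a `^ q + (q - 1) * u `^ q.
Proof.
move=> q1 a0 u0; have [->|qn1] := eqVneq q 1.
  by rewrite subrr powRr0 powRr1// mul0r addr0 mulr1 mul1r.
have q1' : 0 < q - 1 by rewrite subr_gt0 lt_neqAle eq_sym qn1.
have q0 : 0 < q by lra.
have := @conjugate_powR R a (u `^ (q - 1)) q (q / (q - 1)) a0 (powR_ge0 _ _) q0 (divr_gt0 q0 q1') _.
have -> : (u `^ (q - 1)) `^ (q / (q - 1)) = u `^ q.
  by rewrite -powRrM; congr (_ `^ _); field; rewrite gt_eqF.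
have e : q^-1 + (q / (q - 1))^-1 = 1.
  by field; rewrite !gt_eqF.
move=> /(_ e) h; apply: le_trans (ler_wpM2l (ltW q0) h) _.
by rewrite le_eqVlt; apply/orP; left; apply/eqP; field; rewrite !gt_eqF.
Qed.

Lemma powR_sub_le (R : realType) (q a b : R) : 1 <= q -> 0 <= a -> 0 <= b ->
  b `^ q - a `^ q <= q * (b `^ (q - 1) * (b - a)).
Proof.
move=> q1 a0 b0; have := powR_tangent q1 a0 b0.
have bq : b * b `^ (q - 1) = b `^ q by rewrite mulr_powRB1//; lra.
by rewrite mulrBr [b `^ (q - 1) * b]mulrC bq [b `^ (q - 1) * a]mulrC; lra.
Qed.

(* Jensen's inequality for the total mass [avg p], only bounded by [C]. *)
Lemma avg_powR_le (R : realType) (T : finType) (q C : R) (p a : T -> R) :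
  1 <= q -> 0 < C -> (forall x, 0 <= p x) -> (forall x, 0 <= a x) -> avg p <= C ->
  (avg (fun x => p x * a x)) `^ q <= C `^ (q - 1) * avg (fun x => p x * a x `^ q).
Proof.
move=> q1 C0 p0 a0 pC; set s := avg _; set T' := avg (fun x => p x * a x `^ q).
have s0 : 0 <= s by apply: avg_ge0 => x; rewrite mulr_ge0.
(* The tangent is taken at the mean computed as if the total mass were exactly [C]. *)
pose u := s / C; have u0 : 0 <= u by rewrite divr_ge0// ltW.
have h : q * (s * u `^ (q - 1)) <= T' + (q - 1) * u `^ q * avg p.
  rewrite /s /T' -avgZr -!avgZl -avgD; apply: ler_avg => x.
  have := ler_wpM2l (p0 x) (powR_tangent q1 (a0 x) u0); lra.
have uq : u `^ q = s / C * u `^ (q - 1) by rewrite -/u mulr_powRB1//; lra.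
have h2 : (q - 1) * u `^ q * avg p <= (q - 1) * (s * u `^ (q - 1)).
  apply: le_trans (_ : (q - 1) * u `^ q * C <= _).
    by rewrite ler_wpM2l// mulr_ge0 ?powR_ge0//; lra.
  rewrite uq le_eqVlt; apply/orP; left; apply/eqP; field; by rewrite gt_eqF.
have h3 : s * u `^ (q - 1) <= T' by lra.
have -> : s `^ q = C `^ (q - 1) * (s * u `^ (q - 1)).
  rewrite mulrCA -powRM ?(ltW C0)// /u [C * _]mulrC mulfVK ?gt_eqF//.
  by rewrite mulr_powRB1//; lra.
by rewrite ler_wpM2l// powR_ge0.
Qed.

Section TwoGrids.
Variables (R : realType) (d n : nat) (Q : {set freq_box d n}) (a b : freq_box d n -> R).

Definition vpd (k : 'I_d -> nat) : R := \prod_j vp R n (k j).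

Lemma vpd_freq (k : freq_box d n) : vpd (fun j => `|freq k j|%N) = 1.
Proof.
rewrite /vpd big1// => j _; rewrite vp_eq1// /freq; have := ltn_ord (k j); lia.
Qed.

Lemma avg_norm_vpd (N : nat) (x : 'I_d -> R) : ((2 ^ n.+1).*2 < N)%N ->
  avg (fun z : {ffun 'I_d -> 'I_N} =>
    `|kern (2 ^ n.+1) vpd (fun j => x j - gpt R z j)|) <= 3 ^+ d.
Proof.
move=> nN; rewrite -[d in leRHS]card_ord -prodr_const;
apply: (@avg_norm_kern_prod R d (2 ^ n.+1) N (fun=> vp R n) (fun=> 3)) => j t.
by apply: avg_norm_kern1_vp.
Qed.

Lemma kernN (H : nat) (w : ('I_d -> nat) -> R) (x y : 'I_d -> R) :
  kern H w (fun j => x j - y j) = kern H w (fun j => y j - x j).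
Proof.
apply: eq_bigr => k _; congr (_ * _); apply: eq_bigr => j _.
by rewrite -cosN -mulrN opprB.
Qed.

Lemma trig_absE (x : 'I_d -> R) :
  trig_abs Q a b x = Num.sqrt (tp Q a b x ^+ 2 + tp Q b (fun k => - a k) x ^+ 2).
Proof.
rewrite /trig_abs /tp; congr (Num.sqrt (_ + _ ^+ 2)); apply: eq_bigr => k _.
by rewrite mulNr opprK addrC.
Qed.

(** [tp Q b (- a)] is the imaginary part. Pairing the reproducing formulas of both parts with the
    vector of values at [x] gives [r ^ 2 <= r * A], the triangle inequality for a complex average in
    real terms. *)
Lemma trig_abs_kern (N : nat) (x : 'I_d -> R) : ((2 ^ n.+1).*2 < N)%N ->
  trig_abs Q a b x <= avg (fun z : {ffun 'I_d -> 'I_N} =>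
    `|kern (2 ^ n.+1) vpd (fun j => x j - gpt R z j)| * trig_abs Q a b (gpt R z)).
Proof.
move=> nN.
have Hn : (2 ^ n <= 2 ^ n.+1)%N by rewrite leq_exp2l.
have w1 k : k \in Q -> vpd (fun j => `|freq k j|%N) = 1 by move=> _; exact: vpd_freq.
set r := trig_abs Q a b x; set A := avg _.
set u := tp Q a b; set v := tp Q b (fun k => - a k).
have r2 : r ^+ 2 = u x ^+ 2 + v x ^+ 2.
  by rewrite /r trig_absE sqr_sqrtr// addr_ge0 ?sqr_ge0.
have r0 : 0 <= r by exact: sqrtr_ge0.
have : r ^+ 2 <= r * A.
  rewrite r2 2!expr2 -{2}[u x](avg_kern_tp a b x Hn nN w1).
  rewrite -{2}[v x](avg_kern_tp b (fun k => - a k) x Hn nN w1) -!avgZl -avgD.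
  apply: ler_avg => z; set kz := kern _ _ _.
  have -> : u x * (kz * tp Q a b (gpt R z)) + v x * (kz * tp Q b (fun k => - a k) (gpt R z)) =
     kz * (u x * u (gpt R z) + v x * v (gpt R z)) by rewrite /u /v; ring.
  apply: le_trans (ler_norm _) _; rewrite normrM mulrCA ler_wpM2l//.
  rewrite -(ler_pXn2r (n := 2))// ?nnegrE ?mulr_ge0 ?sqrtr_ge0// real_normK ?num_real//.
  rewrite exprMn r2 trig_absE sqr_sqrtr ?addr_ge0 ?sqr_ge0// -/(u _) -/(v _).
  (* Lagrange's identity for the inner product of two plane vectors. *)
  by have := sqr_ge0 (u x * v (gpt R z) - v x * u (gpt R z)); nra.
have [-> _|rn0] := eqVneq r 0.
  by apply: avg_ge0 => z; rewrite mulr_ge0// sqrtr_ge0.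
by rewrite expr2 ler_pM2l// lt_neqAle eq_sym rn0.
Qed.

(** Jensen's inequality over the grid of size [N] costs [C ^ (q - 1)]; after exchanging averages,
    the symmetric kernel averaged over the grid of size [M] costs [C]. The constant is independent
    of both sizes, so either grid may be refined towards the torus. *)
Lemma two_grids (q : R) (M N : nat) : 1 <= q -> ((2 ^ n.+1).*2 < M)%N -> ((2 ^ n.+1).*2 < N)%N ->
  avg (fun x : {ffun 'I_d -> 'I_M} => trig_abs Q a b (gpt R x) `^ q) <=
  (3 ^+ d) `^ q * avg (fun z : {ffun 'I_d -> 'I_N} => trig_abs Q a b (gpt R z) `^ q).
Proof.
move=> q1 nM nN; set C : R := 3 ^+ d.
have C0 : 0 < C by rewrite exprn_gt0.
pose p x z : R := `|kern (2 ^ n.+1) vpd (fun j => x j - z j)|.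
have ta0 x : 0 <= trig_abs Q a b x by exact: sqrtr_ge0.
apply: le_trans (_ : avg (fun x : {ffun 'I_d -> 'I_M} => C `^ (q - 1) *
   avg (fun z : {ffun 'I_d -> 'I_N} => p (gpt R x) (gpt R z) * trig_abs Q a b (gpt R z) `^ q)) <= _).
  apply: ler_avg => x.
  apply: le_trans (avg_powR_le q1 C0 (fun z => normr_ge0 _) (fun z => ta0 _) (avg_norm_vpd _ nN)).
  by apply: ler_powR2r; [lra|exact: ta0|exact: trig_abs_kern].
rewrite avgZl exchange_avg.
have -> : C `^ q = C `^ (q - 1) * C by rewrite mulrC mulr_powRB1 ?ltW//; lra.
rewrite -mulrA ler_wpM2l ?powR_ge0// -avgZl; apply: ler_avg => z.
rewrite avgZr ler_wpM2r ?powR_ge0//.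
apply: le_trans (avg_norm_vpd (gpt R z) nM).
by rewrite le_eqVlt; apply/orP; left; apply/eqP; apply: eq_avg => x; rewrite /p kernN.
Qed.

End TwoGrids.

(** * The torus average as a limit of grid averages *)

Section UniformContinuity.
Variable R : realType.
Implicit Types (g : (nat -> R) -> R) (y : nat -> R).

Definition close (dlt : R) y y' := forall i, `|y i - y' i| <= dlt.

Definition modulus dlt eps g := forall y y', close dlt y y' -> `|g y - g y'| <= eps.

Definition ucont g := forall eps, 0 < eps -> exists2 dlt, 0 < dlt & modulus dlt eps g.

Definition upd y m t : nat -> R := fun i => if i == m then t else y i.

Definition circle_avg (h : R -> R) : R :=
  (2 * pi)^-1 * \int[@lebesgue_measure R]_(t in `[0, 2 * pi[%classic) h t.

Lemma integrable_continuous (h : R -> R) (a b : R) (i : interval R) : continuous h ->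
  [set` i] `<=` [set` `[a, b]] ->
  (@lebesgue_measure R).-integrable [set` i] (EFin \o h).
Proof.
move=> ch iab.
have h1 : (@lebesgue_measure R).-integrable [set` `[a, b]] (EFin \o h).
  by apply: continuous_compact_integrable; [exact: segment_compact|exact: continuous_subspaceT].
apply: (integrableS (mu := @lebesgue_measure R) _ _ _ h1); [exact: measurable_itv..|exact: iab].
Qed.

Lemma integral_step (h : R -> R) (c eps a b : R) : continuous h -> a <= b ->
  (forall t, a <= t -> t <= b -> `|h t - c| <= eps) ->
  `|\int[@lebesgue_measure R]_(t in [set` `[a, b[]) h t - c * (b - a)| <= eps * (b - a).
Proof.
move=> ch ab hc.
have sub : [set` `[a, b[] `<=` [set` `[a, b]].
  by move=> t /=; rewrite !in_itv /= => /andP[-> /ltW ->].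
have ih := integrable_continuous ch sub.
have ic (r : R) : (@lebesgue_measure R).-integrable [set` `[a, b[] (EFin \o (fun=> r)).
  by apply: (integrable_continuous _ sub); exact: cst_continuous.
have mi : measurable ([set` `[a, b[] : set R) by exact: measurable_itv.
have len : fine ((@lebesgue_measure R) [set` `[a, b[]) = b - a.
  rewrite lebesgue_measure_itv /= lte_fin; case: ltP => //= ba.
  by apply/esym/eqP; rewrite subr_eq0 eq_le ba ab.
have cstE r : \int[@lebesgue_measure R]_(t in [set` `[a, b[]) r = r * (b - a).
  by rewrite Rintegral_cst// -len.
rewrite -cstE -RintegralB// -[eps * _]cstE.
have iB : (@lebesgue_measure R).-integrable [set` `[a, b[] (EFin \o (fun t => h t - c)).
  apply: (integrable_continuous _ sub) => t.
  by apply: cvgB; [exact: ch|exact: cvg_cst].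
apply: le_trans (le_normr_Rintegral _ iB) _; first exact: measurable_itv.
apply: le_Rintegral => //.
  apply: (integrable_continuous _ sub) => t.
  by apply: cvg_norm; apply: cvgB; [exact: ch|exact: cvg_cst].
by move=> t /=; rewrite in_itv /= => /andP[at_ /ltW tb]; exact: hc.
Qed.

Lemma two_pi_gt0 : 0 < 2 * pi :> R.
Proof. by rewrite mulr_gt0// pi_gt0. Qed.

Lemma circle_avgB_le (h k : R -> R) (eps : R) : continuous h -> continuous k ->
  (forall t, `|h t - k t| <= eps) -> `|circle_avg h - circle_avg k| <= eps.
Proof.
move=> ch ck hk; have p0 := two_pi_gt0.
have sub : [set` `[0, 2 * (pi : R)[] `<=` [set` `[0, 2 * pi]].
  by move=> t /=; rewrite !in_itv /= => /andP[-> /ltW ->].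
have cB : continuous (fun t => h t - k t).
  by move=> t; apply: cvgB; [exact: ch|exact: ck].
rewrite /circle_avg -mulrBr -RintegralB//; last 2 first.
- exact: integrable_continuous ch sub.
- exact: integrable_continuous ck sub.
rewrite normrM ger0_norm ?invr_ge0 ?(ltW p0)// ler_pdivrMl//.
have hk' t : 0 <= t -> t <= 2 * pi -> `|h t - k t - 0| <= eps by rewrite subr0.
have H := integral_step cB (ltW p0) hk'.
by rewrite mul0r !subr0 [eps * _]mulrC in H.
Qed.

Lemma circle_avg_riemann (h : R -> R) (eps : R) (N : nat) : continuous h -> (0 < N)%N ->
  (forall t t', `|t - t'| <= 2 * pi / N%:R -> `|h t - h t'| <= eps) ->
  `|circle_avg h - avg (fun i : 'I_N => h (node R i))| <= eps.
Proof.
move=> ch N0 hm; have p0 := two_pi_gt0.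
have NR : 0 < N%:R :> R by rewrite ltr0n.
pose st : R := 2 * pi / N%:R; have st0 : 0 < st by rewrite divr_gt0.
pose J k := \int[@lebesgue_measure R]_(t in [set` `[0, k%:R * st[]) h t.
have main k : `|J k - \sum_(i < k) h (i%:R * st) * st| <= eps * st *+ k.
  elim: k => [|k IH].
    rewrite big_ord0 subr0 mulr0n /J mul0r set_itvco0 Rintegral_set0 normr0//.
  have le1 : k%:R * st <= k.+1%:R * st by rewrite ler_pM2r// ler_nat.
  have le0 : 0 <= k%:R * st by rewrite mulr_ge0// ltW.
  have -> : J k.+1 = J k + \int[@lebesgue_measure R]_(t in [set` `[k%:R * st, k.+1%:R * st[]) h t.
    rewrite /J -Rintegral_setU; last 4 first.
    - exact: measurable_itv.
    - exact: measurable_itv.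
    - rewrite -itv_bndbnd_setU ?bnd_simp//.
      apply: (integrable_continuous (a := 0) (b := k.+1%:R * st)) => //.
      by move=> t /=; rewrite !in_itv /= => /andP[-> /ltW ->].
    - apply/disj_setPS => t /= []; rewrite !in_itv /= => /andP[_ h1] /andP[h2 _].
      by move: (lt_le_trans h1 h2); rewrite ltxx.
    by rewrite -itv_bndbnd_setU ?bnd_simp.
  rewrite big_ord_recr /= [eps * st *+ k.+1]mulrS.
  set I := Rintegral _ _ _.
  have -> : J k + I - (\sum_(i < k) h (i%:R * st) * st + h (k%:R * st) * st) =
    (I - h (k%:R * st) * st) + (J k - \sum_(i < k) h (i%:R * st) * st) by ring.
  apply: le_trans (ler_normD _ _) _; apply: lerD => //.
  have stE : k.+1%:R * st - k%:R * st = st by rewrite -natr1; ring.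
  have := @integral_step h (h (k%:R * st)) eps (k%:R * st) (k.+1%:R * st) ch le1.
  rewrite stE; apply => t t1 t2; apply: hm; rewrite -/st ger0_norm ?subr_ge0//; lra.
have := main N; rewrite /J.
have -> : N%:R * st = 2 * pi by rewrite /st mulrC mulfVK ?gt_eqF.
rewrite /circle_avg => hN.
have -> : avg (fun i : 'I_N => h (node R i)) = (2 * pi)^-1 * \sum_(i < N) h (i%:R * st) * st.
  rewrite /avg card_ord -mulr_suml mulrCA mulrC /st.
  have -> : (2 * pi)^-1 * (2 * pi / N%:R) = N%:R^-1 :> R by rewrite mulrA mulVf ?mul1r// gt_eqF.
  congr (_ * _); apply: eq_bigr => i _; congr h; rewrite /node; field.
  by rewrite gt_eqF.
rewrite -mulrBr normrM ger0_norm ?invr_ge0 ?(ltW p0)// ler_pdivrMl//.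
apply: le_trans hN _; rewrite -mulr_natr -mulrA /st mulfVK ?gt_eqF//.
by rewrite mulrC.
Qed.

Lemma ucont_upd_continuous g y m : ucont g -> continuous (fun t => g (upd y m t)).
Proof.
move=> ug t; apply/cvgrPdist_le => e e0; have [dl dl0 hd] := ug e e0.
near=> s; apply: hd => i; rewrite /upd; case: eqP => _.
  by near: s; exact: cvgr_dist_le.
by rewrite subrr normr0 ltW.
Unshelve. all: by end_near.
Qed.

Lemma torus_avg_recS m g y :
  torus_avg_rec m.+1 g y = circle_avg (fun t => torus_avg_rec m g (upd y m t)).
Proof. by []. Qed.

Lemma close_upd dlt y y' m t t' : close dlt y y' -> `|t - t'| <= dlt ->
  close dlt (upd y m t) (upd y' m t').
Proof. by move=> yy tt i; rewrite /upd; case: eqP. Qed.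

(** Averaging in one coordinate does not worsen a modulus of continuity. The same induction supplies
    the continuity of the inner averages that integrability requires. *)
Lemma torus_avg_modulus m g : ucont g -> (forall dlt eps, 0 <= dlt -> modulus dlt eps g ->
   modulus dlt eps (torus_avg_rec m g)) /\ ucont (torus_avg_rec m g).
Proof.
move=> ug.
suff h : forall dlt eps, 0 <= dlt -> modulus dlt eps g -> modulus dlt eps (torus_avg_rec m g).
  split => // eps e0; have [dl dl0 hd] := ug eps e0; exists dl => //.
  by apply: h => //; exact: ltW.
elim: m => [|m IH] // dlt eps dlt0 gm y y' yy.
rewrite !torus_avg_recS.
have um : ucont (torus_avg_rec m g).
  move=> e e0; have [dl dl0 hd] := ug e e0; exists dl => //.
  by apply: IH => //; exact: ltW.
apply: circle_avgB_le; [exact: ucont_upd_continuous|exact: ucont_upd_continuous|].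
move=> t; apply: (IH dlt eps) => //; apply: close_upd => //.
by rewrite subrr normr0.
Qed.

Fixpoint grid_avg_rec (N m : nat) g y : R :=
  if m is m'.+1 then avg (fun i : 'I_N => grid_avg_rec N m' g (upd y m' (node R i))) else g y.

(** The modulus survives the averages already taken, so each coordinate costs one Riemann-sum error
    [eps]. *)
Lemma torus_avg_grid (N m : nat) g (eps : R) : ucont g -> (0 < N)%N ->
  modulus (2 * pi / N%:R) eps g ->
  forall y, `|torus_avg_rec m g y - grid_avg_rec N m g y| <= m%:R * eps.
Proof.
move=> ug N0 gm; have st0 : 0 <= 2 * pi / N%:R :> R by rewrite divr_ge0// ltW// two_pi_gt0.
elim: m => [|m IH] y; first by rewrite subrr normr0 mul0r.
rewrite torus_avg_recS /=.
have [mm um] := torus_avg_modulus m ug.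
set T := circle_avg _; set G := avg _.
have -> : T - G = (T - avg (fun i : 'I_N => torus_avg_rec m g (upd y m (node R i)))) +
   avg (fun i : 'I_N => torus_avg_rec m g (upd y m (node R i)) - grid_avg_rec N m g (upd y m (node R i))).
  by rewrite avgB /G; ring.
apply: le_trans (ler_normD _ _) _; rewrite -natr1 mulrDl mul1r addrC; apply: lerD.
  apply: le_trans (ler_norm_avg _) _.
  rewrite -[leRHS](@avg_cst R 'I_N) ?card_ord//; apply: ler_avg => i; exact: IH.
apply: (circle_avg_riemann (h := fun t => torus_avg_rec m g (upd y m t))) => //.
  exact: ucont_upd_continuous.
move=> t t' tt; apply: (mm _ _ st0 gm); apply: close_upd => // i.
by rewrite subrr normr0.
Qed.

Lemma grid_avg_recE (N m : nat) g y : (0 < N)%N ->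
  grid_avg_rec N m g y = avg (fun z : {ffun 'I_m -> 'I_N} =>
    g (fun i => if insub i is Some j then node R (z j) else y i)).
Proof.
move=> N0; elim: m y => [|m IH] y /=.
  rewrite -[LHS](@avg_cst R {ffun 'I_0 -> 'I_N}); last by rewrite card_ffun card_ord expn_gt0 N0.
  apply: eq_avg => z; congr g; apply/funext => i; case: insubP => [j _ _|_ //].
  by have := ltn_ord j; rewrite ltn0.
transitivity (avg (fun i : 'I_N => avg (fun z : {ffun 'I_m -> 'I_N} =>
    g (fun l => if insub l is Some j then node R (z j) else upd y m (node R i) l)))).
  by apply: eq_avg => i; rewrite IH.
rewrite /avg -mulr_sumr mulrA !card_ffun !card_ord expnS natrM invfM.
congr (_ * _); rewrite pair_big /=.
(* The recursion averages coordinate [m] outermost, so a grid point is split at its last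
   coordinate. *)
pose e (p : 'I_N * {ffun 'I_m -> 'I_N}) : {ffun 'I_m.+1 -> 'I_N} :=
  [ffun i => if unlift ord_max i is Some j then p.2 j else p.1].
pose e' (u : {ffun 'I_m.+1 -> 'I_N}) : 'I_N * {ffun 'I_m -> 'I_N} :=
  (u ord_max, [ffun j => u (lift ord_max j)]).
rewrite [RHS](reindex e); last first.
  exists e' => [[i z]|u] _.
    rewrite /e' /e; congr pair; first by rewrite ffunE unlift_none.
    by apply/ffunP => j; rewrite !ffunE liftK.
  apply/ffunP => i; rewrite !ffunE; case: unliftP => [j ->|->] //=.
  by rewrite ffunE.
apply: eq_bigr => -[i z] _ /=; congr g; apply/funext => l.
case: insubP => [j lm jl|]; case: insubP => [j' lm' jl'|].
- rewrite ffunE; have -> : j' = lift ord_max j by apply: ord_inj; rewrite lift_max; exact: etrans jl' (esym jl).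
  by rewrite liftK.
- by rewrite -leqNgt => h; move: (leq_trans h (ltnW lm)); rewrite ltnn.
- rewrite -leqNgt => ml; have lE : l = m by apply/eqP; rewrite eqn_leq ml andbT -ltnS.
  rewrite /upd lE eqxx ffunE.
  by have -> : j' = ord_max by [apply: val_inj; rewrite /= jl' lE]; rewrite unlift_none.
- rewrite -!leqNgt => lm ml; rewrite /upd ifF//; apply/eqP => lE.
  by move: lm; rewrite lE ltnn.
Qed.

End UniformContinuity.

Section UniformContinuityRules.
Variable R : realType.
Implicit Types (g h : (nat -> R) -> R) (y : nat -> R).

Lemma ucont_lin c i : ucont (fun y => c * y i).
Proof.
move=> e e0; have c1 : 0 < `|c| + 1 by rewrite ltr_wpDl.
exists (e / (`|c| + 1)); first by rewrite divr_gt0.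
move=> y y' yy; rewrite -mulrBr normrM; apply: le_trans (ler_wpM2l (normr_ge0 _) (yy i)) _.
rewrite mulrCA ler_piMr ?(ltW e0)// ler_pdivrMr// mul1r; lra.
Qed.

Lemma closeW (dl dl' : R) y y' : dl <= dl' -> close dl y y' -> close dl' y y'.
Proof. by move=> dd yy i; exact: le_trans (yy i) dd. Qed.

Lemma ucontD g h : ucont g -> ucont h -> ucont (fun y => g y + h y).
Proof.
move=> ug uh e e0; have e20 : 0 < e / 2 by lra.
have [dg dg0 hg] := ug _ e20; have [dh dh0 hh] := uh _ e20.
exists (Num.min dg dh); first by rewrite lt_min dg0.
move=> y y' yy.
have h1 := hg y y' (closeW (_ : _ <= dg) yy); have h2 := hh y y' (closeW (_ : _ <= dh) yy).
have -> : g y + h y - (g y' + h y') = (g y - g y') + (h y - h y') by ring.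
apply: le_trans (ler_normD _ _) _.
have m1 : Num.min dg dh <= dg by rewrite ge_min lexx.
have m2 : Num.min dg dh <= dh by rewrite ge_min lexx orbT.
by have := h1 m1; have := h2 m2; lra.
Qed.

Lemma ucont_sum (I : Type) (r : seq I) (P : pred I) (F : I -> (nat -> R) -> R) :
  (forall i, ucont (F i)) -> ucont (fun y => \sum_(i <- r | P i) F i y).
Proof.
move=> uF; elim: r => [|i r IH].
  by move=> e e0; exists 1 => // y y' _; rewrite !big_nil subrr normr0 ltW.
case Pi : (P i).
  move=> e e0; have [dl dl0 hd] := ucontD (uF i) IH e0; exists dl => // y y' /hd.
  by rewrite !big_cons Pi.
move=> e e0; have [dl dl0 hd] := IH e e0; exists dl => // y y' /hd.
by rewrite !big_cons Pi.
Qed.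

Lemma ucont_comp g (f : R -> R) : (forall e, 0 < e -> exists2 dl, 0 < dl &
    forall s t, `|s - t| <= dl -> `|f s - f t| <= e) -> ucont g -> ucont (fun y => f (g y)).
Proof.
move=> uf ug e e0; have [df df0 hf] := uf e e0; have [dg dg0 hg] := ug df df0.
by exists dg => // y y' yy; apply: hf; exact: hg.
Qed.

Lemma ucontZ c g : ucont g -> ucont (fun y => c * g y).
Proof.
apply: (@ucont_comp g (fun t => c * t)) => e e0.
have c1 : 0 < `|c| + 1 by rewrite ltr_wpDl.
exists (e / (`|c| + 1)); first by rewrite divr_gt0.
move=> s t st; rewrite -mulrBr normrM; apply: le_trans (ler_wpM2l (normr_ge0 _) st) _.
by rewrite mulrCA ler_piMr ?(ltW e0)// ler_pdivrMr// mul1r; lra.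
Qed.

Lemma small_angle (e : R) : 0 < e -> exists2 dl, 0 < dl &
  forall h : R, `|h| <= dl -> `|cos h - 1| <= e /\ `|sin h| <= e.
Proof.
move=> e0.
have := @continuous_cos R 0; move/cvgrPdist_le => /(_ e e0) /nbhs_ballP[d1 /= d10 h1].
have := @continuous_sin R 0; move/cvgrPdist_le => /(_ e e0) /nbhs_ballP[d2 /= d20 h2].
exists (Num.min d1 d2 / 2); first by rewrite divr_gt0// lt_min d10.
move=> h hd; have hlt : `|h| < Num.min d1 d2.
  have : 0 < Num.min d1 d2 by rewrite lt_min d10.
  by lra.
split.
  have := h1 h; rewrite /ball /= sub0r normrN cos0 distrC; apply.
  by apply: lt_le_trans hlt _; rewrite ge_min lexx.
have := h2 h; rewrite /ball /= sub0r normrN sin0 sub0r normrN; apply.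
by apply: lt_le_trans hlt _; rewrite ge_min lexx orbT.
Qed.

Lemma cos_uniform (e : R) : 0 < e -> exists2 dl, 0 < dl &
    forall s t : R, `|s - t| <= dl -> `|cos s - cos t| <= e.
Proof.
move=> e0; have [dl dl0 hd] := small_angle (divr_gt0 e0 (ltr0n _ 2)).
exists dl => // s t /hd[h1 h2].
have -> : cos s - cos t = cos t * (cos (s - t) - 1) - sin t * sin (s - t).
  have {1}-> : s = t + (s - t) by ring.
  by rewrite cosD; ring.
apply: le_trans (ler_normB _ _) _; rewrite !normrM.
have := cos_max t; have := sin_max t => hs hc.
have : `|cos t| * `|cos (s - t) - 1| <= 1 * (e / 2) by rewrite ler_pM.
have : `|sin t| * `|sin (s - t)| <= 1 * (e / 2) by rewrite ler_pM.
by lra.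
Qed.

Lemma sin_uniform (e : R) : 0 < e -> exists2 dl, 0 < dl &
    forall s t : R, `|s - t| <= dl -> `|sin s - sin t| <= e.
Proof.
move=> e0; have [dl dl0 hd] := cos_uniform e0; exists dl => // s t st.
rewrite -![sin _]cosBpihalf.
by apply: hd; have -> : s - pi / 2 - (t - pi / 2) = s - t by ring.
Qed.

Lemma sqrt_lipschitz (a b c e : R) :
  `|Num.sqrt (a ^+ 2 + b ^+ 2) - Num.sqrt (c ^+ 2 + e ^+ 2)| <= `|a - c| + `|b - e|.
Proof.
have key (x y z t : R) : Num.sqrt (x ^+ 2 + y ^+ 2) <=
    Num.sqrt (z ^+ 2 + t ^+ 2) + (`|x - z| + `|y - t|).
  set r := Num.sqrt (z ^+ 2 + t ^+ 2).
  have r0 : 0 <= r by exact: sqrtr_ge0.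
  have r2 : r ^+ 2 = z ^+ 2 + t ^+ 2 by rewrite sqr_sqrtr// addr_ge0 ?sqr_ge0.
  have zr : `|z| <= r by rewrite -sqrtr_sqr ler_wsqrtr// lerDl sqr_ge0.
  have tr : `|t| <= r by rewrite -sqrtr_sqr ler_wsqrtr// lerDr sqr_ge0.
  have u0 := normr_ge0 (x - z); have v0 := normr_ge0 (y - t).
  rewrite -[leRHS]ger0_norm; last by rewrite addr_ge0// addr_ge0.
  rewrite -sqrtr_sqr ler_wsqrtr//.
  have x2 : x ^+ 2 <= (`|z| + `|x - z|) ^+ 2.
    rewrite -[x ^+ 2]real_normK ?num_real// lerXn2r ?nnegrE ?addr_ge0//.
    by have := ler_normD z (x - z); rewrite addrC subrK.
  have y2 : y ^+ 2 <= (`|t| + `|y - t|) ^+ 2.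
    rewrite -[y ^+ 2]real_normK ?num_real// lerXn2r ?nnegrE ?addr_ge0//.
    by have := ler_normD t (y - t); rewrite addrC subrK.
  have z2 : `|z| ^+ 2 = z ^+ 2 by rewrite real_normK ?num_real.
  have t2 : `|t| ^+ 2 = t ^+ 2 by rewrite real_normK ?num_real.
  apply: le_trans (lerD x2 y2) _; rewrite !sqrrD z2 t2 r2.
  have : `|z| * `|x - z| <= r * `|x - z| by rewrite ler_wpM2r.
  have : `|t| * `|y - t| <= r * `|y - t| by rewrite ler_wpM2r.
  have : 0 <= `|x - z| * `|y - t| by rewrite mulr_ge0.
  move: `|z| `|t| `|x - z| `|y - t| => Z T u v h3 h2 h1; rewrite -subr_ge0.
  rewrite [leRHS](_ : _ = 2 * (r * u - Z * u) + 2 * (r * v - T * v) + 2 * (u * v)); last by ring.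
  by rewrite !addr_ge0// mulr_ge0// subr_ge0.
have h1 := key a b c e; have h2 := key c e a b.
rewrite [`|c - a|]distrC [`|e - b|]distrC in h2.
by rewrite ler_norml; apply/andP; split; lra.
Qed.

Lemma powR_uniform (q B : R) : 1 <= q -> 0 <= B ->
  forall s t, 0 <= s <= B -> 0 <= t <= B ->
  `|s `^ q - t `^ q| <= q * B `^ (q - 1) * `|s - t|.
Proof.
move=> q1 B0.
have key s t : 0 <= s -> 0 <= t <= B -> t `^ q - s `^ q <= q * B `^ (q - 1) * `|s - t|.
  move=> s0 /andP[t0 tB]; apply: le_trans (powR_sub_le q1 s0 t0) _.
  rewrite -mulrA ler_wpM2l//; first by lra.
  apply: le_trans (_ : t `^ (q - 1) * `|s - t| <= _).
    by rewrite ler_wpM2l ?powR_ge0// distrC ler_norm.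
  by rewrite ler_wpM2r//; apply: ler_powR2r => //; lra.
move=> s t sB tB; have /andP[s0 _] := sB; have /andP[t0 _] := tB.
have h1 := key s t s0 tB; have h2 := key t s t0 sB; rewrite distrC in h2.
by rewrite ler_norml; apply/andP; split; lra.
Qed.

End UniformContinuityRules.

Section TorusGrid.
Variables (R : realType) (d n : nat) (Q : {set freq_box d n}) (a b : freq_box d n -> R).

Definition restr (y : nat -> R) : 'I_d -> R := fun j => y (nat_of_ord j).

Lemma ucont_phase (k : freq_box d n) : ucont (fun y => phase k (restr y)).
Proof. by apply: ucont_sum => j; exact: ucont_lin. Qed.

Lemma ucont_tp (u v : freq_box d n -> R) : ucont (fun y => tp Q u v (restr y)).
Proof.
apply: ucont_sum => k; apply: ucontD.
  by apply: ucontZ; apply: (@ucont_comp R _ cos); [exact: cos_uniform|exact: ucont_phase].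
move=> e e0.
have us : ucont (fun y => - v k * sin (phase k (restr y))).
  by apply: ucontZ; apply: (@ucont_comp R _ sin); [exact: sin_uniform|exact: ucont_phase].
have [dl dl0 hd] := us e e0; exists dl => // y y' /hd.
by rewrite !mulNr.
Qed.

Lemma tp_bound (u v : freq_box d n -> R) (x : 'I_d -> R) :
  `|tp Q u v x| <= \sum_(k in Q) (`|u k| + `|v k|).
Proof.
apply: le_trans (ler_norm_sum _ _ _) _; apply: ler_sum => k _.
apply: le_trans (ler_normB _ _) _; rewrite !normrM.
by apply: lerD; rewrite ler_piMr ?cos_max ?sin_max.
Qed.

(** A polynomial is bounded, and on a bounded interval the power is Lipschitz because [q >= 1]. *)
Lemma ucont_trig_abs_powR (q : R) : 1 <= q ->
  ucont (fun y => trig_abs Q a b (restr y) `^ q).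
Proof.
move=> q1.
pose B : R := Num.sqrt ((\sum_(k in Q) (`|a k| + `|b k|)) ^+ 2 +
   (\sum_(k in Q) (`|b k| + `|- a k|)) ^+ 2).
have B0 : 0 <= B by exact: sqrtr_ge0.
have tB x : 0 <= trig_abs Q a b x <= B.
  rewrite sqrtr_ge0 /= trig_absE /B ler_wsqrtr//.
  rewrite -[tp Q a b x ^+ 2]real_normK ?num_real//.
  rewrite -[tp Q b _ x ^+ 2]real_normK ?num_real//.
  have s0 (u v : freq_box d n -> R) : 0 <= \sum_(k in Q) (`|u k| + `|v k|).
    by apply: sumr_ge0 => k _; exact: addr_ge0.
  apply: lerD; rewrite lerXn2r ?nnegrE ?s0 ?tp_bound//.
have C0 : 0 < q * B `^ (q - 1) + 1.
  by rewrite ltr_wpDl// mulr_ge0 ?powR_ge0//; lra.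
move=> e e0; pose e' := e / (q * B `^ (q - 1) + 1) / 2.
have e'0 : 0 < e' by rewrite !divr_gt0.
have [d1 d10 h1] := ucont_tp a b e'0.
have [d2 d20 h2] := ucont_tp b (fun k => - a k) e'0.
exists (Num.min d1 d2); first by rewrite lt_min d10.
move=> y y' yy.
apply: le_trans (powR_uniform q1 B0 (tB _) (tB _)) _.
rewrite !trig_absE; apply: le_trans (ler_wpM2l _ (sqrt_lipschitz _ _ _ _)) _.
  by rewrite mulr_ge0 ?powR_ge0//; lra.
have k1 := h1 y y' (closeW (_ : Num.min d1 d2 <= d1) yy).
have k2 := h2 y y' (closeW (_ : Num.min d1 d2 <= d2) yy).
have m1 : Num.min d1 d2 <= d1 by rewrite ge_min lexx.
have m2 : Num.min d1 d2 <= d2 by rewrite ge_min lexx orbT.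
apply: le_trans (_ : q * B `^ (q - 1) * (e' + e') <= _).
  rewrite ler_wpM2l ?lerD ?k1 ?k2// mulr_ge0 ?powR_ge0//; lra.
have -> : e' + e' = e / (q * B `^ (q - 1) + 1) by rewrite /e'; field; rewrite gt_eqF.
by rewrite mulrCA ler_piMr ?(ltW e0)// ler_pdivrMr// mul1r; lra.
Qed.

Lemma torus_avg_grid_limit (q : R) (e : R) : 1 <= q -> 0 < e ->
  exists N0, forall N, (N0 <= N)%N ->
   `|Lq_pow q (trig_abs Q a b) - avg (fun z : {ffun 'I_d -> 'I_N} => trig_abs Q a b (gpt R z) `^ q)| <= e.
Proof.
move=> q1 e0; have ug := ucont_trig_abs_powR q1.
have e'0 : 0 < e / (d%:R + 1) by rewrite divr_gt0// ltr_wpDl.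
have [dl dl0 hd] := ug _ e'0.
have p0 := two_pi_gt0 R.
exists (Num.truncn (2 * pi / dl)).+1 => N NN.
have N0 : (0 < N)%N by exact: leq_trans NN.
have NR : 0 < N%:R :> R by rewrite ltr0n.
have mo : modulus (2 * pi / N%:R) (e / (d%:R + 1)) (fun y => trig_abs Q a b (restr y) `^ q).
  move=> y y' yy; apply: hd; apply: closeW yy.
  rewrite ler_pdivrMr// [dl * _]mulrC -ler_pdivrMr//.
  by apply: ltW; apply: lt_le_trans (truncnS_gt _) _; rewrite ler_nat.
have := torus_avg_grid d ug N0 mo (fun=> 0).
rewrite grid_avg_recE// => h.
have -> : Lq_pow q (trig_abs Q a b) = torus_avg_rec d (fun y => trig_abs Q a b (restr y) `^ q) (fun=> 0).
  rewrite /Lq_pow /torus_avg; congr torus_avg_rec; apply/funext => y.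
  by rewrite ger0_norm// sqrtr_ge0.
have -> : avg (fun z : {ffun 'I_d -> 'I_N} => trig_abs Q a b (gpt R z) `^ q) =
   avg (fun z : {ffun 'I_d -> 'I_N} => trig_abs Q a b (restr (fun i =>
       if insub i is Some j then node R (z j) else 0)) `^ q).
  apply: eq_avg => z; congr (trig_abs Q a b _ `^ q); apply/funext => j.
  by rewrite /restr valK.
apply: le_trans h _; rewrite mulrCA ler_piMr ?(ltW e0)//.
by rewrite ler_pdivrMr ?mul1r ?lerDl ?ltr_wpDl.
Qed.

(* Marcinkiewicz-Zygmund, by comparison with grids so fine that they approximate the torus. *)
Lemma torus_avg_grid_equiv (q : R) (N : nat) : 1 <= q -> ((2 ^ n.+1).*2 < N)%N ->
  let A := avg (fun z : {ffun 'I_d -> 'I_N} => trig_abs Q a b (gpt R z) `^ q) in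
  Lq_pow q (trig_abs Q a b) <= (3 ^+ d) `^ q * A /\
  A <= (3 ^+ d) `^ q * Lq_pow q (trig_abs Q a b).
Proof.
move=> q1 nN A; set L := Lq_pow _ _; set C := (3 ^+ d) `^ q.
have C0 : 0 < C by rewrite powR_gt0 ?exprn_gt0.
split; apply/ler_addgt0Pr => e e0.
  have [N0 h] := torus_avg_grid_limit q1 e0.
  pose M := maxn N0 (2 ^ n.+1).*2.+1.
  have := h M (leq_maxl _ _); rewrite ler_norml -/L => /andP[_ h1].
  have := @two_grids R d n Q a b q M N q1 (leq_maxr _ _) nN; rewrite -/A -/C => h2.
  lra.
have [N0 h] := torus_avg_grid_limit q1 (divr_gt0 e0 C0).
pose M := maxn N0 (2 ^ n.+1).*2.+1.
have := h M (leq_maxl _ _); rewrite ler_norml -/L => /andP[h1 _].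
have := @two_grids R d n Q a b q N M q1 nN (leq_maxr _ _); rewrite -/A -/C.
set X := avg _ in h1 *; move=> h2; apply: le_trans h2 _.
have : C * X <= C * (L + e / C) by rewrite ler_pM2l//; lra.
by rewrite mulrDr [C * (e / C)]mulrCA mulfV ?mulr1 ?gt_eqF.
Qed.

End TorusGrid.

(** * Cardinality of the hyperbolic cross *)

Lemma dyadic_block_inj (a b k : nat) :
  ((2 ^ a)./2 <= k < 2 ^ a)%N -> ((2 ^ b)./2 <= k < 2 ^ b)%N -> a = b.
Proof.
have half c e : (c < e)%N -> (2 ^ c <= (2 ^ e)./2)%N.
  by case: e => // e ce; rewrite expnS mul2n doubleK leq_exp2l.
move=> /andP[a1 a2] /andP[b1 b2]; case: (ltngtP a b) => // /half ab.
  by move: (leq_ltn_trans b1 a2); rewrite ltnNge ab.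
by move: (leq_ltn_trans a1 b2); rewrite ltnNge ab.
Qed.

(** The nonnegative frequencies alone suffice: there are [2 ^ s - (2 ^ s)./2] of them, at least half
    of [2 ^ s]. This includes [s = 0], where the block is just frequency 0. *)
Lemma card_dyadic_block (n s : nat) : (s <= n)%N ->
  (2 ^ s <= 2 * \sum_(i < (2 ^ n).*2.+1) ((2 ^ s)./2 <= `|ifreq i| < 2 ^ s))%N.
Proof.
move=> sn; have s2n : (2 ^ s <= 2 ^ n)%N by rewrite leq_exp2l.
set h := (2 ^ s)./2; pose m := (2 ^ s - h)%N.
have hs : (h < 2 ^ s)%N by rewrite /h; have := expn_gt0 2 s; lia.
have im (i : 'I_m) : (2 ^ n + h + i < (2 ^ n).*2.+1)%N by have := ltn_ord i; rewrite /m; lia.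
pose f (i : 'I_m) : 'I_(2 ^ n).*2.+1 := Ordinal (im i).
have fi : injective f by move=> i j /(congr1 val) /= /addnI ij; exact: val_inj.
rewrite -big_mkcond /= sum1_card; set c := #|_|.
have : (m <= c)%N.
  rewrite -[m in (m <= _)%N]card_ord -(card_codom fi); apply: subset_leq_card.
  apply/fintype.subsetP => _ /codomP[i ->]; rewrite unfold_in /ifreq /=.
  by have := ltn_ord i; rewrite /m; lia.
rewrite /m /h; lia.
Qed.

(** The [nu - 1] coordinates after the first with [gamma = 1] take any exponents up to
    [n / (d + 1)], and coordinate 0 takes the rest of [n]: this yields enough disjoint blocks of
    order [2 ^ n] each. The estimate turns the quantity [2 ^ n * n ^ (nu - 1)] of the kernel bounds
    into the cardinality of the cross. *)
Lemma card_hcross_ge (R : realType) (d n nu : nat) (gamma : 'I_d.+1 -> R) :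
  (0 < nu)%N -> (nu <= d.+1)%N -> (forall j : 'I_d.+1, (j < nu)%N -> gamma j = 1) ->
  (2 ^ n * n.+1 ^ nu.-1 <= 2 ^ d.+1 * d.+1 ^ nu.-1 * #|hcross gamma n|)%N.
Proof.
move=> nu0 nud g1; set k := nu.-1.
have kd : (k <= d)%N by rewrite /k; lia.
pose e := (n %/ d.+1)%N.
pose idx := {ffun 'I_k -> 'I_e.+1}.
pose ext (s : idx) (i : nat) : nat := if insub i is Some o then s o else 0%N.
pose tot (s : idx) : nat := (\sum_i s i)%N.
have totn s : (tot s <= n)%N.
  apply: leq_trans (_ : \sum_(i < k) e <= _)%N.
    by apply: leq_sum => i _; rewrite -ltnS ltn_ord.
  rewrite sum_nat_const card_ord; apply: leq_trans (leq_divM n d.+1).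
  by rewrite mulnC leq_mul2l; apply/orP; right; lia.
pose lev (s : idx) (j : 'I_d.+1) : nat := if j == ord0 then (n - tot s)%N else ext s j.-1.
have extn s i : (ext s i <= n)%N.
  rewrite /ext; case: insubP => // o _ _; apply: leq_trans (totn s).
  by rewrite /tot (bigD1 o)//= leq_addr.
have levn s j : (lev s j <= n)%N by rewrite /lev; case: ifP => // _; exact: leq_subr.
have ext_sum s : (\sum_(i < d) ext s i = tot s)%N.
  transitivity (\sum_(i < d | (i < k)%N) ext s i)%N.
    rewrite [RHS]big_mkcond; apply: eq_bigr => i _; case: ifPn => // ik.
    by rewrite /ext insubN.
  rewrite -(big_ord_widen d (ext s) kd); apply: eq_bigr => i _.
  by rewrite /ext valK.
have lev_sum s : (\sum_j lev s j = n)%N.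
  rewrite big_ord_recl /lev eqxx -[RHS](subnK (totn s)); congr addn.
  by rewrite -ext_sum; apply: eq_bigr.
have lev_ok s : step_ok gamma n (lev s).
  rewrite /step_ok -[in leRHS](lev_sum s) natr_sum; apply: ler_sum => j _.
  have [jn|jn] := ltnP j nu; first by rewrite g1// mul1r.
  have -> : lev s j = 0%N; last by rewrite mulr0.
  rewrite /lev; case: eqP => [j0|j0]; first by move: jn; rewrite j0 /=; lia.
  by rewrite /ext insubN// -leqNgt /k; lia.
pose inb (s : idx) (kk : freq_box d.+1 n) := in_rho (lev s) (freq kk).
have card_inb s : (2 ^ n <= 2 ^ d.+1 * \sum_(kk : freq_box d.+1 n) inb s kk)%N.
  have -> : (\sum_(kk : freq_box d.+1 n) inb s kk =
     \prod_j \sum_(i < (2 ^ n).*2.+1) ((2 ^ lev s j)./2 <= `|ifreq i| < 2 ^ lev s j))%N.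
    rewrite bigA_distr_bigA; apply: eq_bigr => kk _.
    rewrite /inb /in_rho; case: forallP => [h|h].
      by rewrite big1// => j _; rewrite /ifreq; have := h j; rewrite /freq => ->.
    have [j hj] : exists j, ~~ ((2 ^ lev s j)./2 <= `|freq kk j| < 2 ^ lev s j)%N.
      by apply/existsP; rewrite -negb_forall; apply/forallP.
    by rewrite (bigD1 j)//= /ifreq -/(freq kk j) (negbTE hj) mul0n.
  apply: leq_trans (_ : \prod_j 2 ^ lev s j <= _)%N; first by rewrite -expn_sum lev_sum.
  have -> : (2 ^ d.+1 = \prod_(j < d.+1) 2)%N by rewrite prod_nat_const card_ord.
  rewrite -big_split /=.
  by apply: leq_prod => j _; exact: card_dyadic_block.
(* The free exponents can be read off from the frequency by [dyadic_block_inj], so the blocks are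
   disjoint. *)
have uniq kk : (\sum_(s : idx) inb s kk <= (kk \in hcross gamma n))%N.
  have [[s hs]|ns] := pselect (exists s, inb s kk); last first.
    by rewrite big1// => s _; apply/eqP; rewrite eqb0; apply/negP => hs; apply: ns; exists s.
  have -> : kk \in hcross gamma n by rewrite inE; apply/asboolP; exists (lev s).
  rewrite (bigD1 s)//= hs big1 ?addn0// => t ts; apply/eqP; rewrite eqb0.
  apply: contra ts => ht; apply/eqP/ffunP => i; apply: val_inj => /=.
  have ik : (i.+1 < d.+1)%N by have := ltn_ord i; lia.
  pose j := Ordinal ik.
  have levj u : lev u j = u i by rewrite /lev /= /ext valK.
  have /forallP/(_ j) := hs; have /forallP/(_ j) := ht; rewrite !levj.
  exact: dyadic_block_inj.
have main : (#|idx| * 2 ^ n <= 2 ^ d.+1 * #|hcross gamma n|)%N.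
  rewrite -sum_nat_const.
  apply: leq_trans (_ : \sum_(s : idx) 2 ^ d.+1 * \sum_(kk : freq_box d.+1 n) inb s kk <= _)%N.
    by apply: leq_sum => s _; exact: card_inb.
  rewrite -big_distrr /= leq_mul2l; apply/orP; right.
  rewrite exchange_big /= -sum1_card [leqRHS]big_mkcond; apply: leq_sum => kk _.
  by apply: leq_trans (uniq kk) _; case: (_ \in _).
rewrite card_ffun !card_ord in main.
have ne : (n.+1 <= d.+1 * e.+1)%N.
  by rewrite mulnS mulnC; have := ltn_ceil n (ltn0Sn d); rewrite -/e; lia.
have : (n.+1 ^ k <= d.+1 ^ k * e.+1 ^ k)%N.
  by rewrite -expnMn; case: (k) => // k'; rewrite leq_exp2r.
move=> h; apply: leq_trans (leq_mul (leqnn _) h) _.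
rewrite mulnCA [(2 ^ d.+1 * _)%N]mulnC -mulnA leq_mul2l; apply/orP; right.
by rewrite mulnC.
Qed.

(** A crude bound is enough, since it enters only through the logarithm that counts levels. *)
Lemma card_hcross_le (R : realType) (d n : nat) (gamma : 'I_d -> R) :
  (#|hcross gamma n| <= 2 ^ (d * n.+2))%N.
Proof.
apply: leq_trans (max_card _) _; rewrite card_ffun !card_ord mulnC expnM.
case: (d) => // d'; rewrite leq_exp2r// expnS.
by have := expn_gt0 2 n; rewrite !expnS; lia.
Qed.

(** * Sampling on the hyperbolic cross *)

(** The least power of 2 exceeding twice the kernel degree [2 ^ (n + 1)]; its logarithm stays of
    order [n]. *)
Definition grid_size (n : nat) : nat := (2 ^ n.+3)%N.

Lemma grid_size_gt n : ((2 ^ n.+1).*2 < grid_size n)%N.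
Proof. by rewrite /grid_size !expnS; have := expn_gt0 2 n; lia. Qed.

Section Assembly.
Variables (R : realType) (d nu : nat) (gamma : 'I_d.+1 -> R) (q : R).
Hypotheses (nu0 : (0 < nu)%N) (nud : (nu <= d.+1)%N).
Hypothesis g1 : forall j : 'I_d.+1, (j < nu)%N -> gamma j = 1.
Hypothesis g2 : forall j : 'I_d.+1, (nu <= j)%N -> 1 < gamma j.

Lemma ln_card_grid (n : nat) : (0 < n)%N ->
  ln (4 * #|{ffun 'I_d.+1 -> 'I_(grid_size n)}|%:R) <= 6 * d.+1%:R * n%:R :> R.
Proof.
move=> n0; rewrite card_ffun !card_ord /grid_size -expnM.
have -> : 4 * (2 ^ (n.+3 * d.+1))%:R = 2 ^+ (2 + n.+3 * d.+1) :> R.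
  by rewrite natrX exprD; congr (_ * _); ring.
rewrite lnXn// -[X in X <= _]mulr_natr.
have l2 : ln 2 <= 1 :> R.
  have := @le_ln1Dx R 1; rewrite (_ : 1 + 1 = 2); last by ring.
  by apply; lra.
have l20 : 0 <= ln 2 :> R by rewrite ln_ge0// ler1n.
apply: le_trans (_ : (2 + n.+3 * d.+1)%:R <= _).
  by rewrite ler_piMl.
rewrite -!natrM ler_nat; nia.
Qed.

(** The cross is invariant under sign changes of the frequencies, so its indicator qualifies as a
    weight of [kern]; the kernel is then the Dirichlet kernel. *)
Lemma hcross_even (n : nat) : exists w : ('I_d.+1 -> nat) -> R,
  forall k : freq_box d.+1 n, w (fun j => `|freq k j|%N) = (k \in hcross gamma n)%:R.
Proof.
exists (fun kk => `[< exists s : 'I_d.+1 -> nat, step_ok gamma n s /\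
  [forall j, ((2 ^ s j)./2 <= kk j < 2 ^ s j)%N] >]%:R) => k.
by rewrite inE.
Qed.

Lemma card_hcross_gt0 (n : nat) : (0 < #|hcross gamma n|)%N.
Proof.
have := card_hcross_ge n nu0 nud g1; rewrite lt0n; apply: contraL => /eqP ->.
by rewrite muln0 -ltnNge muln_gt0 !expn_gt0.
Qed.

(** One factor [n] is the number [l] of levels, the other is [ln #|G|]. *)
Lemma grid_sampling_le2 : 1 <= q -> q <= 2 -> exists2 C : R, 0 < C &
  forall n m : nat, (0 < n)%N -> (0 < m)%N ->
    C * #|hcross gamma n|%:R * n%:R ^+ 2 <= m%:R ->
  exists x : 'I_m -> {ffun 'I_d.+1 -> 'I_(grid_size n)},
    forall f, tp_sphere (hcross gamma n) q f ->
    (16 * 4 `^ q)^-1 <= m%:R^-1 * \sum_i `|f (x i)| `^ q <= 1 + 7 * 4 `^ q.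
Proof.
move=> q1 q2; pose D : R := d.+1%:R.
have D1 : 1 <= D by rewrite ler1n.
have p4 : 0 < 4 `^ q :> R by rewrite powR_gt0.
have p2 : 0 < 2 `^ q :> R by rewrite powR_gt0.
pose C : R := 8 * 4 `^ q * (5 * D) * (2 `^ q * (4 * (8 * 16 * 64 * (6 * D))) + 20 * D).
have C0 : 0 < C.
  by rewrite mulr_gt0// ?addr_gt0// !mulr_gt0//; lra.
exists C => // n m n0 m0 mC.
have [w wQ] := hcross_even n.
have nN : ((2 ^ n).*2 < grid_size n)%N.
  by apply: leq_ltn_trans (grid_size_gt n); rewrite leq_double leq_exp2l.
have Q0 := card_hcross_gt0 n; set Q := hcross gamma n in wQ Q0 mC *.
(* From [4 * #|Q| <= 2 ^ (2 + (d + 1) * (n + 2))] and [n >= 1]. *)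
pose l := (5 * d.+1 * n)%N.
have l0 : (0 < l)%N by rewrite !muln_gt0.
have Ql : (4 * #|Q| <= 2 ^ l)%N.
  apply: leq_trans (leq_mul (leqnn 4) (card_hcross_le n gamma)) _.
  by rewrite -[4%N]/(2 ^ 2)%N -expnD leq_exp2l// /l; nia.
apply: (sampling_le2 wQ nN q1 q2 Q0 m0 l0 Ql).
apply: le_trans mC.
have Q1 : 0 < #|Q|%:R :> R by rewrite ltr0n.
have n1 : 1 <= n%:R :> R by rewrite ler1n.
have lE : l%:R = 5 * D * n%:R :> R by rewrite /l !natrM.
have lnl : ln (4 * (5 * D * n%:R)) <= 20 * D * n%:R :> R.
  apply: le_trans (ltW (ln_sublinear _)) _; first by rewrite !mulr_gt0//; lra.
  by lra.
have lnG := ln_card_grid n0; rewrite -/D in lnG.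
rewrite lE.
apply: le_trans (_ : 8 * 4 `^ q * (5 * D * n%:R) *
   (2 `^ q * (4 * (8 * 16 * 64 * #|Q|%:R * (6 * D * n%:R))) + #|Q|%:R * (20 * D * n%:R)) <= _).
  rewrite ler_pM2l; last by rewrite !mulr_gt0//; lra.
  apply: lerD; last by rewrite ler_pM2l.
  by rewrite !ler_pM2l// !mulr_gt0.
by rewrite le_eqVlt; apply/orP; left; apply/eqP; rewrite /C; ring.
Qed.

Lemma grid_sampling_gt2 : 2 < q -> exists2 C : R, 0 < C &
  forall n m : nat, (0 < n)%N -> (0 < m)%N ->
    C * #|hcross gamma n|%:R * n%:R `^ ((nu%:R - 1) * (q - 2) + 2) <= m%:R ->
  exists x : 'I_m -> {ffun 'I_d.+1 -> 'I_(grid_size n)},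
    forall f, tp_sphere (hcross gamma n) q f ->
    (16 * 4 `^ q)^-1 <= m%:R^-1 * \sum_i `|f (x i)| `^ q <= 1 + 7 * 4 `^ q.
Proof.
move=> q2; have [c c1 hc] := sampling_gt2_hcross nu0 nud g1 g2 q2.
have p4 : 0 < 4 `^ q :> R by rewrite powR_gt0.
have p2 : 0 < 2 `^ q :> R by rewrite powR_gt0.
pose k := nu.-1.
have kE : nu%:R - 1 = k%:R :> R by rewrite /k -[nu in LHS]prednK// -natr1; ring.
pose D : R := d.+1%:R.
have D1 : 1 <= D by rewrite ler1n.
(* Together [aa] and [bb] make [2 ^ ((aa + 1 + bb) * n)] at least [8 * B]: [aa] covers [8 * c], the
   1 covers [2 ^ n], and [bb] covers the power of [n + 1 <= 2 ^ n]. *)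
pose bb := (k * (Num.truncn q).+1)%N.
have kb : k%:R * (q - 1) <= bb%:R :> R.
  rewrite natrM ler_wpM2l//; have := truncnS_gt q; lra.
pose aa := (Num.truncn (8 * c)).+1.
have ca : 8 * c <= 2 ^+ aa.
  apply: ltW; apply: lt_le_trans (truncnS_gt _) _.
  by rewrite -natrX ler_nat ltnW// ltn_expl.
pose L : R := (aa + 1 + bb)%:R.
have L0 : 0 < L by rewrite ltr0n.
pose c' : R := c * (2 ^+ d.+1 * d.+1%:R ^+ k) * 2 `^ (k%:R * (q - 2)).
have c'0 : 0 < c'.
  by rewrite mulr_gt0 ?powR_gt0// mulr_gt0 ?mulr_gt0 ?exprn_gt0//; lra.
pose C : R := 8 * 4 `^ q * L * (2 `^ q * ((64 * 4 `^ q + 2 `^ q) * (6 * D)) + 2 `^ q * (4 * L)) * c'.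
have C0 : 0 < C.
  rewrite mulr_gt0// mulr_gt0//; first by rewrite !mulr_gt0.
  by rewrite addr_gt0// !mulr_gt0 ?addr_gt0 ?mulr_gt0//; lra.
exists C => // n m n0 m0 mC.
set Q := hcross gamma n in mC *.
have n1 : 1 <= n%:R :> R by rewrite ler1n.
pose S : R := n.+1%:R ^+ k.
have S1 : 1 <= S by rewrite exprn_ege1// ler1n.
pose B := c * (2 ^+ n * S `^ (q - 1)).
have B0 : 0 < B by rewrite !mulr_gt0 ?exprn_gt0 ?powR_gt0//; lra.
pose l := ((aa + 1 + bb) * n)%N.
have l0 : (0 < l)%N by rewrite muln_gt0 n0 andbT addn_gt0.
have lE : l%:R = L * n%:R :> R by rewrite natrM.
have SE r : S `^ r = n.+1%:R `^ (k%:R * r) by rewrite /S -powR_mulrn// -powRrM.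
have Bl : 8 * B <= 2 ^+ l.
  have -> : (2 : R) ^+ l = 2 ^+ (aa * n) * (2 ^+ n * 2 ^+ (bb * n)).
    by rewrite -!exprD /l; congr (_ ^+ _); ring.
  rewrite /B mulrA ler_pM ?mulr_ge0 ?powR_ge0//.
  - by lra.
  - apply: le_trans ca _; rewrite ler_weXn2l ?ler1n// leq_pmulr//.
  rewrite ler_pM2l ?exprn_gt0// SE.
  apply: le_trans (_ : (2 ^+ n) `^ (bb%:R) <= _).
    apply: le_trans (_ : (2 ^+ n) `^ (k%:R * (q - 1)) <= _).
      apply: ler_powR2r => //; first by rewrite mulr_ge0//; lra.
      by rewrite -natrX ler_nat ltn_expl.
    by apply: ler_powR => //; rewrite exprn_ege1// ler1n.
  by rewrite powR_mulrn ?exprn_ge0// -exprM mulnC.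
apply: (hc n (grid_size n) m l (grid_size_gt n) m0 l0 Bl).
apply: le_trans mC; rewrite -/S -/B lE.
have lnl : ln (4 * (L * n%:R)) <= 4 * L * n%:R :> R.
  apply: le_trans (ltW (ln_sublinear _)) _; first by rewrite !mulr_gt0// ltr0n.
  by rewrite mulrA.
have lnG := ln_card_grid n0; rewrite -/D in lnG.
(* One factor [S] goes into [#|Q|] by [card_hcross_ge]; the remaining [S ^ (q - 2)] becomes the
   power of [n], through [n + 1 <= 2 * n]. *)
have BQ : B <= c' * #|Q|%:R * n%:R `^ (k%:R * (q - 2)).
  have SS : S `^ (q - 1) = S * S `^ (q - 2).
    rewrite -[S in S * _]powRr1 ?(le_trans _ S1)// -powRD; last by rewrite gt_eqF ?implybT//; lra.
    by congr (_ `^ _); ring.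
  have h1 : 2 ^+ n * S <= 2 ^+ d.+1 * d.+1%:R ^+ k * #|Q|%:R.
    by have := card_hcross_ge n nu0 nud g1; rewrite -/k -/Q -(ler_nat R) !natrM !natrX.
  have h2 : S `^ (q - 2) <= 2 `^ (k%:R * (q - 2)) * n%:R `^ (k%:R * (q - 2)).
    rewrite SE -powRM//; apply: ler_powR2r => //; first by rewrite mulr_ge0//; lra.
    by rewrite -natr1; lra.
  rewrite /B SS mulrA.
  apply: le_trans (_ : c * ((2 ^+ d.+1 * d.+1%:R ^+ k * #|Q|%:R) *
     (2 `^ (k%:R * (q - 2)) * n%:R `^ (k%:R * (q - 2)))) <= _).
    rewrite -mulrA ler_wpM2l ?(le_trans _ c1)//.
    rewrite mulrA; apply: ler_pM => //; [|exact: powR_ge0].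
    by rewrite mulr_ge0 ?exprn_ge0// (le_trans _ S1).
  by rewrite le_eqVlt; apply/orP; left; apply/eqP; rewrite /c'; ring.
apply: le_trans (_ : 8 * 4 `^ q * (L * n%:R) * (2 `^ q * ((64 * 4 `^ q + 2 `^ q) * B * (6 * D * n%:R))
   + 2 `^ q * B * (4 * L * n%:R)) <= _).
  rewrite ler_pM2l; last by rewrite !mulr_gt0//; lra.
  apply: lerD; last by rewrite ler_pM2l// mulr_gt0.
  by rewrite !ler_pM2l// mulr_gt0// addr_gt0// mulr_gt0.
have nE : n%:R `^ ((nu%:R - 1) * (q - 2) + 2) = n%:R `^ (k%:R * (q - 2)) * n%:R ^+ 2 :> R.
  by rewrite kE powRD ?powR_sqr// pnatr_eq0 (gtn_eqF n0) implybT.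
rewrite nE.
set Y := 8 * 4 `^ q * L * (2 `^ q * ((64 * 4 `^ q + 2 `^ q) * (6 * D)) + 2 `^ q * (4 * L)).
have Y0 : 0 <= Y.
  rewrite /Y mulr_ge0//; first by rewrite !mulr_ge0 ?powR_ge0 ?(ltW L0).
  by rewrite addr_ge0// !mulr_ge0 ?addr_ge0 ?mulr_ge0 ?powR_ge0 ?(ltW L0)//; lra.
apply: le_trans (_ : Y * B * n%:R ^+ 2 <= _).
  by rewrite le_eqVlt; apply/orP; left; apply/eqP; rewrite /Y; ring.
apply: le_trans (_ : Y * (c' * #|Q|%:R * n%:R `^ (k%:R * (q - 2))) * n%:R ^+ 2 <= _).
  by rewrite ler_wpM2r ?exprn_ge0// ler_wpM2l.
by rewrite le_eqVlt; apply/orP; left; apply/eqP; rewrite /C /Y; ring.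
Qed.

End Assembly.

(** The exponents reached are at most [wexp nu q], as [Num.min q 3 >= 2] for [q > 2], and [n >= 1]
    allows them to be raised. *)
Lemma exists_sampling_points (R : realType) (d nu : nat) (gamma : 'I_d.+1 -> R) (q : R) :
  (0 < nu)%N -> (nu <= d.+1)%N ->
  (forall j : 'I_d.+1, (j < nu)%N -> gamma j = 1) ->
  (forall j : 'I_d.+1, (nu <= j)%N -> 1 < gamma j) ->
  1 <= q -> exists2 C : R, 0 < C &
  forall n m : nat, (0 < n)%N -> (0 < m)%N ->
    C * #|hcross gamma n|%:R * n%:R `^ (wexp nu q) <= m%:R ->
  exists x : 'I_m -> {ffun 'I_d.+1 -> 'I_(grid_size n)},
    forall f, tp_sphere (hcross gamma n) q f ->
    (16 * 4 `^ q)^-1 <= m%:R^-1 * \sum_i `|f (x i)| `^ q <= 1 + 7 * 4 `^ q.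
Proof.
move=> nu0 nud g1 g2 q1; have [q2|q2] := leP q 2.
  have [C C0 h] := grid_sampling_le2 nu0 nud g1 q1 q2.
  exists C => // n m n0 m0 mC; apply: h => //; apply: le_trans mC.
  rewrite ler_wpM2l ?mulr_ge0 ?(ltW C0)// -powR_sqr//; apply: ler_powR; first by rewrite ler1n.
  by rewrite /wexp q2; case: ifP => _; lra.
have [C C0 h] := grid_sampling_gt2 nu0 nud g1 g2 q2.
exists C => // n m n0 m0 mC; apply: h => //; apply: le_trans mC.
rewrite ler_wpM2l ?mulr_ge0 ?(ltW C0)//; apply: ler_powR; first by rewrite ler1n.
rewrite /wexp gt_eqF; last by lra.
rewrite (leNgt q) q2 lerD2l le_min (ltW q2) /=; lra.
Qed.

(** * From normalized real polynomials to arbitrary complex ones *)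

Section Homogeneity.
Variables (R : realType) (d n N m : nat) (Q : {set freq_box d n}) (q cl cu : R).
Variable x : 'I_m -> {ffun 'I_d -> 'I_N}.
Hypotheses (q0 : 0 < q) (N0 : (0 < N)%N).
Hypothesis sphere : forall f, tp_sphere Q q f ->
  cl <= m%:R^-1 * \sum_i `|f (x i)| `^ q <= cu.

Lemma sampling_tp a b : let A := avg (fun z : {ffun 'I_d -> 'I_N} => `|tp Q a b (gpt R z)| `^ q) in
  cl * A <= m%:R^-1 * \sum_i `|tp Q a b (gpt R (x i))| `^ q <= cu * A.
Proof.
rewrite /=; set A := avg _.
have A0 : 0 <= A by apply: avg_ge0 => z; exact: powR_ge0.
have G0 : (0 < #|{ffun 'I_d -> 'I_N}|)%N by rewrite card_ffun !card_ord expn_gt0 N0.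
(* A zero mean cannot be normalized, but it forces the polynomial to vanish on the whole grid,
   sample points included. *)
have [AE|An] := eqVneq A 0.
  have tp0 (z : {ffun 'I_d -> 'I_N}) : `|tp Q a b (gpt R z)| `^ q = 0.
    have S0 : \sum_(z : {ffun 'I_d -> 'I_N}) `|tp Q a b (gpt R z)| `^ q = 0.
      apply/eqP; move/eqP: AE; rewrite /A /avg mulf_eq0 invr_eq0 pnatr_eq0.
      by rewrite (gtn_eqF G0).
    by have /psumr_eq0P := S0; apply => // z' _; exact: powR_ge0.
  by rewrite AE big1 ?mulr0 ?lexx.
have Ap : 0 < A by rewrite lt_neqAle eq_sym An.
pose t := A `^ (- q^-1).
have t0 : 0 <= t by exact: powR_ge0.
have tq : t `^ q = A^-1.
  by rewrite /t -powRrM mulNr mulVf ?gt_eqF// powRN powRr1.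
pose f : {ffun {ffun 'I_d -> 'I_N} -> R} := [ffun z => t * tp Q a b (gpt R z)].
have fq z : `|f z| `^ q = A^-1 * `|tp Q a b (gpt R z)| `^ q.
  by rewrite ffunE normrM powRM// ger0_norm// tq.
have fS : tp_sphere Q q f.
  split; last by under eq_avg do rewrite fq; rewrite avgZl mulVf.
  exists (fun k => t * a k), (fun k => t * b k) => z.
  by rewrite ffunE /tp mulr_sumr; apply: eq_bigr => k _; ring.
have fE : \sum_i `|f (x i)| `^ q = A^-1 * \sum_i `|tp Q a b (gpt R (x i))| `^ q.
  by rewrite mulr_sumr; apply: eq_bigr => i _; exact: fq.
have := sphere fS.
by rewrite fE mulrCA ler_pdivlMl// ler_pdivrMl// ![A * _]mulrC.
Qed.

(** The sum of the [q]-th powers of the real and imaginary parts is at most [2 * |f| ^ q] and at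
    least [|f| ^ q / 2 ^ q], so the passage to complex values costs [2 * 2 ^ q] on either side. *)
Lemma sampling_trig_abs a b : 1 <= q -> 0 <= cl -> 0 <= cu ->
  let A := avg (fun z : {ffun 'I_d -> 'I_N} => trig_abs Q a b (gpt R z) `^ q) in
  let S := m%:R^-1 * \sum_i trig_abs Q a b (gpt R (x i)) `^ q in
  cl * A <= 2 * 2 `^ q * S /\ S <= 2 * 2 `^ q * cu * A.
Proof.
move=> q1 cl0 cu0 A S; set p := 2 `^ q.
have p0 : 0 < p by rewrite powR_gt0.
pose g (u v : freq_box d n -> R) (z : {ffun 'I_d -> 'I_N}) : R := `|tp Q u v (gpt R z)| `^ q.
pose na : freq_box d n -> R := fun k => - a k.
have ge1 z : trig_abs Q a b (gpt R z) `^ q <= p * (g a b z + g b na z).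
  apply: le_trans (powR_addl2 q1 (normr_ge0 _) (normr_ge0 _)).
  apply: ler_powR2r; [by lra|exact: sqrtr_ge0|].
  rewrite trig_absE -[leRHS]ger0_norm ?addr_ge0// -sqrtr_sqr ler_wsqrtr//.
  rewrite -[tp Q a b _ ^+ 2]real_normK ?num_real// -[tp Q b _ _ ^+ 2]real_normK ?num_real//.
  by rewrite sqrrD lerD2r lerDl mulrn_wge0// mulr_ge0.
have le1 z : g a b z + g b na z <= 2 * trig_abs Q a b (gpt R z) `^ q.
  rewrite [2 * _]mulr_natl mulr2n; apply: lerD;
    (apply: ler_powR2r; [by lra|exact: normr_ge0|]);
    by rewrite trig_absE -sqrtr_sqr ler_wsqrtr// ?lerDl ?lerDr sqr_ge0.
have /andP[l1 u1] := sampling_tp a b; have /andP[l2 u2] := sampling_tp b na.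
rewrite -/(g a b) -/(g b na) in l1 l2 u1 u2.
set A1 := avg _ in l1 u1; set A2 := avg _ in l2 u2.
set S1 := m%:R^-1 * _ in l1 u1; set S2 := m%:R^-1 * _ in l2 u2.
have AA : A <= p * (A1 + A2) by rewrite -avgD -avgZl; exact: ler_avg.
have AA' : A1 + A2 <= 2 * A by rewrite -avgD -avgZl; exact: ler_avg.
have SS : S <= p * (S1 + S2).
  rewrite -mulrDr mulrCA ler_wpM2l ?invr_ge0// -big_split mulr_sumr.
  by apply: ler_sum => i _; exact: ge1.
have SS' : S1 + S2 <= 2 * S.
  rewrite -mulrDr mulrCA ler_wpM2l ?invr_ge0// -big_split mulr_sumr.
  by apply: ler_sum => i _; exact: le1.
split.
  apply: le_trans (ler_wpM2l cl0 AA) _.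
  by rewrite mulrCA [2 * p]mulrC -mulrA ler_pM2l//; apply: le_trans SS'; rewrite mulrDr lerD.
apply: le_trans SS _; rewrite -mulrA [2 * _]mulrC -mulrA ler_pM2l//.
have := ler_wpM2l cu0 AA'; lra.
Qed.

End Homogeneity.

Theorem theorem1p2 (R : realType) (d : nat) (q : R) (gamma : 'I_d -> R) (nu : nat) :
  (1 <= d)%N -> 1 <= q ->
  (1 <= nu)%N -> (nu <= d)%N ->
  (forall j : 'I_d, (j < nu)%N -> gamma j = 1) ->
  (forall j : 'I_d, (nu <= j)%N -> 1 < gamma j) ->
  (forall i j : 'I_d, (nu <= i)%N -> (i <= j)%N -> gamma i <= gamma j) ->
  exists C1 C2 C3 : R, [/\ 0 < C1, 0 < C2 & 0 < C3] /\
    forall n m : nat, (1 <= n)%N -> (1 <= m)%N ->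
      C1 * #|hcross gamma n|%:R * powR n%:R (wexp nu q) <= m%:R ->
      exists xi : 'I_m -> 'I_d -> R,
        (forall (i : 'I_m) (j : 'I_d), 0 <= xi i j < 2 * pi) /\
        forall a b : freq_box d n -> R,
          let f := trig_abs (hcross gamma n) a b in
          C2 * Lq_pow q f <= m%:R^-1 * \sum_(i < m) powR `|f (xi i)| q /\
          m%:R^-1 * \sum_(i < m) powR `|f (xi i)| q <= C3 * Lq_pow q f.
Proof.
case: d gamma => // d' g _ q1 nu0 nud g1 g2 _.
have [C C0 hC] := exists_sampling_points nu0 nud g1 g2 q1.
set p : R := 2 * 2 `^ q; set T : R := (3 ^+ d'.+1) `^ q.
pose cl : R := (16 * 4 `^ q)^-1; pose cu : R := 1 + 7 * 4 `^ q.
have p0 : 0 < p by rewrite mulr_gt0// powR_gt0.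
have T0 : 0 < T by rewrite powR_gt0// exprn_gt0.
have cl0 : 0 < cl by rewrite invr_gt0 mulr_gt0// powR_gt0.
have cu0 : 0 < cu by rewrite addr_gt0// mulr_gt0// powR_gt0.
(* On either side, [p] is the loss from splitting into real and imaginary parts and [T] the loss
   between grid and torus. *)
exists C, (cl / p / T), (p * cu * T); split.
  by split => //; rewrite ?mulr_gt0 ?invr_gt0.
move=> n m n0 m0 mC; have [x hx] := hC n m n0 m0 mC.
exists (fun i => gpt R (x i)); split.
  move=> i j; rewrite /gpt /node.
  have N0 : (0 : R) < (grid_size n)%:R by rewrite ltr0n expn_gt0.
  have tp0 := two_pi_gt0 R.
  apply/andP; split; first by rewrite divr_ge0// mulr_ge0// ltW.
  rewrite ltr_pdivrMr// ltr_pM2l//.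
  by rewrite ltr_nat ltn_ord.
move=> a b f.
have fE y : `|f y| = f y by rewrite ger0_norm// sqrtr_ge0.
under eq_bigr do rewrite fE.
have q0 : 0 < q by lra.
have N0 : (0 < grid_size n)%N by rewrite expn_gt0.
have [h1 h2] := sampling_trig_abs q0 N0 hx a b q1 (ltW cl0) (ltW cu0).
have [k1 k2] := torus_avg_grid_equiv (hcross g n) a b q1 (grid_size_gt n).
rewrite -/f -/p -/cl -/cu -/T in h1 h2 k1 k2 *.
set S := _ * \sum_i _ in h1 h2 *; set A := avg _ in h1 h2 k1 k2.
split.
  rewrite -mulrA -mulrA.
  apply: le_trans (_ : cl * (p^-1 * A) <= _).
    by rewrite ler_pM2l// ler_pM2l ?invr_gt0// ler_pdivrMl.
  by rewrite mulrCA ler_pdivrMl.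
apply: le_trans h2 _; rewrite -[p * cu * T * _]mulrA ler_pM2l ?mulr_gt0//.
Qed.
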